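(* Let $f\in C^2(\mathbb R)$ satisfy $f'(0)\ge 0$ and $|f''(u)-f''(v)|\le L|u-v|$ for all $u,v\in\mathbb R$, for some constant $L$. Let $(\bar u,\bar\mu)\in\mathcal D$ and $\bar\xi=\bar\mu(\mathbb R_+)$. Consider a function $u=u(t,x)$ and a family of measures $\mu_{(t)}$, $t\ge0$, with $(u(t),\mu_{(t)})\in\mathcal D$ for all $t$, satisfying: (i) $u$ is locally H\''older continuous in $\mathbb R_+\times\mathbb R_+$ and is a solution (in the sense of the definition in the context) of $$u_t+f(u)_x=\tfrac12\int_0^xf''(u)u_x^2\,dx,\qquad u(t,0)=0,\qquad u(0,x)=\bar u(x);$$ (ii) $t\mapsto\mu_{(t)}$ is a measure-valued solution to the linear transport equation $w_t+[f'(u)w]_x=0$, $w(0)=\bar\mu$, and the singular part satisfies $f''(u(t))\,\mu^s_{(t)}=0$ for a.e. $t\ge 0$. Moreover, setting $$y(t,\xi)=\inf\{x\ge0:\ \mu_{(t)}([0,x])\ge\xi\},\qquad U(t,\xi)=u(t,y(t,\xi)),$$ assume that for a.e. $\xi\in[0,\bar\xi]$ the map $t\mapsto U(t,\xi)$ is absolutely continuous and satisfies the differential equation $$\frac{\partial U}{\partial t}(t,\xi)=\frac12\int_0^\xi f''(U(t,\eta))\,d\eta .$$ Then $(u(t),\mu_{(t)})=S_t(\bar u,\bar\mu)$ for all $t\ge 0$, where $S$ is the conservative semigroup described in the context. In particular, for given $(\bar u,\bar\mu)\in\mathcal D$, the solution $t\mapsto(u(t),\mu_{(t)})\in\mathcal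 D$ which satisfies (i), (ii) and the assumption that, for a.e. $\xi\in[0,\bar\xi]$, the map $t\mapsto U(t,\xi)=u(t,y(t,\xi))$ is absolutely continuous and satisfies $\frac{\partial U}{\partial t}(t,\xi)=\frac12\int_0^\xi f''(U(t,\eta))\,d\eta$, is unique.
   Context: Notation: $\mathbb R_+=[0,\infty[$. The domain $\mathcal D$ is the set of couples $(u,\mu)$ where $u:\mathbb R_+\to\mathbb R$ is a continuous function with $u(0)=0$ whose distributional derivative $u_x$ lies in $L^2(\mathbb R_+)$, and $\mu=\mu^a+\mu^s$ is a bounded nonnegative Radon measure on $\mathbb R_+$ whose absolutely continuous part (w.r.t. Lebesgue measure) satisfies $d\mu^a=u_x^2\,dx$; $\mu^s$ denotes the singular part. Solution: a function $u=u(t,x)$ on $[0,T]\times\mathbb R_+$ is a solution of the initial-boundary value problem with data $u(0,x)=\bar u(x)$, $u(t,0)=0$ if: (a) $u$ is locally H\''older continuous w.r.t. both variables; the initial and boundary conditions hold pointwise; for each $t$ the map $x\mapsto u(t,x)$ is absolutely continuous with $u_x(t,\cdot)\in L^2_{loc}(\mathbb R_+)$; (b) for any $M>0$, restricting $u$ to $x\in[0,M]$, the map $t\mapsto u(t,\cdot)\in L^2([0,M])$ is absolutely continuous and satisfies $$\frac{d}{dt}u(t,\cdot)=-f'(u)u_x+\frac12\int_0^{\,\cdot}f''(u)u_x^2\,dx$$ for a.e. $t\in[0,T]$, as an equality of functions in $L^2([0,M])$. A function on $\mathbb R_+\times\mathbb R_+$ is a solution if this holds for every $T>0$. Measure-valued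 solution: $t\mapsto\mu_{(t)}$ is a measure-valued solution of $w_t+[f'(u)w]_x=0$, $w(0)=\bar\mu$, if $\mu_{(0)}=\bar\mu$ and $$\int\phi(t_2,\cdot)\,d\mu_{(t_2)}-\int\phi(t_1,\cdot)\,d\mu_{(t_1)}=\int_{t_1}^{t_2}\left[\int\big[\phi_t(t,\cdot)+\phi_x(t,\cdot)f'(u(t,\cdot))\big]\,d\mu_{(t)}\right]dt$$ for all $t_2>t_1\ge0$ and every $C^1$ compactly supported function $\phi=\phi(t,x)$ on $\mathbb R_+\times\mathbb R_+$. The conservative semigroup $S:\mathcal D\times[0,\infty[\to\mathcal D$ is defined as follows. Given $(\bar u,\bar\mu)\in\mathcal D$ with $\bar\mu$ compactly supported, let $\bar\xi=\bar\mu(\mathbb R_+)$, $\bar y(\xi)=\inf\{x\ge0:\bar\mu([0,x])\ge\xi\}$ for $0<\xi\le\bar\xi$, and $\bar y(0)=\sup\{x:\bar\mu([0,x])=0\}$. Let $\hat U(t,\xi)$ be the unique continuous solution on $[0,\infty[\times[0,\bar\xi]$ of $\partial_t\hat U(t,\xi)=\frac12\int_0^\xi f''(\hat U(t,\eta))\,d\eta$ with $\hat U(0,\xi)=\bar u(\bar y(\xi))$, and put $\hat y(t,\xi)=\bar y(\xi)+\int_0^tf'(\hat U(\tau,\xi))\,d\tau$. Then $S_t(\bar u,\bar\mu)=(\hat u(t),\hat\mu_{(t)})$, where $\hat u(t,x)=\hat U(t,\hat\xi(t,x))$ with $\hat\xi(t,x)=\sup\{\xi\in[0,\bar\xi]:\hat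 y(t,\xi)\le x\}$ (and $\hat u(t,x)=0$ for $0\le x\le\hat y(t,0)$), and $\hat\mu_{(t)}$ is the push-forward of Lebesgue measure on $[0,\bar\xi]$ under $\xi\mapsto\hat y(t,\xi)$, i.e. $\hat\mu_{(t)}(J)=\mathrm{meas}\{\xi\in[0,\bar\xi]:\hat y(t,\xi)\in J\}$ for Borel $J\subset\mathbb R_+$. For general data in $\mathcal D$, $S_t$ is obtained by approximation with data whose measure is compactly supported, using that $S$ is continuous in the following sense: if $\bar u^n\to\bar u$ uniformly on bounded sets and $d(\bar\mu^n,\bar\mu)\to0$, then the first components of $S_t(\bar u^n,\bar\mu^n)$ converge uniformly on bounded sets of $(t,x)$ and the second components converge in $d$ for every $t>0$; here $d(\mu,\tilde\mu)=\sup_\varphi|\int\varphi\,d\mu-\int\varphi\,d\tilde\mu|$ over smooth $\varphi$ with $|\varphi|\le1$, $|\varphi_x|\le1$. *)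

(* Defs.v *)
From mathcomp Require Export all_boot all_order all_algebra.
From mathcomp Require Export all_classical all_reals all_analysis.

Set Implicit Arguments.
Unset Strict Implicit.
Unset Printing Implicit Defensive.
Export Order.TTheory GRing.Theory Num.Theory.
Export numFieldNormedType.Exports.

Global Open Scope ring_scope.
Global Open Scope classical_set_scope.

(* the analytic derivative also inside integrands, where ring_scope would read
   the notation as the formal derivative of a polynomial *)
Notation "f ^` ()" := (derive1 f) : ring_scope.
Notation "f ^` ( n )" := (derive1n n f) : ring_scope.

Section definitions.
Context {R : realType}.
Notation leb := (@lebesgue_measure R).
Implicit Types (f v w g : R -> R) (u phi U : R -> R -> R).

Definition Rplus : set R := `[0, +oo[.

(* Functions and measures on R_+ are represented by functions and finite Borel
   measures on R.  Values of functions at negative arguments are never used, and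
   the measures of the domain below do not charge ]-oo, 0[. *)
Definition fmeasure := {finite_measure set (measurableTypeR R) -> \bar R}.
Definition data : Type := ((R -> R) * fmeasure)%type.

Definition data_eq (p q : data) : Prop :=
  (forall x : R, 0 <= x -> p.1 x = q.1 x) /\
  (forall A, measurable A -> p.2 A = q.2 A).

Definition total_mass (nu : fmeasure) : R := fine (nu Rplus).

Definition smooth v : Prop := forall n x, derivable (v^`(n)) x 1.

Definition square_integrable (A : set R) v : Prop :=
  measurable_fun A v /\ (\int[leb]_(x in A) ((v x) ^+ 2)%:E < +oo)%E.

(* w is the derivative of v in the sense of distributions on ]0, +oo[ *)
Definition distr_derivative v w : Prop :=
  forall g : R -> R, smooth g ->
    (exists a b : R, 0 < a /\ forall x, ~ (a <= x <= b) -> g x = 0) ->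
    \int[leb]_(x in Rplus) (v x * g^`() x) =
    - \int[leb]_(x in Rplus) (w x * g x).

Definition lebesgue_decomposition (nu : fmeasure)
    (nua nus : {measure set (measurableTypeR R) -> \bar R}) : Prop :=
  [/\ forall A, measurable A -> nu A = (nua A + nus A)%E,
      nua `<< leb
    & exists N, [/\ measurable N, leb N = 0%E & nus (~` N) = 0%E]].

Definition in_domain (p : data) : Prop :=
  [/\ {within Rplus, continuous p.1}, p.1 0 = 0, p.2 (~` Rplus) = 0%E
    & exists w nua nus,
      [/\ distr_derivative p.1 w, square_integrable Rplus w,
          lebesgue_decomposition p.2 nua nus
        & forall A, measurable A ->
            nua A = \int[leb]_(x in A `&` Rplus) ((w x) ^+ 2)%:E]%E].

(* Absolute continuity on [a, b] of a map g with values in a (semi)normed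
   space, in terms of rho s t = |g t - g s|. *)
Definition abs_continuous (a b : R) (rho : R -> R -> \bar R) : Prop :=
  forall e : R, 0 < e -> exists2 d : R, 0 < d &
    forall (n : nat) (s t : 'I_n -> R),
      (forall i, a <= s i /\ s i <= t i /\ t i <= b) ->
      (forall i j, i != j -> t i <= s j \/ t j <= s i) ->
      \sum_(i < n) (t i - s i) < d ->
      (\sum_(i < n) rho (s i) (t i) < e%:E)%E.

Definition abs_continuous_fun (a b : R) v : Prop :=
  abs_continuous a b (fun s t => `|v t - v s|%:E).

Definition L2norm (M : R) v : \bar R :=
  'N[leb]_(2%:E)[EFin \o (v \_ `[0, M])].

(* Hoelder continuity in both variables on the bounded subsets of I x R_+ *)
Definition locally_hoelder (I : set R) u : Prop :=
  forall T M : R, exists C a : R, 0 < a <= 1 /\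
    forall s t x y : R, I s -> I t -> s <= T -> t <= T ->
      0 <= x <= M -> 0 <= y <= M ->
      `|u s x - u t y| <= C * (`|s - t| `^ a + `|x - y| `^ a).

(* u_x is the pointwise derivative, which exists a.e. since u t is absolutely
   continuous *)
Definition pde_rhs f u (t x : R) : R :=
  - (f^`() (u t x) * (u t)^`() x) +
  2^-1 * \int[leb]_(z in `[0, x]) (f^`(2) (u t z) * ((u t)^`() z) ^+ 2).

Definition solution_on f v (T : R) u : Prop :=
  [/\ locally_hoelder `[0, T] u,
      forall x : R, 0 <= x -> u 0 x = v x,
      forall t : R, 0 <= t <= T -> u t 0 = 0,
      forall t M : R, 0 <= t <= T -> 0 < M ->
        abs_continuous_fun 0 M (u t) /\ square_integrable `[0, M] (u t)^`()
    & forall M : R, 0 < M ->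
        abs_continuous 0 T (fun s t => L2norm M (u t \- u s)) /\
        {ae leb, forall t : R, 0 <= t <= T ->
          L2norm M (fun x => (u (t + h) x - u t x) / h - pde_rhs f u t x)
            @[h --> 0^'] --> 0%E}].

Definition solution f v u : Prop :=
  forall T : R, 0 < T -> solution_on f v T u.

(* C^1 functions with compact support on R_+ x R_+, given as restrictions of
   C^1 functions with compact support on the plane *)
Definition C1_test phi : Prop :=
  [/\ forall t x, derivable (phi^~ x) t 1 /\ derivable (phi t) x 1,
      continuous (fun z : R * R => (phi^~ z.2)^`() z.1),
      continuous (fun z : R * R => (phi z.1)^`() z.2)
    & exists K : R, forall t x : R, K < `|t| \/ K < `|x| -> phi t x = 0].

Definition measure_valued_solution f u (nu : fmeasure) (mu : R -> fmeasure)
    : Prop :=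
  (forall A, measurable A -> mu 0 A = nu A) /\
  forall phi, C1_test phi -> forall t1 t2 : R, 0 <= t1 -> t1 < t2 ->
    let G t := \int[mu t]_(x in Rplus)
                 ((phi^~ x)^`() t + (phi t)^`() x * f^`() (u t x)) in
    leb.-integrable `[t1, t2] (EFin \o G) /\
    \int[mu t2]_(x in Rplus) phi t2 x - \int[mu t1]_(x in Rplus) phi t1 x =
    \int[leb]_(t in `[t1, t2]) G t.

(* f''(v) nu^s = 0 as a measure on R_+ *)
Definition singular_part_vanishes f v (nu : fmeasure) : Prop :=
  exists nua nus, lebesgue_decomposition nu nua nus /\
    forall A, measurable A ->
      (\int[nus]_(x in A `&` Rplus) (f^`(2) (v x))%:E = 0)%E.

Definition mass_inverse (nu : fmeasure) (xi : R) : R :=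
  inf [set x : R | 0 <= x /\ (xi%:E <= nu `[0%R, x])%E].

Definition lagrangian u (mu : R -> fmeasure) (t xi : R) : R :=
  u t (mass_inverse (mu t) xi).

Definition lagrangian_ode f u (nu : fmeasure) (mu : R -> fmeasure) : Prop :=
  {ae leb, forall xi : R, 0 <= xi <= total_mass nu ->
    (forall T : R, 0 < T -> abs_continuous_fun 0 T ((lagrangian u mu)^~ xi)) /\
    {ae leb, forall t : R, 0 <= t ->
      is_derive t 1 ((lagrangian u mu)^~ xi)
        (2^-1 * \int[leb]_(eta in `[0, xi]) f^`(2) (lagrangian u mu t eta))}}.

Definition compactly_supported (nu : fmeasure) : Prop :=
  exists r : R, nu `]r, +oo[ = 0%E.

(* For nu = 0 the supremum at xi = 0 is +oo; the library then returns 0, which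
   gives the same solution u = 0. *)
Definition initial_position (nu : fmeasure) (xi : R) : R :=
  if xi == 0 then sup [set x : R | 0 <= x /\ nu `[0, x] = 0%E]
  else mass_inverse nu xi.

(* The equation at t = 0 with the one-sided derivative follows from the
   equation for t > 0 and the continuity of U. *)
Definition characteristic_solution f (p : data) U : Prop :=
  let m := total_mass p.2 in
  [/\ {within [set z : R * R | 0 <= z.1 /\ 0 <= z.2 <= m],
         continuous (fun z => U z.1 z.2)},
      forall xi : R, 0 <= xi <= m -> U 0 xi = p.1 (initial_position p.2 xi)
    & forall t xi : R, 0 < t -> 0 <= xi <= m ->
        is_derive t 1 (U^~ xi)
          (2^-1 * \int[leb]_(eta in `[0, xi]) f^`(2) (U t eta))].

Definition characteristic f (nu : fmeasure) U (t xi : R) : R :=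
  initial_position nu xi + \int[leb]_(s in `[0, t]) f^`() (U s xi).

Definition explicit_solution f (t : R) (p q : data) : Prop :=
  exists U, characteristic_solution f p U /\
    let m := total_mass p.2 in
    let y := characteristic f p.2 U t in
    (forall x : R, 0 <= x -> q.1 x =
       if x <= y 0 then 0
       else U t (sup [set xi : R | 0 <= xi <= m /\ y xi <= x])) /\
    (forall J, measurable J -> J `<=` Rplus ->
       q.2 J = leb [set xi : R | 0 <= xi <= m /\ J (y xi)]).

(* the metric d, as a (possibly infinite) supremum over smooth functions *)
Definition measure_dist (nu1 nu2 : fmeasure) : \bar R :=
  ereal_sup [set (`|\int[nu1]_(x in Rplus) g x - \int[nu2]_(x in Rplus) g x|)%:E
            | g in [set g : R -> R | smooth g /\
                      forall x : R, 0 <= x -> `|g x| <= 1 /\ `|g^`() x| <= 1]].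

Definition locally_uniform_cvg (vn : nat -> R -> R) v : Prop :=
  forall M e : R, 0 < e -> \forall n \near \oo,
    forall x : R, 0 <= x <= M -> `|vn n x - v x| < e.

Definition locally_uniform_cvg2 (un : nat -> R -> R -> R) u : Prop :=
  forall T M e : R, 0 < e -> \forall n \near \oo,
    forall t x : R, 0 <= t <= T -> 0 <= x <= M -> `|un n t x - u t x| < e.

(* The map S t p = S_t p on the domain: the explicit formula on data with
   compactly supported measure, extended to the whole domain by continuity.
   These clauses determine S t p, up to data_eq, for all t >= 0 and all p in the
   domain; at t = 0 the last clause is the statement S_0 = id. *)
Definition conservative_semigroup f (S : R -> data -> data) : Prop :=
  [/\ forall (t : R) (p : data), 0 <= t -> in_domain p -> in_domain (S t p),
      forall (t : R) (p : data), 0 <= t -> in_domain p ->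
        compactly_supported p.2 -> explicit_solution f t p (S t p)
    & forall (pn : nat -> data) (p : data),
        (forall n, in_domain (pn n)) -> in_domain p ->
        locally_uniform_cvg (fun n => (pn n).1) p.1 ->
        measure_dist (pn n).2 p.2 @[n --> \oo] --> 0%E ->
        locally_uniform_cvg2 (fun n t => (S t (pn n)).1) (fun t => (S t p).1) /\
        forall t : R, 0 <= t ->
          measure_dist (S t (pn n)).2 (S t p).2 @[n --> \oo] --> 0%E].

(* u_t + f(u)_x = 1/2 int_0^x f''(u) u_x^2 together with the transport equation
   for mu and the equation along characteristics *)
Definition conservative_solution f (p : data) u (mu : R -> fmeasure) : Prop :=
  [/\ forall t : R, 0 <= t -> in_domain (u t, mu t),
      locally_hoelder Rplus u /\ solution f p.1 u,
      measure_valued_solution f u p.2 mu,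
      {ae leb, forall t : R, 0 <= t -> singular_part_vanishes f (u t) (mu t)}
    & lagrangian_ode f u p.2 mu].

End definitions.

(* Main.v *)
Require Import Defs.
From mathcomp Require Import measurable_realfun ring lra.

(** Let [y t xi] be the generalized inverse of the distribution function of [mu t]
    ([mass_inverse]), and [U t xi] the value of [u t] at [y t xi] ([lagrangian]).
    The couple [(u t, mu t)] can be recovered from [y t] and [U t]: the inverse
    determines the distribution function, and [u t] is constant on the intervals
    without mass, because its energy there is at most the mass
    ([domain_lagrangian]). So the point is that the initial data determine [U] and
    [y].

    The equation for [U] is closed, and its right-hand side is Lipschitz in [U] for
    the supremum norm over the labels [0 <= xi <= X]. Two solutions, each absolutely
    continuous in time for almost every label, agree for almost every label: the
    supremum of [exp (- lam * t) * `|V t xi - W t xi|] is at most half of itself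
    when [lam] is large ([system_unique], which integrates an inequality between
    derivatives that holds almost everywhere by [ae_le_increment]). Since [y t] and
    [U t] are left continuous in the label, they agree for every label
    ([lagrangian_unique]).

    The trajectories [y] move with the speed [f' (U)]. Testing the transport equation
    with a cut-off that follows a line shows that the mass on the left of the line
    increases if the line is faster than the particles near it ([mass_fast_line])
    and decreases if it is slower ([mass_slow_line]). Because [u] is uniformly
    continuous on bounded sets, lines of slopes [f' (U) + e] and [f' (U) - e]
    squeeze [y] on both sides, forward and backward in time ([flow_local]). The
    energy bound gives [u ^+ 2 = O(1 + y)] along a trajectory, and [f'] grows at
    most quadratically, so the speed is [O(1 + y)] and trajectories stay bounded in
    finite time ([flow_speed_bound], [flow_reached]). Hence [U] and the initial
    positions determine [y]; this gives uniqueness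
    ([conservative_solution_unique]).

    To compare a solution with the semigroup, the data are truncated: beyond [k] the
    function is made constant and the measure is erased. This stays in the domain
    ([in_domain_truncation]), and the truncated data converge to the given ones in
    the sense in which the semigroup is continuous ([truncation_cvg]). The equation
    for the label [xi] involves smaller labels only, so the explicit solution with
    truncated data has the same [U] and [y] as the given solution for all labels up
    to the mass of [[0, k]] ([characteristic_lagrangian],
    [characteristic_position]). At a given point [x] the explicit formula therefore
    returns the given solution as soon as [k] is large, and convergence in the
    metric of measures identifies the distribution functions ([mass_limit]). *)

Set Implicit Arguments.
Unset Strict Implicit.
Unset Printing Implicit Defensive.

(** * Derivatives and smooth steps *)
Section derivatives.
Context {R : realType}.
Implicit Types (v w g : R -> R) (x y d e : R).

Lemma is_derive_epsP v x d :
  is_derive x 1 v d <->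
  forall e, 0 < e -> exists2 r : R, 0 < r &
    forall y, `|y - x| < r -> `|v y - v x - d * (y - x)| <= e * `|y - x|.
Proof.
split.
  move=> [dv dvE] e e0.
  have /cvgrPdist_le/(_ e e0) : h^-1 *: (v (h *: 1 + x) - v x) @[h --> 0^'] --> d.
    by rewrite -dvE.
  rewrite near_withinE => /nbhs_ballP[r r0 H]; exists r => // y yx.
  have [->|yNx] := eqVneq y x; first by rewrite !subrr mulr0 subrr normr0 mulr0.
  have {H} := H (y - x).
  rewrite /ball/= sub0r normrN => /(_ yx); rewrite subr_eq0 => /(_ yNx).
  rewrite scaler1 subrK => H.
  have xy0 : y - x != 0 by rewrite subr_eq0.
  have -> : v y - v x - d * (y - x) = - (d - (y - x)^-1 * (v y - v x)) * (y - x).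
    by field.
  by rewrite normrM normrN ler_wpM2r.
move=> H.
have C : h^-1 *: (v (h *: 1 + x) - v x) @[h --> 0^'] --> d.
  apply/cvgrPdist_le => e e0; have [r r0 {}H] := H _ e0.
  rewrite near_withinE; apply/nbhs_ballP; exists r => //= h.
  rewrite /ball/= sub0r normrN => hr h0; have := H (h + x).
  rewrite addrK scaler1 => /(_ hr).
  have -> : v (h + x) - v x - d * h = - (d - h^-1 *: (v (h + x) - v x)) * h.
    by rewrite /GRing.scale/=; field.
  by rewrite normrM normrN ler_pM2r// normr_gt0.
by apply: DeriveDef; [apply/cvg_ex; exists d|exact/cvg_lim].
Qed.

Lemma is_derive_local v w x d r : 0 < r ->
  (forall y, `|y - x| < r -> v y = w y) -> is_derive x 1 v d -> is_derive x 1 w d.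
Proof.
move=> r0 vw /is_derive_epsP H; apply/is_derive_epsP => e /H[s s0 {}H].
exists (Num.min r s); first by rewrite lt_min r0.
move=> y; rewrite lt_min => /andP[yr ys].
by rewrite -!vw ?subrr ?normr0//; exact: H.
Qed.

Lemma is_derive_ext v w x d d' :
  v = w -> d = d' -> is_derive x 1 v d -> is_derive x 1 w d'.
Proof. by move=> -> ->. Qed.

Lemma is_derive_derive1 v v' : (forall x, is_derive x 1 v (v' x)) -> v^`() = v'.
Proof. by move=> dv; apply/funext => x; rewrite derive1E derive_val. Qed.

Lemma derivable_is_derive v x : derivable v x 1 -> is_derive x 1 v (v^`() x).
Proof. by move=> dv; rewrite derive1E; exact: derivableP. Qed.

Lemma is_derive_continuous v x d : is_derive x 1 v d -> {for x, continuous v}.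
Proof. by move=> [dv _]; exact/differentiable_continuous/derivable1_diffP. Qed.

Lemma ball_continuousP v x : {for x, continuous v} <->
  forall e, 0 < e -> exists2 r : R, 0 < r & forall y, `|y - x| < r -> `|v y - v x| < e.
Proof.
split=> [/cvgrPdist_lt H e /H /nbhs_ballP[r r0 {}H]|H].
  exists r => // y yx; rewrite distrC; apply: H.
  by rewrite /ball/= distrC.
apply/cvgrPdist_lt => e /H[r r0 {}H]; apply/nbhs_ballP; exists r => // y.
by rewrite /ball/= distrC [X in _ -> X < _]distrC; exact: H.
Qed.

(** Functions with a prescribed number of derivatives; unlike [smooth], it can be
    proved by induction along the rules of differentiation. *)
Fixpoint times_derivable n v : Prop :=
  if n is n'.+1 then
    exists2 v', (forall x, is_derive x 1 v (v' x)) & times_derivable n' v'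
  else True.

Lemma times_derivable_pred n v : times_derivable n.+1 v -> times_derivable n v.
Proof.
elim: n v => // n IH v [v' dv v'n]; exists v' => //; exact: IH.
Qed.

Lemma smoothP v : smooth v <-> forall n, times_derivable n v.
Proof.
split=> [sv n|vn].
  elim: n v sv => // n IH v sv; exists v^`().
    by move=> x; apply: derivable_is_derive; exact: (sv 0%N).
  by apply: IH => k x; rewrite -derive1Sn; exact: sv.
move=> n; elim: n v vn => [|n IH] v vn x.
  by have [v' dv _] := vn 1%N; have [] := dv x.
rewrite derive1Sn; apply: IH => k.
by have [v' /is_derive_derive1 -> ] := vn k.+1.
Qed.

Lemma times_derivable_cst n (c : R) : times_derivable n (fun=> c).
Proof.
elim: n c => // n IH c; exists (fun=> 0) => // x.
exact: is_derive_cst.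
Qed.

Lemma times_derivableD n v w : times_derivable n v -> times_derivable n w ->
  times_derivable n (fun x => v x + w x).
Proof.
elim: n v w => // n IH v w [v' dv v'n] [w' dw w'n].
by exists (fun x => v' x + w' x); [move=> x; exact: is_deriveD|exact: IH].
Qed.

Lemma times_derivableM n v w : times_derivable n v -> times_derivable n w ->
  times_derivable n (fun x => v x * w x).
Proof.
elim: n v w => // n IH v w vn wn.
move: (times_derivable_pred vn) (times_derivable_pred wn) => vn' wn'.
case: vn wn => [v' dv v'n] [w' dw w'n].
exists (fun x => v' x * w x + v x * w' x); last by apply: times_derivableD; exact: IH.
move=> x; apply: is_derive_ext (is_deriveM (dv x) (dw x)) => //.
by rewrite /GRing.scale/=; ring.
Qed.

Lemma times_derivableV n v : (forall x, v x != 0) -> times_derivable n v ->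
  times_derivable n (fun x => (v x)^-1).
Proof.
move=> v0; elim: n v v0 => // n IH v v0 vn.
have /IH-/(_ v0) vin := times_derivable_pred vn.
case: vn => [v' dv v'n].
exists (fun x => -1 * (v x)^-1 * (v x)^-1 * v' x).
  move=> x; apply: is_derive_ext (is_deriveV (v0 x) (dv x)) => //.
  by rewrite /GRing.scale/= expr2 invfM; ring.
apply: times_derivableM => //; apply: times_derivableM => //.
by apply: times_derivableM => //; exact: times_derivable_cst.
Qed.

Lemma is_derive_affine x (a b : R) : is_derive x 1 (fun x => a * x + b) a.
Proof.
have ax := is_deriveM (is_derive_cst a x 1) (is_derive_id x 1).
apply: (is_derive_ext _ _ (is_deriveD ax (is_derive_cst b x 1))) => //.
by rewrite /GRing.scale/=; ring.
Qed.

Lemma times_derivable_affine n v (a b : R) : times_derivable n v ->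
  times_derivable n (fun x => v (a * x + b)).
Proof.
elim: n v => // n IH v [v' dv v'n].
exists (fun x => v' (a * x + b) * a); last first.
  by apply: times_derivableM; [exact: IH|exact: times_derivable_cst].
by move=> x; exact: (is_derive1_comp (dv _) (is_derive_affine x a b)).
Qed.

Lemma smoothM v w : smooth v -> smooth w -> smooth (fun x => v x * w x).
Proof. by move=> /smoothP sv /smoothP sw; apply/smoothP => n; exact: times_derivableM. Qed.

Lemma smoothD v w : smooth v -> smooth w -> smooth (fun x => v x + w x).
Proof. by move=> /smoothP sv /smoothP sw; apply/smoothP => n; exact: times_derivableD. Qed.

Lemma smooth_affine v (a b : R) : smooth v -> smooth (fun x => v (a * x + b)).
Proof. by move=> /smoothP sv; apply/smoothP => n; exact: times_derivable_affine. Qed.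

Lemma smooth_cst (c : R) : smooth (fun=> c).
Proof. by apply/smoothP => n; exact: times_derivable_cst. Qed.

Lemma smooth_is_derive v x : smooth v -> is_derive x 1 v (v^`() x).
Proof. by move=> sv; apply: derivable_is_derive; exact: (sv 0%N). Qed.

Lemma smooth_derive1 v : smooth v -> smooth v^`().
Proof. by move=> sv n x; rewrite -derive1Sn; exact: sv. Qed.

Lemma smooth_continuous v : smooth v -> continuous v.
Proof. by move=> sv x; exact: is_derive_continuous (smooth_is_derive x sv). Qed.

(** Up to coefficients, the derivatives of [exp (- 1 / x)] are combinations of these
    functions, and so are their derivatives: smoothness becomes an induction. *)
Definition flat k x : R := if x <= 0 then 0 else x ^- k * expR (- x^-1).

Lemma flat_ge0 k x : 0 <= flat k x.
Proof.
rewrite /flat; case: ifPn => //; rewrite -ltNge => x0.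
by rewrite mulr_ge0 ?expR_ge0// invr_ge0 exprn_ge0// ltW.
Qed.

Lemma flat_gt0 k x : 0 < x -> 0 < flat k x.
Proof.
move=> x0; rewrite /flat leNgt x0/=.
by rewrite mulr_gt0 ?expR_gt0// invr_gt0 exprn_gt0.
Qed.

(** One term of the exponential series: [exp (1 / x) >= x ^- (k + 2) / (k + 2)!]. *)
Lemma flat_small k : exists2 C : R, 0 <= C & forall x, flat k x <= C * x ^+ 2.
Proof.
exists (k.+2)`!%:R => // x; rewrite /flat; case: ifPn => [_|].
  by rewrite mulr_ge0// sqr_ge0.
rewrite -ltNge => x0.
have := @expR_ge1Dxn R x^-1 k.+1; rewrite invr_ge0 (ltW x0) => /(_ isT) H.
have F0 : (0:R) < (k.+2)`!%:R by rewrite ltr0n fact_gt0.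
have {H} : x^-1 ^+ k.+2 / (k.+2)`!%:R <= expR x^-1.
  by apply: le_trans H; rewrite lerDr.
rewrite expRN => H.
rewrite ler_pdivrMr ?expR_gt0//.
have -> : x ^- k = x ^+ 2 * x^-1 ^+ k.+2.
  have xk0 : x ^+ k != 0 by rewrite expf_neq0// gt_eqF.
  by rewrite -[k.+2]addn2 exprD !exprVn; field; rewrite xk0 gt_eqF.
move: H; rewrite ler_pdivrMr// => H.
apply: le_trans (ler_wpM2l (sqr_ge0 x) H) _.
by rewrite le_eqVlt; apply/orP; left; apply/eqP; ring.
Qed.

Lemma is_derive_flat k x :
  is_derive x 1 (flat k) (flat k.+2 x + (- k%:R) * flat k.+1 x).
Proof.
have [x0|x0|->] := ltgtP x 0.
- apply: (@is_derive_local (fun=> 0) _ _ _ (- x)); first by rewrite oppr_gt0.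
    move=> y; rewrite ltr_norml => /andP[_ H]; rewrite /flat ifT//.
    by apply: ltW; move: H; lra.
  by rewrite /flat ltW// mulr0 addr0; exact: is_derive_cst.
- apply: (@is_derive_local (fun y => (y ^+ k)^-1 * expR (- y^-1)) _ _ _ x) => //.
    move=> y; rewrite ltr_norml => /andP[H _]; rewrite /flat ifF//.
    by apply/negbTE; rewrite -ltNge; move: H; lra.
  have xn0 : x != 0 by rewrite gt_eqF.
  have d1 : is_derive x 1 (fun y => y^-1) (- x ^- 2 *: 1).
    exact: (is_deriveV xn0 (is_derive_id x 1)).
  have d2 : is_derive x 1 (fun y => expR (- y^-1)) (expR (- x^-1) * (- (- x ^- 2 *: 1))).
    exact: (is_derive1_comp (is_derive_expR _) (is_deriveN d1)).
  have d3 : is_derive x 1 (fun y => (y ^+ k)^-1) (- (x^+k) ^- 2 *: (k%:R * x ^+ k.-1 *: 1)).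
    apply: (is_deriveV _ _); first by rewrite expf_neq0.
    apply: is_derive_ext (is_deriveX k (is_derive_id x 1)) => //.
    by apply/funext => y; rewrite exprfctE.
  apply: is_derive_ext (is_deriveM d3 d2) => //.
  rewrite /flat leNgt x0/= /GRing.scale/=.
  case: k {d3} => [|k]; first by rewrite /= expr0; field.
  by rewrite /= !exprS -?natr1; field; rewrite xn0 ?expf_neq0.
rewrite /flat lexx mulr0 addr0; apply/is_derive_epsP => e e0.
have [C C0 H] := flat_small k.
exists (e / (C + 1)); first by rewrite divr_gt0// ltr_wpDl.
move=> y; rewrite /flat lexx !subr0 mul0r subr0 => yr.
rewrite -/(flat k y) ger0_norm ?flat_ge0// (le_trans (H y))//.
rewrite -[y ^+ 2](ger0_norm (sqr_ge0 _)) normrX expr2 mulrA ler_wpM2r//.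
have : `|y| * (C + 1) <= e by rewrite -ler_pdivlMr ?ltr_wpDl// ltW.
have : 0 <= `|y| by [].
by nra.
Qed.

Lemma smooth_flat k : smooth (flat k).
Proof.
apply/smoothP => n; elim: n k => // n IH k.
exists (fun x => flat k.+2 x + (- k%:R) * flat k.+1 x) => [x|].
  exact: is_derive_flat.
by apply: times_derivableD => //; apply: times_derivableM => //; exact: times_derivable_cst.
Qed.

(** The transition from 0 to 1 from which all test functions below are built. *)
Definition step x : R := flat 0 x / (flat 0 x + flat 0 (- x + 1)).

Lemma step_den_gt0 x : 0 < flat 0 x + flat 0 (- x + 1).
Proof.
have [x0|x0] := ltP 0 x.
  by rewrite ltr_pwDl ?flat_gt0 ?flat_ge0.
by rewrite ltr_wpDl ?flat_ge0// flat_gt0//; lra.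
Qed.

Lemma smooth_step : smooth step.
Proof.
have s1 : smooth (fun x => flat 0 (- x + 1)).
  have := @smooth_affine (flat 0) (-1) 1 (@smooth_flat 0).
  by under eq_fun do rewrite mulN1r.
apply: smoothM; first exact: smooth_flat.
apply/smoothP => n; apply: times_derivableV => [x|].
  by rewrite gt_eqF// step_den_gt0.
by move: n; apply/smoothP/smoothD => //; exact: smooth_flat.
Qed.

Lemma step_le0 x : x <= 0 -> step x = 0.
Proof. by move=> x0; rewrite /step {1}/flat x0 mul0r. Qed.

Lemma step_ge1 x : 1 <= x -> step x = 1.
Proof.
move=> x1; rewrite /step {3}/flat ifT; last by lra.
by rewrite addr0 divff// gt_eqF// flat_gt0//; lra.
Qed.

Lemma step_ge0 x : 0 <= step x.
Proof. by rewrite divr_ge0 ?flat_ge0// ltW// step_den_gt0. Qed.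

Lemma step_le1 x : step x <= 1.
Proof. by rewrite ler_pdivrMr ?step_den_gt0// mul1r lerDl flat_ge0. Qed.

Lemma flat0_derive x : is_derive x 1 (flat 0) (flat 2 x).
Proof.
by apply: is_derive_ext (is_derive_flat 0 x) => //; rewrite oppr0 mul0r addr0.
Qed.

Lemma step_derive_ge0 x : 0 <= step^`() x.
Proof.
have d0 := flat0_derive x.
have d1 : is_derive x 1 (fun x => flat 0 (- x + 1)) (flat 2 (- x + 1) * (-1)).
  apply: (@is_derive1_comp _ (flat 0) (fun x => - x + 1)).
    exact: flat0_derive.
  have := is_derive_affine x (-1) 1.
  by apply: is_derive_ext => //; apply/funext => y; rewrite mulN1r.
have dn : flat 0 x + flat 0 (- x + 1) != 0 by rewrite gt_eqF// step_den_gt0.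
have := is_deriveM d0 (is_deriveV (f := fun x => flat 0 x + flat 0 (- x + 1)) dn (is_deriveD d0 d1)).
move=> [_]; rewrite derive1E => ->; rewrite /GRing.scale/=.
set A := flat 0 x; set B := flat 0 (- x + 1); set A' := flat 2 x; set B' := flat 2 (- x + 1).
have D0 : 0 < A + B by exact: step_den_gt0.
have -> : A * (- (A + B) ^- 2 * (A' + B' * -1)) + (A + B)^-1 * A' =
   (A * B' + B * A') / (A + B) ^+ 2 by field; rewrite gt_eqF.
by rewrite divr_ge0 ?sqr_ge0// addr_ge0// mulr_ge0 ?flat_ge0.
Qed.

End derivatives.

(** * A mean value inequality for absolutely continuous functions *)
Section absolute_continuity.
Context {R : realType}.
Notation leb := (@lebesgue_measure R).
Implicit Types (v w g : R -> R) (a b t d e : R).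

Lemma negligible_open_cover (N : set R) e : 0 < e -> leb.-negligible N ->
  exists V, [/\ open V, N `<=` V & (leb V < e%:E)%E].
Proof.
move=> e0 [A [mA A0 NA]].
have [|V [oO AO OA]] := lebesgue_regularity_outer mA _ e0; first by rewrite [X in (X < _)%E]A0 ltry.
exists V; split => //; first exact: subset_trans NA AO.
have mO : measurable V := open_measurable oO.
have -> : V = (V `\` A) `|` (V `&` A) by rewrite setUC setUIDK.
apply: le_lt_trans OA; apply: le_trans (measureU2 _ _ _) _ => /=.
- exact: measurableD.
- exact: measurableI.
- rewrite -[X in (_ <= X)%E]adde0 leeD//.
  by rewrite -[X in (_ <= X)%E]A0 le_measure ?inE//; exact: measurableI.
Qed.

Lemma lebesgue_measure_bnd (x y : bool) a b : a <= b ->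
  leb [set` Interval (BSide x a) (BSide y b)] = (b - a)%:E.
Proof.
move=> ab; rewrite lebesgue_measure_itv/= lte_fin EFinB.
by move: ab; rewrite le_eqVlt => /predU1P[->|->]; rewrite ?ltxx ?subee.
Qed.

Lemma negligible_set1 a : leb.-negligible [set a].
Proof.
by apply/negligibleP; [exact: measurable_set1|exact: lebesgue_measure_set1].
Qed.

(** Advance from [a], covering the points where both derivatives exist by short
    intervals on which [v] grows no faster than [g], up to an error [e], and the
    exceptional points by intervals inside an open set [V] of measure less than the
    [dl] that absolute continuity provides for [e]. The supremum of the points that
    can be reached cannot lie before [b]. *)
Lemma ae_le_increment a b v g : a <= b -> abs_continuous_fun a b v ->
  (forall s t, s <= t -> g s <= g t) ->
  {ae leb, forall t, a < t < b -> exists dv dg : R,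
     [/\ is_derive t 1 v dv, is_derive t 1 g dg & dv <= dg]} ->
  v b - v a <= g b - g a.
Proof.
move=> ab acv ndg aevg.
suff H e : 0 < e -> v b - v a <= g b - g a + e * (b - a) + e.
  apply/ler_addgt0Pr => e e0.
  have e'0 : 0 < e / (b - a + 1) by rewrite divr_gt0//; lra.
  apply: le_trans (H _ e'0) _; rewrite -addrA lerD2l -{2}[e / _]mulr1 -mulrDr.
  by rewrite divfK//; lra.
move=> e0; have [dl dl0 {}acv] := acv _ e0.
set good := fun t => exists dv dg : R,
     [/\ is_derive t 1 v dv, is_derive t 1 g dg & dv <= dg].
have nN : leb.-negligible ([set t | ~ (a < t < b -> good t)] `|` ([set a] `|` [set b])).
  apply: negligibleU; first exact: aevg.
  by apply: negligibleU; exact: negligible_set1.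
have [V [oO NO Odl]] := negligible_open_cover dl0 nN.
have mO : measurable V := open_measurable oO.
(* t can be reached: the s i, r i are the ends of the intervals inside V *)
pose P t := exists (n : nat) (s r : nat -> R),
  [/\ forall i, (i < n)%N -> a <= s i /\ s i <= r i /\ r i <= t,
      forall i j, (i < j)%N -> (j < n)%N -> r i <= s j,
      ((\sum_(i < n) (r i - s i))%:E <= leb (V `&` `[a, t[))%E
    & v t - v a <= g t - g a + e * (t - a) + \sum_(i < n) `|v (r i) - v (s i)|].
have Pa : P a.
  exists 0%N, (fun=> 0), (fun=> 0); split => //.
    by rewrite big_ord0; exact: measure_ge0.
  by rewrite big_ord0 !subrr mulr0 !addr0.
pose S := [set t | a <= t <= b /\ P t].
have Sa : S a by split => //; rewrite lexx.
have supS : has_sup S.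
  by split; [exists a|exists b => t [/andP[]]].
set T := sup S.
have aT : a <= T by apply: ub_le_sup => //; exact: supS.2.
have Tb : T <= b by apply: ge_sup => [|t [/andP[]]//]; exists a.
(* P extends across T: if T is not in V, by comparing derivatives at T, and
   otherwise by adding one interval inside V *)
have [r r0 stepr] : exists2 r : R, 0 < r & forall t t', a <= t -> t <= T -> T <= t' -> t' <= b ->
    T - r < t -> t' < T + r -> P t -> P t'.
  have [OT|OT] := pselect (V T); last first.
    have Tab : a < T < b.
      apply/andP; split; rewrite lt_neqAle ?aT ?Tb andbT; apply/eqP => E; apply: OT.
        by apply: NO; right; left.
      by apply: NO; right; right.
    have [dv [dg [Hv Hg dvg]]] : good T.
      by apply: contrapT => ngT; apply: OT; apply: NO; left => /(_ Tab).
    have e20 : 0 < e / 2 by rewrite divr_gt0.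
    have [r1 r10 H1] := (is_derive_epsP _ _ _).1 Hv _ e20.
    have [r2 r20 H2] := (is_derive_epsP _ _ _).1 Hg _ e20.
    exists (Num.min r1 r2); first by rewrite lt_min r10.
    move=> t t' at0 tT Tt' t'b rt rt' [n [s [q [Pn1 Pn2 Pn3 Pn4]]]].
    have tt' := le_trans tT Tt'.
    exists n, s, q; split => //.
    - by move=> i /Pn1[? [? ?]]; split => //; split => //; exact: le_trans tt'.
    - apply: le_trans Pn3 _; apply: le_measure; rewrite ?inE.
      + exact: measurableI.
      + exact: measurableI.
      + by apply: setIS; apply: subset_itvl; rewrite bnd_simp.
    - have d1 : `|t - T| < Num.min r1 r2 by rewrite distrC ger0_norm ?subr_ge0//; move: rt; lra.
      have d2 : `|t' - T| < Num.min r1 r2 by rewrite ger0_norm ?subr_ge0//; move: rt'; lra.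
      move: d1 d2; rewrite !lt_min => /andP[/H1 K1 /H2 K2] /andP[/H1 K3 /H2 K4].
      move: K1 K2 K3 K4; rewrite distrC [`|t - T|]distrC.
      rewrite !(ger0_norm (_ : 0 <= T - t)) ?(ger0_norm (_ : 0 <= t' - T)) ?subr_ge0//.
      rewrite !ler_norml => /andP[K1 K1'] /andP[K2 K2'] /andP[K3 K3'] /andP[K4 K4'].
      have : 0 <= (dg - dv) * (t' - t) by rewrite mulr_ge0 ?subr_ge0.
      nra.
  have [r r0 Hr] : exists2 r : R, 0 < r & forall y, `|y - T| < r -> V y.
    have /nbhs_ballP[r r0 Hr] := open_nbhs_nbhs (conj oO OT).
    by exists r => // y yT; apply: Hr; rewrite /ball/= distrC.
  exists r => // t t' at0 tT Tt' t'b rt rt' [n [s [q [Pn1 Pn2 Pn3 Pn4]]]].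
  have tt' := le_trans tT Tt'.
  exists n.+1, (fun i => if i == n then t else s i), (fun i => if i == n then t' else q i).
  split.
  - move=> i; rewrite ltnS leq_eqVlt; case: eqP => [_ _|_ /= /Pn1[? [? ?]]].
      by split.
    by split => //; split => //; exact: le_trans tt'.
  - move=> i j ij; rewrite ltnS leq_eqVlt; case: eqP => [jn _|_ /= jn].
      rewrite ifF; last by apply/negbTE; rewrite neq_ltn -jn ij.
      by have [|_ []] := Pn1 i => //; rewrite -jn.
    rewrite ifF; first exact: Pn2.
    by apply/negbTE; rewrite neq_ltn (ltn_trans ij jn).
  - rewrite big_ord_recr/= eqxx.
    under eq_bigr => i _ do rewrite (ltn_eqF (ltn_ord i)).
    have -> : V `&` `[a, t'[ = (V `&` `[a, t[) `|` `[t, t'[.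
      apply/seteqP; split=> y /=; rewrite !in_itv/=.
        move=> [Vy /andP[ay yt']]; have [yt|ty] := ltP y t; first by left; rewrite ay.
        by right.
      move=> [[Vy /andP[ay yt]]|/andP[ty yt']].
        by split => //; rewrite ay (lt_le_trans yt).
      split; last by rewrite yt' (le_trans at0).
      by apply: Hr; rewrite ltr_norml; apply/andP; split; move: rt rt'; lra.
    rewrite measureU//; last 2 first.
    + exact: measurableI.
    + apply/seteqP; split => // y [[_ /=]]; rewrite !in_itv/= => /andP[_ yt] /andP[ty _].
      by move: yt; rewrite ltNge ty.
    by rewrite EFinD leeD// [X in (_ <= X)%E](lebesgue_measure_bnd true true tt').
  - rewrite big_ord_recr/= eqxx.
    under eq_bigr => i _ do rewrite (ltn_eqF (ltn_ord i)).
    have := ler_norm (v t' - v t); have := ndg _ _ tt'.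
    have : 0 <= e * (t' - t) by rewrite mulr_ge0 ?subr_ge0// ltW.
    by move: Pn4; lra.
have [t [/andP[at0 tb] Pt] rt] := sup_adherent r0 supS.
have tT : t <= T.
  by apply: (ub_le_sup supS.2); split => //; rewrite at0.
pose t' := Num.min b (T + r / 2).
have t'b : t' <= b by rewrite ge_min lexx.
have r20 : 0 < r / 2 by rewrite divr_gt0.
have Tt' : T <= t' by rewrite le_min Tb/= lerDl ltW.
have t'r : t' < T + r.
  by rewrite gt_min; apply/orP; right; lra.
have Pt' : P t' by exact: stepr Pt.
have t'T : t' <= T.
  apply: ub_le_sup; first exact: supS.2.
  by split => //; rewrite t'b andbT (le_trans aT).
have bE : b = T.
  apply/eqP; rewrite eq_le Tb andbT; move: t'T; rewrite ge_min => /orP[//|].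
  lra.
have [n [s [q [Pn1 Pn2 Pn3 Pn4]]]] : P b by rewrite bE (_ : T = t')//; apply/eqP; rewrite eq_le Tt' t'T.
apply: le_trans Pn4 _; rewrite lerD2l ltW// -lte_fin -sumEFin.
apply: (acv n (fun i => s i) (fun i => q i)).
- by move=> i; exact: Pn1.
- move=> i j; rewrite neq_ltn => /orP[ij|ji]; [left|right]; exact: Pn2.
- rewrite -lte_fin; apply: le_lt_trans Pn3 _; apply: le_lt_trans Odl.
  by apply: le_measure; rewrite ?inE//; exact: measurableI.
Qed.

End absolute_continuity.

(** * One-sided derivatives, exponential growth and continuation *)
Section growth.
Context {R : realType}.
Implicit Types (v w g y : R -> R) (A : set R) (a b t s d e r T B : R).

Lemma within_epsP A v : {within A, continuous v} <->
  forall x, A x -> forall e, 0 < e -> exists2 r : R, 0 < r &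
    forall z, A z -> `|z - x| < r -> `|v z - v x| < e.
Proof.
rewrite subspace_continuousP; split=> H x Ax.
  move=> e e0; have /cvgrPdist_lt/(_ e e0) := H x Ax.
  rewrite near_withinE => /nbhs_ballP[r r0 {}H]; exists r => // y Ay yx.
  by rewrite distrC; apply: H => //; rewrite /ball/= distrC.
apply/cvgrPdist_lt => e e0; have [r r0 {}H] := H x Ax e e0.
rewrite near_withinE; apply/nbhs_ballP; exists r => //= y yx Ay.
by rewrite distrC; apply: H => //; rewrite distrC.
Qed.

(** The derivative of [v] at [t] along [A], which is one-sided at the endpoints
    of an interval [A]. *)
Definition rel_derive A v t d : Prop :=
  forall e, 0 < e -> exists2 r : R, 0 < r &
    forall s, A s -> `|s - t| < r -> `|v s - v t - d * (s - t)| <= e * `|s - t|.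

Lemma is_derive_rel A v t d : is_derive t 1 v d -> rel_derive A v t d.
Proof. by move=> /is_derive_epsP H e /H[r r0 {}H]; exists r => // s _; exact: H. Qed.

Lemma rel_derive_sub A A' v t d : A' `<=` A ->
  rel_derive A v t d -> rel_derive A' v t d.
Proof. by move=> A'A H e /H[r r0 {}H]; exists r => // s /A'A; exact: H. Qed.

Lemma rel_derive_interior a b v t d : a < t < b ->
  rel_derive `[a, b] v t d -> is_derive t 1 v d.
Proof.
move=> /andP[at0 tb] H; apply/is_derive_epsP => e /H[r r0 {}H].
exists (Num.min r (Num.min (t - a) (b - t))).
  by rewrite !lt_min r0 !subr_gt0 at0.
move=> s; rewrite !lt_min => /and3P[sr sa sb]; apply: H => //=.
rewrite in_itv/=; move: sa sb; rewrite !ltr_norml => /andP[? ?] /andP[? ?].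
by apply/andP; split; lra.
Qed.

Lemma rel_derive_continuous A v (dv : R -> R) :
  (forall t, A t -> rel_derive A v t (dv t)) -> {within A, continuous v}.
Proof.
move=> H; apply/within_epsP => t At e e0.
have [r r0 {}H] := H t At 1 ltr01.
have D0 : 0 < 1 + `|dv t| + 1 by rewrite ltr_wpDl// addr_ge0.
exists (Num.min r (e / (1 + `|dv t| + 1))).
  by rewrite lt_min r0 divr_gt0.
move=> s As; rewrite lt_min ltr_pdivlMr// => /andP[sr se].
have := H s As sr; rewrite mul1r => {}H.
have : `|v s - v t| <= `|v s - v t - dv t * (s - t)| + `|dv t * (s - t)|.
  by rewrite -{1}[v s - v t](subrK (dv t * (s - t))) ler_normD.
have {}se : `|s - t| + `|s - t| * `|dv t| + `|s - t| < e.
  by move: se; rewrite !mulrDr mulr1.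
rewrite normrM; move: se.
have := normr_ge0 (s - t); have := normr_ge0 (dv t).
by nra.
Qed.

Lemma rel_deriveB A v w t d d' : rel_derive A v t d -> rel_derive A w t d' ->
  rel_derive A (fun s => v s - w s) t (d - d').
Proof.
move=> Hv Hw e e0; have e20 : 0 < e / 2 by rewrite divr_gt0.
have [r r0 {}Hv] := Hv _ e20; have [q q0 {}Hw] := Hw _ e20.
exists (Num.min r q); first by rewrite lt_min r0.
move=> s As; rewrite lt_min => /andP[sr sq].
have -> : v s - w s - (v t - w t) - (d - d') * (s - t) =
  (v s - v t - d * (s - t)) - (w s - w t - d' * (s - t)) by ring.
apply: le_trans (ler_normB _ _) _.
have := Hv _ As sr; have := Hw _ As sq; lra.
Qed.

Lemma rel_derive0_eq v w (dv : R -> R) T : 0 <= T -> v 0 = w 0 ->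
  (forall t, 0 <= t <= T -> rel_derive `[0, T] v t (dv t)) ->
  (forall t, 0 <= t <= T -> rel_derive `[0, T] w t (dv t)) -> v T = w T.
Proof.
move=> T0 vw0 Hv Hw.
have H t : 0 <= t <= T -> rel_derive `[0, T] (fun s => v s - w s) t 0.
  by move=> tT; have := rel_deriveB (Hv _ tT) (Hw _ tT); rewrite subrr.
have [c _] : exists2 c, c \in `[0, T]%R &
    (v T - w T) - (v 0 - w 0) = (fun=> 0) c * (T - 0).
  apply: (@MVT_segment R (fun t => v t - w t) (fun=> 0)) => // [t|].
    by rewrite in_itv/= => tT; apply: rel_derive_interior (H _ _) => //; lra.
  by apply: (@rel_derive_continuous _ _ (fun=> 0)) => t/=; rewrite in_itv/=; exact: H.
by rewrite mul0r vw0; lra.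
Qed.

(** Gronwall: [(1 + y t) * expR (- B * t)] is nonincreasing. *)
Lemma exponential_growth a b y (dy : R -> R) B : a <= b ->
  (forall t, a <= t <= b -> rel_derive `[a, b] y t (dy t)) ->
  (forall t, a <= t <= b -> dy t <= B * (1 + y t)) ->
  1 + y b <= (1 + y a) * expR (B * (b - a)).
Proof.
move=> ab Hy dyB.
pose g t := (1 + y t) * expR (- B * t).
have dexp t : is_derive t 1 (fun s => expR (- B * s)) (expR (- B * t) * - B).
  have := @is_derive1_comp R expR (fun s => - B * s + 0) t _ _ (is_derive_expR _) (is_derive_affine t (- B) 0).
  by apply: is_derive_ext; [apply/funext => s /=|]; rewrite addr0.
have gle : g b <= g a.
  have [c] : exists2 c, c \in `[a, b]%R &
      g b - g a = ((dy c - B * (1 + y c)) * expR (- B * c)) * (b - a).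
    apply: (@MVT_segment _ g (fun c => (dy c - B * (1 + y c)) * expR (- B * c))) => // [t|].
      rewrite in_itv/= => /andP[ta tb].
      have tab : a <= t <= b by lra.
      have dyt : is_derive t 1 y (dy t).
        by apply: rel_derive_interior (Hy _ tab) => //; lra.
      have := is_deriveM (is_deriveD (is_derive_cst (1 : R) t 1) dyt) (dexp t).
      apply: is_derive_ext => //; rewrite /GRing.scale/= (_ : (cst 1 + y) t = 1 + y t)//; ring.
    have cy : {within `[a, b], continuous y}.
      by apply: (@rel_derive_continuous _ _ dy) => t/=; rewrite in_itv/=; exact: Hy.
    have cexp : {within `[a, b], continuous (fun s => expR (- B * s))}.
      by apply: continuous_subspaceT => s; exact: is_derive_continuous (dexp s).
    apply/subspace_continuousP => t tab; apply: cvgM.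
      apply: cvgD; first exact: cvg_cst.
      by move/subspace_continuousP : cy; exact.
    by move/subspace_continuousP : cexp; exact.
  rewrite in_itv/= => /dyB cB E.
  rewrite -subr_le0 E mulr_le0_ge0 ?subr_ge0//.
  by rewrite mulr_le0_ge0 ?expR_ge0//; lra.
have -> : 1 + y b = g b * expR (B * b).
  by rewrite /g -mulrA -expRD mulNr addNr expR0 mulr1.
apply: le_trans (ler_wpM2r (expR_ge0 _) gle) _.
by rewrite /g -mulrA -expRD (_ : - B * a + B * b = B * (b - a))//; ring.
Qed.

(** A property that persists for a time which is uniform as long as [y] is bounded
    persists forever when [y] grows at most exponentially. *)
Lemma continuation_forward (P : R -> Prop) y T B : 0 <= B ->
  (forall Y, exists2 r : R, 0 < r & forall t s, 0 <= t <= T -> 0 <= s <= T ->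
     P t -> y t <= Y -> `|s - t| <= r -> P s) ->
  (forall t, 0 <= t <= T -> P t -> 0 <= y t /\ exists d,
     `|d| <= B * (1 + y t) /\ rel_derive `[0, T] y t d) ->
  forall t s, 0 <= t -> t <= s -> s <= T -> P t -> P s.
Proof.
move=> B0 H D a b a0 ab bT Pa.
have aT : 0 <= a <= T by rewrite a0 (le_trans ab).
(* as long as P holds, y is bounded by Y, so that steps of a fixed length r reach b *)
pose Y := (1 + y a) * expR (B * T).
have ya0 := (D _ aT Pa).1.
have [r r0 Hr] := H Y.
pose c (n : nat) := Num.min b (a + n%:R * r).
have cb n : c n <= b by rewrite ge_min lexx.
have ac n : a <= c n by rewrite le_min ab lerDl mulr_ge0// ltW.
suff K n : forall t, a <= t <= c n -> P t.
  have [n nba] : exists n : nat, (b - a) / r <= n%:R.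
    exists (Num.bound ((b - a) / r)); apply/ltW/archi_boundP.
    by rewrite divr_ge0 ?subr_ge0// ltW.
  apply: (K n); rewrite ab le_min lexx/=.
  by move: nba; rewrite ler_pdivrMr//; lra.
elim: n => [|n IH] t /andP[at0].
  rewrite /c mul0r addr0 (min_idPr ab) => ta.
  by rewrite (_ : t = a)//; apply/eqP; rewrite eq_le ta.
move=> tc; have [tcn|tcn] := leP t (c n); first by apply: IH; rewrite at0.
have cT : 0 <= c n <= T by rewrite (le_trans a0 (ac n)) (le_trans (cb n) bT).
have Pc : P (c n) by apply: IH; rewrite ac lexx.
apply: (Hr (c n)) => //.
- by rewrite (le_trans a0 at0) (le_trans tc)// (le_trans (cb _)).
- have /choice[dy Hdy] : forall s, exists d, a <= s <= c n ->
      `|d| <= B * (1 + y s) /\ rel_derive `[0, T] y s d.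
    move=> s; have [sc|nsc] := pselect (a <= s <= c n); last by exists 0 => sc.
    have sT : 0 <= s <= T.
      by case/andP: sc => as0 sc; rewrite (le_trans a0 as0) (le_trans sc)//; case/andP: cT.
    by have [_ [d Hd]] := D s sT (IH _ sc); exists d.
  have := @exponential_growth a (c n) y dy B (ac n).
  move=> /(_ _ _)/le_trans G.
  have : 1 + y (c n) <= Y.
    apply: G.
    + move=> s sc; have [_] := Hdy s sc; apply: rel_derive_sub => q /=.
      rewrite !in_itv/= => /andP[aq qc].
      by rewrite (le_trans a0 aq) (le_trans qc)//; case/andP: cT.
    + by move=> s sc; have [ds _] := Hdy s sc; exact: le_trans (ler_norm _) ds.
    + rewrite ler_wpM2l ?addr_ge0// ler_expR ler_wpM2l//.
      by case/andP: cT => _; lra.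
  lra.
rewrite ger0_norm ?subr_ge0; last exact: ltW.
move: tc tcn; rewrite le_min gt_min -natr1 mulrDl mul1r => /andP[tb tr] /orP[|].
  by move: tb; case: ltgtP.
by rewrite /c; case: (leP b); lra.
Qed.

(** Both directions of time, by the symmetry [t |-> T - t]. *)
Lemma continuation (P : R -> Prop) y T B : 0 <= B ->
  (forall Y, exists2 r : R, 0 < r & forall t s, 0 <= t <= T -> 0 <= s <= T ->
     P t -> y t <= Y -> `|s - t| <= r -> P s) ->
  (forall t, 0 <= t <= T -> P t -> 0 <= y t /\ exists d,
     `|d| <= B * (1 + y t) /\ rel_derive `[0, T] y t d) ->
  forall t s, 0 <= t <= T -> 0 <= s <= T -> P t -> P s.
Proof.
move=> B0 H D t s /andP[t0 tT] /andP[s0 sT] Pt.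
have [ts|/ltW st] := leP t s; first exact: (continuation_forward B0 H D t0 ts sT).
have := @continuation_forward (fun q => P (T - q)) (fun q => y (T - q)) T B B0.
have rv q : 0 <= q <= T -> 0 <= T - q <= T by lra.
move=> /(_ _ _ (T - t) (T - s)); rewrite !subKr; apply => //; try lra.
- move=> Y; have [r r0 Hr] := H Y; exists r => // a b aT bT Pa Ya ab.
  apply: (Hr (T - a)) => //; try exact: rv.
  by rewrite (_ : _ - _ = a - b); [rewrite distrC|ring].
- move=> a aT Pa; have [ya [d [dB Hd]]] := D _ (rv _ aT) Pa; split => //.
  exists (- d); split; first by rewrite normrN.
  move=> e /Hd[r r0 Hr]; exists r => // b/=; rewrite in_itv/= => bT ab.
  have E : T - b - (T - a) = - (b - a) by ring.
  have := Hr (T - b); rewrite E normrN mulrN => {}Hr.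
  by rewrite mulNr; apply: Hr => //=; rewrite in_itv/=; exact: rv.
Qed.

End growth.

(** * Distribution functions and their generalized inverses *)
Section distribution_functions.
Context {R : realType}.
Implicit Types (nu : @fmeasure R) (x y xi eta e : R).

(** The distribution function; at negative arguments the interval is empty. *)
Definition mass nu x : R := fine (nu `[0, x]).

Lemma massE nu x : nu `[0, x] = (mass nu x)%:E.
Proof. by rewrite /mass fineK// fin_num_measure. Qed.

Lemma mass_ge0 nu x : 0 <= mass nu x.
Proof. by rewrite -lee_fin -massE measure_ge0. Qed.

Lemma le_mass nu x y : x <= y -> mass nu x <= mass nu y.
Proof.
move=> xy; rewrite -lee_fin -!massE le_measure ?inE//.
exact: subset_itvl.
Qed.

Lemma mass_lt0 nu x : x < 0 -> mass nu x = 0.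
Proof.
move=> x0; rewrite /mass set_itv_ge ?measure0//.
by rewrite bnd_simp -ltNge.
Qed.

Lemma measurable_Rplus : measurable (Rplus : set R).
Proof. exact: measurable_itv. Qed.

Lemma total_massE nu : nu Rplus = (total_mass nu)%:E.
Proof. by rewrite /total_mass fineK// fin_num_measure//; exact: measurable_Rplus. Qed.

Lemma mass_le_total nu x : mass nu x <= total_mass nu.
Proof.
rewrite -lee_fin -massE -total_massE le_measure ?inE//; first exact: measurable_Rplus.
by apply: subset_itvl; rewrite bnd_simp.
Qed.

Lemma mass_right_continuous nu x e : 0 < e ->
  exists2 r : R, 0 < r & mass nu (x + r) < mass nu x + e.
Proof.
move=> e0; pose F (n : nat) : set R := `[0, x + n.+1%:R^-1].
have cap : \bigcap_n F n = `[0, x].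
  apply/seteqP; split => y; rewrite /F/= !in_itv/=.
    move=> H; have := H 0%N I; rewrite /= ?in_itv/= => /andP[y0 _]; rewrite y0/=.
    apply/ler_addgt0Pr => d d0.
    have [n Hn] : exists n : nat, n.+1%:R^-1 < d.
      exists (Num.bound d^-1); rewrite invf_plt ?posrE//.
      apply: lt_trans (archi_boundP _) _; first by rewrite invr_ge0 ltW.
      by rewrite ltr_nat.
    have := H n I; rewrite /= ?in_itv/= => /andP[_ /le_trans]; apply.
    by rewrite lerD2l ltW.
  move=> /andP[y0 yx] n _; rewrite /= ?in_itv/= y0/= (le_trans yx)// lerDl invr_ge0.
  exact: ler0n.
have : (nu \o F) @ \oo --> nu (\bigcap_n F n).
  apply: nonincreasing_cvg_mu.
  - by rewrite ltey_eq fin_num_measure//; exact: measurable_itv.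
  - by move=> i; exact: measurable_itv.
  - by rewrite cap; exact: measurable_itv.
  - move=> m n mn; apply/subsetPset; apply: subset_itvl; rewrite bnd_simp lerD2l.
    by rewrite lef_pV2 ?posrE// ler_nat.
rewrite cap massE.
have -> : nu \o F = (fun n => (mass nu (x + n.+1%:R^-1))%:E).
  by apply/funext => n /=; rewrite -massE.
move=> /fine_cvgP[_]/cvgrPdist_lt/(_ e e0)[N _ /(_ N (leqnn N))]/=.
rewrite distrC ltr_norml => /andP[_]; rewrite ltrBlDl => H.
by exists N.+1%:R^-1 => //; rewrite invr_gt0.
Qed.

Lemma mass_tail nu e : 0 < e -> exists2 x : R, 0 <= x & total_mass nu - e < mass nu x.
Proof.
move=> e0; pose F (n : nat) : set R := `[0, n%:R].
have cup : \bigcup_n F n = Rplus.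
  apply/seteqP; split => y; rewrite /F /Rplus/= ?in_itv/=.
    by move=> [n _]; rewrite /= ?in_itv/= => /andP[->].
  rewrite andbT => y0; exists (Num.bound y) => //=; rewrite in_itv/= y0/=.
  exact/ltW/archi_boundP.
have : (nu \o F) @ \oo --> nu (\bigcup_n F n).
  apply: nondecreasing_cvg_mu.
  - by move=> i; exact: measurable_itv.
  - by rewrite cup; exact: measurable_itv.
  - by move=> m n mn; apply/subsetPset; apply: subset_itvl; rewrite bnd_simp ler_nat.
rewrite cup total_massE.
have -> : nu \o F = (fun n => (mass nu n%:R)%:E).
  by apply/funext => n /=; rewrite -massE.
move=> /fine_cvgP[_]/cvgrPdist_lt/(_ e e0)[N _ /(_ N (leqnn N))]/=.
rewrite ltr_norml => /andP[_]; rewrite ltrBlDl => H.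
by exists N%:R => //; lra.
Qed.

Lemma measure_Rplus_itv nu x : nu (~` Rplus) = 0%E ->
  nu `]x, +oo[ = (total_mass nu - mass nu x)%:E.
Proof.
move=> nu0; have mR := measurable_Rplus.
have [x0|x0] := ltP x 0.
  have -> : `]x, +oo[%classic = Rplus `|` `]x, 0[.
    apply/seteqP; split => y; rewrite /Rplus/= !in_itv/= !andbT.
      by move=> xy; case: (leP 0 y) => y0; [left|right; rewrite xy].
    by move=> [|/andP[]//]; exact: lt_le_trans.
  rewrite measureU//; last first.
    apply/seteqP; split => // y; rewrite /Rplus/= !in_itv/= andbT => -[y0 /andP[_]].
    by rewrite ltNge y0.
  rewrite mass_lt0// subr0 -total_massE [X in (_ + X)%E](_ : _ = 0%E) ?adde0//.
  apply/eqP; rewrite eq_le measure_ge0 andbT -nu0 le_measure ?inE//.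
    exact: measurableC.
  move=> y; rewrite /Rplus/= !in_itv/= andbT => /andP[_ yx].
  by apply/negP; rewrite -ltNge.
have E : Rplus = `[0, x] `|` `]x, +oo[.
  apply/seteqP; split => y; rewrite /Rplus/= !in_itv/= !andbT.
    by move=> y0; case: (leP y x) => yx; [left; rewrite y0|right].
  by move=> [/andP[]//|/ltW]; exact: le_trans.
have : nu Rplus = (nu `[0%R, x] + nu `]x, +oo[)%E.
  rewrite {1}E measureU//; apply/seteqP; split => // y.
  by rewrite /= !in_itv/= andbT => -[/andP[_ yx]]; rewrite ltNge yx.
rewrite total_massE massE.
have : nu `]x, +oo[ \is a fin_num by rewrite fin_num_measure.
move=> /fineK <-; rewrite -EFinD => -[E']; congr EFin; move: E'; lra.
Qed.

Lemma eq_measure_mass nu1 nu2 : nu1 (~` Rplus) = 0%E -> nu2 (~` Rplus) = 0%E ->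
  (forall x, 0 <= x -> mass nu1 x = mass nu2 x) ->
  forall A, measurable A -> nu1 A = nu2 A.
Proof.
move=> nu10 nu20 m12.
have mE x : mass nu1 x = mass nu2 x.
  by have [x0|x0] := ltP x 0; [rewrite !mass_lt0|exact: m12].
have tle nu nu' : (forall x, mass nu x = mass nu' x) -> total_mass nu <= total_mass nu'.
  move=> E; apply/ler_addgt0Pr => e e0; have [x _] := mass_tail nu e0.
  by rewrite E; have := mass_le_total nu' x; lra.
have tE : total_mass nu1 = total_mass nu2 by apply/eqP; rewrite eq_le !tle.
move=> A mA.
apply: (@measure_unique _ R (measurableTypeR R) (@RGenOInfty.G R) (fun n => `](- n%:R), +oo[%classic)) => //.
- exact: RGenOInfty.measurableE.
- move=> _ _ [x ->] [y ->]; exists (Num.max x y).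
  by apply/seteqP; split => z; rewrite /= !in_itv/= !andbT gt_max => /andP.
- by move=> i; exists (- i%:R).
- apply/seteqP; split => // x _; exists (Num.bound (- x)) => //=.
  rewrite in_itv/= andbT ltrNl; have [x0|x0] := ltP x 0.
    by apply: archi_boundP; rewrite oppr_ge0 ltW.
  by apply: (@le_lt_trans _ _ 0); rewrite ?oppr_le0// ltr0n archi_bound_gt0.
- move=> _ [x ->]; transitivity (total_mass nu1 - mass nu1 x)%:E.
    exact: measure_Rplus_itv.
  by rewrite tE mE; apply/esym; exact: measure_Rplus_itv.
- by move=> k; rewrite ltey_eq fin_num_measure//; exact: measurable_itv.
Qed.

(** At other labels the set in [mass_inverse] is empty and its infimum is the
    default value 0. The label [total_mass nu] need not be reached, when the measure
    has no compact support. *)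
Definition reached nu xi : Prop := exists x, xi <= mass nu x.

Section inverse.
Variables (nu : @fmeasure R) (xi : R).
Hypotheses (xi0 : 0 < xi) (rxi : reached nu xi).

Let S := [set x : R | 0 <= x /\ (xi%:E <= nu `[0%R, x])%E].

Let S0 : S !=set0.
Proof.
have [x Hx] := rxi; exists x; split; last by rewrite massE lee_fin.
by rewrite leNgt; apply/negP => x0; move: Hx; rewrite mass_lt0// leNgt xi0.
Qed.

Let Slb : has_lbound S.
Proof. by exists 0 => x []. Qed.

Lemma mass_inverse_ge0 : 0 <= mass_inverse nu xi.
Proof. by apply: lb_le_inf => // x []. Qed.

(** The generalized inverse and the distribution function form a Galois
    connection, because the latter is right continuous. *)
Lemma mass_inverse_le x : (mass_inverse nu xi <= x) = (xi <= mass nu x).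
Proof.
apply/idP/idP => [yx|xix].
  apply: le_trans (le_mass nu yx).
  apply/ler_addgt0Pr => e e0; have [r r0 Hr] := mass_right_continuous nu (mass_inverse nu xi) e0.
  apply: ltW; apply: le_lt_trans Hr.
  have [x' [x'0]] := inf_adherent r0 (conj S0 Slb).
  rewrite massE lee_fin => H lx'; apply: le_trans H _; apply: le_mass.
  exact: ltW.
apply: ge_inf => //; split; last by rewrite massE lee_fin.
by rewrite leNgt; apply/negP => x0; move: xix; rewrite mass_lt0// leNgt xi0.
Qed.

Lemma mass_inverse_gt x : (x < mass_inverse nu xi) = (mass nu x < xi).
Proof. by rewrite ltNge mass_inverse_le -ltNge. Qed.

Lemma mass_mass_inverse : xi <= mass nu (mass_inverse nu xi).
Proof. by rewrite -mass_inverse_le. Qed.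

End inverse.

Lemma reached_le nu xi eta : xi <= eta -> reached nu eta -> reached nu xi.
Proof. by move=> xe [x Hx]; exists x; exact: le_trans Hx. Qed.

Lemma le_mass_inverse nu xi eta : 0 < xi -> xi <= eta -> reached nu eta ->
  mass_inverse nu xi <= mass_inverse nu eta.
Proof.
move=> xi0 xe re; rewrite mass_inverse_le//; last exact: reached_le re.
by apply: (le_trans xe); apply: mass_mass_inverse => //; exact: lt_le_trans xe.
Qed.

Lemma mass_inverse_left_continuous nu xi e : 0 < xi -> reached nu xi -> 0 < e ->
  exists2 eta : R, 0 < eta < xi & forall z, eta < z -> z <= xi ->
    mass_inverse nu xi - e < mass_inverse nu z <= mass_inverse nu xi.
Proof.
move=> xi0 rxi e0; set y := mass_inverse nu xi.
have my : mass nu (y - e) < xi by rewrite -mass_inverse_gt// /y ltrBlDr ltrDl.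
have := mass_ge0 nu (y - e) => m0.
exists (Num.max (xi / 2) (mass nu (y - e))).
  by rewrite lt_max gt_max my andbT; apply/andP; split; [apply/orP; left|]; lra.
move=> z; rewrite gt_max => /andP[z1 z2] zxi.
have z0 : 0 < z by lra.
by rewrite mass_inverse_gt ?z2 ?le_mass_inverse//; exact: reached_le rxi.
Qed.

Lemma mass_inverse0 nu : mass_inverse nu 0 = 0.
Proof.
apply/eqP; rewrite eq_le; apply/andP; split.
  by apply: ge_inf; [exists 0 => x []|split].
by apply: lb_le_inf; [exists 0; split|move=> x []].
Qed.

End distribution_functions.

(** * Smooth ramps and distributional derivatives *)
Section integrals.
Context {R : realType}.
Notation leb := (@lebesgue_measure R).
Implicit Types (v w g psi : R -> R) (A : set R) (a b c x z e d l : R).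

Lemma within_continuousM A v w : {within A, continuous v} ->
  {within A, continuous w} -> {within A, continuous (fun x => v x * w x)}.
Proof.
move=> /subspace_continuousP cv /subspace_continuousP cw.
by apply/subspace_continuousP => x Ax; apply: cvgM; [exact: cv|exact: cw].
Qed.

Lemma within_continuousB A v w : {within A, continuous v} ->
  {within A, continuous w} -> {within A, continuous (fun x => v x - w x)}.
Proof.
move=> /subspace_continuousP cv /subspace_continuousP cw.
by apply/subspace_continuousP => x Ax; apply: cvgB; [exact: cv|exact: cw].
Qed.

Lemma integrable_itv_continuous a b v : {within `[a, b], continuous v} ->
  leb.-integrable `[a, b] (EFin \o v).
Proof. by apply: continuous_compact_integrable; exact: segment_compact. Qed.

Lemma Rintegral_support (d : measure_display) (T : measurableType d)
    (mu : {measure set T -> \bar R}) (D E : set T) (F : T -> R) :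
  E `<=` D -> (forall t, D t -> ~ E t -> F t = 0) ->
  \int[mu]_(x in D) F x = \int[mu]_(x in E) F x.
Proof.
move=> ED F0; rewrite -[in RHS](setIidr ED) Rintegral_mkcondr.
apply: eq_Rintegral => x; rewrite inE patchE => Dx; case: ifPn => //.
by rewrite notin_setE => /F0 ->.
Qed.

Lemma integrable_linear (d : measure_display) (T : measurableType d)
    (mu : {measure set T -> \bar R}) (D : set T) (F G : T -> R) (k : R) :
  measurable D -> mu.-integrable D (EFin \o F) -> mu.-integrable D (EFin \o G) ->
  mu.-integrable D (EFin \o (fun t => k * F t + G t)).
Proof.
by move=> mD iF iG; exact: (integrableD mD (integrableZl mD k iF) iG).
Qed.

Lemma Rintegral_derive a b v v' : a <= b -> (forall x, is_derive x 1 v (v' x)) ->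
  continuous v' -> \int[leb]_(x in `[a, b]) v' x = v b - v a.
Proof.
rewrite le_eqVlt => /predU1P[<-|ab] dv cv'.
  by rewrite set_itv1 Rintegral_set1 subrr.
rewrite /Rintegral (@continuous_FTC2 _ v' v)//.
- exact: continuous_subspaceT.
- split=> [x _||].
  + by have [] := dv x.
  + by apply: cvg_at_right_filter; exact: is_derive_continuous (dv a).
  + by apply: cvg_at_left_filter; exact: is_derive_continuous (dv b).
- by move=> x _; rewrite (is_derive_derive1 dv).
Qed.

(** Smooth approximation of the indicator function of [z, +oo[. *)
Definition ramp z e x : R := step (e^-1 * x + - (z / e)).
Definition ramp' z e x : R := step^`() (e^-1 * x + - (z / e)) * e^-1.

Lemma smooth_ramp z e : smooth (ramp z e).
Proof. by apply: smooth_affine; exact: smooth_step. Qed.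

Lemma is_derive_ramp z e x : is_derive x 1 (ramp z e) (ramp' z e x).
Proof.
exact: (is_derive1_comp (smooth_is_derive _ smooth_step) (is_derive_affine _ _ _)).
Qed.

Lemma continuous_ramp' z e : continuous (ramp' z e).
Proof.
have <- : (ramp z e)^`() = ramp' z e by apply: is_derive_derive1; exact: is_derive_ramp.
by apply: smooth_continuous; apply: smooth_derive1; exact: smooth_ramp.
Qed.

Lemma ramp_ge0 z e x : 0 <= ramp z e x. Proof. exact: step_ge0. Qed.
Lemma ramp_le1 z e x : ramp z e x <= 1. Proof. exact: step_le1. Qed.

Lemma ramp_left z e x : 0 < e -> x <= z -> ramp z e x = 0.
Proof.
move=> e0 xz; rewrite /ramp step_le0// mulrC -mulrBl.
by rewrite mulr_le0_ge0 ?invr_ge0 ?subr_le0// ltW.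
Qed.

Lemma ramp_right z e x : 0 < e -> z + e <= x -> ramp z e x = 1.
Proof.
move=> e0 xz; rewrite /ramp step_ge1// mulrC -mulrBl.
by rewrite ler_pdivlMr// mul1r; lra.
Qed.

Lemma ramp'_ge0 z e x : 0 < e -> 0 <= ramp' z e x.
Proof. by move=> e0; rewrite mulr_ge0 ?step_derive_ge0// invr_ge0 ltW. Qed.

Lemma is_derive_cst_side v x d (c : R) (s : bool) : is_derive x 1 v d ->
  (forall y, (if s then x <= y else y <= x) -> v y = c) -> d = 0.
Proof.
move=> /is_derive_epsP H vc; apply/eqP; rewrite -normr_le0.
apply/ler_addgt0Pr => e e0; rewrite add0r.
have [r r0 {}H] := H e e0.
pose y := if s then x + r / 2 else x - r / 2.
have r20 : 0 < r / 2 by lra.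
have yx : `|y - x| = r / 2.
  by rewrite /y; case: (s); rewrite addrAC subrr add0r ?normrN gtr0_norm.
have := H y; rewrite yx !vc; last 2 first.
- by case: s vc {H y yx} => _; exact: lexx.
- by rewrite /y; case: s vc {H y yx} => _; lra.
rewrite subrr sub0r normrN normrM yx ler_pM2r//; apply; lra.
Qed.

Lemma ramp'_left z e x : 0 < e -> x <= z -> ramp' z e x = 0.
Proof.
move=> e0 xz; apply: (@is_derive_cst_side _ _ _ 0 false (is_derive_ramp z e x)).
by move=> y yx; rewrite ramp_left// (le_trans yx).
Qed.

Lemma ramp'_right z e x : 0 < e -> z + e <= x -> ramp' z e x = 0.
Proof.
move=> e0 xz; apply: (@is_derive_cst_side _ _ _ 1 true (is_derive_ramp z e x)).
by move=> y yx; rewrite ramp_right// (le_trans xz).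
Qed.

(** The derivatives of the ramps are an approximate identity. *)
Lemma ramp'_approx psi a c z e l : 0 < e -> a <= z -> z + e <= c ->
  {within `[a, c], continuous psi} ->
  (forall x, z <= x <= z + e -> `|psi x - psi z| <= l) ->
  `|\int[leb]_(x in `[a, c]) (psi x * ramp' z e x) - psi z| <= l.
Proof.
move=> e0 az zc cpsi psil.
have ac : a <= c by lra.
have cr : {within `[a, c], continuous (ramp' z e)}.
  exact/continuous_subspaceT/continuous_ramp'.
have int1 : \int[leb]_(x in `[a, c]) ramp' z e x = 1.
  rewrite (Rintegral_derive ac (is_derive_ramp z e)); last exact: continuous_ramp'.
  by rewrite ramp_right// ramp_left// subr0.
have ir : leb.-integrable `[a, c] (EFin \o ramp' z e) by exact: integrable_itv_continuous.
have ip : leb.-integrable `[a, c] (EFin \o (fun x => psi x * ramp' z e x)).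
  by apply: integrable_itv_continuous; exact: within_continuousM.
have icp : leb.-integrable `[a, c] (EFin \o (fun x => psi z * ramp' z e x)).
  by apply: integrable_itv_continuous; apply: within_continuousM => //; apply: continuous_subspaceT => x; exact: cvg_cst.
rewrite -[X in _ - X]mulr1 -int1 -RintegralZl// -RintegralB//.
have ib : leb.-integrable `[a, c] (EFin \o (fun x => psi x * ramp' z e x - psi z * ramp' z e x)).
  by apply: integrable_itv_continuous; apply: within_continuousB; apply: within_continuousM => //;
    apply: continuous_subspaceT => x; exact: cvg_cst.
apply: le_trans (le_normr_Rintegral _ ib) _ => //.
rewrite -[leRHS]mulr1 -int1 -RintegralZl//; apply: le_Rintegral => //.
- exact: integrable_norm.
- by apply: integrable_itv_continuous; apply: within_continuousM => //; apply: continuous_subspaceT => x; exact: cvg_cst.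
move=> x _; rewrite -mulrBl normrM [`|ramp' _ _ _|]ger0_norm ?ramp'_ge0//.
have [xz|zx] := leP x z; first by rewrite ramp'_left// !mulr0.
have [zex|xze] := leP (z + e) x; first by rewrite ramp'_right// !mulr0.
by rewrite ler_wpM2r ?ramp'_ge0// psil// !ltW.
Qed.

End integrals.

Section distributional_derivatives.
Context {R : realType}.
Notation leb := (@lebesgue_measure R).
Implicit Types (v w g psi : R -> R) (nu : @fmeasure R) (a b c x z e d l : R).

(** Young's inequality, with a weight [l] to be optimized by the user; integrated, it
    plays the role of the Cauchy-Schwarz inequality. *)
Lemma le_half_sqr (l t : R) : 0 < l -> `|t| <= 2^-1 * (l + t ^+ 2 / l).
Proof.
move=> l0; rewrite ler_pdivlMl//.
have : 0 <= (`|t| - l) ^+ 2 / l by rewrite divr_ge0 ?sqr_ge0// ltW.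
have -> : (`|t| - l) ^+ 2 / l = t ^+ 2 / l - 2 * `|t| + l.
  by rewrite -(real_normK (num_real t)); field; rewrite gt_eqF.
lra.
Qed.

(** The difference of two ramps, at [a] and at [b], approximates the indicator
    function of [[a, b]]; tested against it, the distributional derivative gives
    the increment, because the derivatives of the ramps are approximate identities.
    The second ramp lies in [[b, c]]. *)
Lemma distr_derivative_increment v w a b c l : 0 < a -> a < b -> b < c ->
  {within Rplus, continuous v} -> distr_derivative v w ->
  square_integrable Rplus w -> 0 < l ->
  `|v b - v a| <= 2^-1 * (l * (c - a) + (\int[leb]_(x in `[a, c]) (w x ^+ 2)) / l).
Proof.
move=> a0 ab bc cv vw [mw w2] l0.
have acR : `[a, c] `<=` (Rplus : set R).
  by move=> x; rewrite /Rplus/= !in_itv/= andbT => /andP[ax _]; rewrite (le_trans (ltW a0)).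
have cvac : {within `[a, c], continuous v} by exact: continuous_subspaceW cv.
have mwac : measurable_fun `[a, c] w by exact: measurable_funS measurable_Rplus acR mw.
have iw2 : leb.-integrable `[a, c] (EFin \o (fun x => w x ^+ 2)).
  apply: (@integrableS _ _ _ leb Rplus `[a, c] (EFin \o (fun x => w x ^+ 2)) measurable_Rplus (measurable_itv _) acR).
  apply/integrableP; split; first by apply/measurable_EFinP; exact: measurable_funX.
  by under eq_integral => x _ do rewrite /= ger0_norm ?sqr_ge0//.
have icst k : leb.-integrable `[a, c] (EFin \o (fun=> k : R)).
  by apply: integrable_itv_continuous; apply: continuous_subspaceT => x; exact: cvg_cst.
have ibnd : leb.-integrable `[a, c] (EFin \o (fun x => 2^-1 * (l + w x ^+ 2 / l))).
  have := integrable_linear (mu := leb) (2^-1 / l) (measurable_itv _) iw2 (icst (2^-1 * l)).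
  by apply: eq_integrable => // x _ /=; congr EFin; ring.
apply/ler_addgt0Pr => eta eta0.
have eta40 : 0 < eta / 4 by rewrite divr_gt0.
have cP x : 0 <= x -> exists2 r : R, 0 < r & forall y, 0 <= y -> `|y - x| < r -> `|v y - v x| < eta / 4.
  move/within_epsP: cv => /(_ x) H x0.
  have [|r r0 Hr] := H _ _ eta40; first by rewrite /Rplus/= in_itv/= x0.
  by exists r => // y y0; apply: Hr; rewrite /Rplus/= in_itv/= y0.
have [r1 r10 Hr1] := cP a (ltW a0).
have [r2 r20 Hr2] := cP b (ltW (lt_trans a0 ab)).
have [e e0 [er1 er2 ec]] : exists2 e : R, 0 < e & [/\ e < r1, e < r2 & e <= c - b].
  have cb0 : 0 < c - b by lra.
  exists (Num.min (r1 / 2) (Num.min (r2 / 2) (c - b))).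
    by rewrite !lt_min !divr_gt0.
  split.
  - by rewrite gt_min; apply/orP; left; lra.
  - by rewrite !gt_min; apply/orP; right; apply/orP; left; lra.
  - by rewrite !ge_min lexx !orbT.
pose g x := ramp a e x + -1 * ramp b e x.
have sg : smooth g.
  by apply: smoothD; [exact: smooth_ramp|apply: smoothM; [exact: smooth_cst|exact: smooth_ramp]].
have gout x : ~ (a <= x <= c) -> g x = 0.
  move=> xac; rewrite /g; have [xa|ax] := leP x a.
    by rewrite !ramp_left// ?mulr0 ?addr0//; lra.
  rewrite !ramp_right//; lra.
have g'E x : g^`() x = ramp' a e x - ramp' b e x.
  rewrite derive1E; have := is_deriveB (is_derive_ramp a e x) (is_derive_ramp b e x).
  move=> [_ <-]; congr ('D_1 _ x); apply/funext => y.
  by rewrite /g mulN1r.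
have := vw g sg (ex_intro _ a (ex_intro _ c (conj a0 gout))).
rewrite (Rintegral_support leb acR); last first.
  move=> x _ /=; rewrite in_itv/= => xac; rewrite g'E.
  have [xa|ax] := leP x a.
    by rewrite !ramp'_left// ?subrr ?mulr0//; lra.
  by rewrite !ramp'_right ?subrr ?mulr0//; lra.
rewrite (Rintegral_support leb acR); last first.
  by move=> x _ /=; rewrite in_itv/= => /gout ->; rewrite mulr0.
have cvr z : {within `[a, c], continuous (fun x => v x * ramp' z e x)}.
  by apply: within_continuousM => //; exact/continuous_subspaceT/continuous_ramp'.
under eq_Rintegral => x _ do rewrite g'E mulrBr.
rewrite RintegralB//; last 2 first.
- exact: integrable_itv_continuous.
- exact: integrable_itv_continuous.
have Ha : `|\int[leb]_(x in `[a, c]) (v x * ramp' a e x) - v a| <= eta / 4.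
  apply: ramp'_approx => //; first lra.
  move=> x /andP[ax xe]; apply/ltW/Hr1; first lra.
  by rewrite ger0_norm; lra.
have Hb : `|\int[leb]_(x in `[a, c]) (v x * ramp' b e x) - v b| <= eta / 4.
  apply: ramp'_approx => //; [lra|lra|].
  move=> x /andP[ax xe]; apply/ltW/Hr2; first lra.
  by rewrite ger0_norm; lra.
have iwg : leb.-integrable `[a, c] (EFin \o (fun x => w x * g x)).
  apply: le_integrable ibnd => //.
    apply/measurable_EFinP; apply: measurable_funM => //.
    by apply: measurable_funTS; apply: continuous_measurable_fun; exact: smooth_continuous.
  move=> x _ /=; rewrite lee_fin normrM.
  apply: (@le_trans _ _ `|w x|).
    rewrite ler_piMr// ler_norml /g mulN1r.
    have := ramp_ge0 a e x; have := ramp_ge0 b e x.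
    have := ramp_le1 a e x; have := ramp_le1 b e x.
    by move=> ? ? ? ?; apply/andP; split; lra.
  by apply: le_trans (ler_norm _); exact: le_half_sqr.
have Hw : `|\int[leb]_(x in `[a, c]) (w x * g x)| <=
    2^-1 * (l * (c - a) + (\int[leb]_(x in `[a, c]) (w x ^+ 2)) / l).
  apply: le_trans (le_normr_Rintegral _ iwg) _ => //.
  apply: (@le_trans _ _ (\int[leb]_(x in `[a, c]) (2^-1 * (l + w x ^+ 2 / l)))).
    apply: le_Rintegral => //; first exact: integrable_norm.
    move=> x _; rewrite normrM.
    apply: (@le_trans _ _ `|w x|); last exact: le_half_sqr.
    rewrite ler_piMr// ler_norml /g mulN1r.
    have := ramp_ge0 a e x; have := ramp_ge0 b e x.
    have := ramp_le1 a e x; have := ramp_le1 b e x.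
    by move=> ? ? ? ?; apply/andP; split; lra.
  have -> : \int[leb]_(x in `[a, c]) (2^-1 * (l + w x ^+ 2 / l)) =
      \int[leb]_(x in `[a, c]) (2^-1 * l + (2^-1 / l) * w x ^+ 2).
    by apply: eq_Rintegral => x _; ring.
  rewrite RintegralD//; last exact: (@integrableZl _ _ _ leb _ _ (2^-1 / l) _ iw2).
  rewrite Rintegral_cst// RintegralZl//.
  rewrite [X in fine X](_ : _ = (c - a)%:E); last first.
    by apply: (lebesgue_measure_bnd true false); lra.
  by rewrite le_eqVlt; apply/orP; left; apply/eqP => /=; ring.
move=> E; move: Ha Hb Hw.
set Ia := \int[leb]_(x in `[a, c]) (v x * ramp' a e x) in E *.
set Ib := \int[leb]_(x in `[a, c]) (v x * ramp' b e x) in E *.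
set Iw := \int[leb]_(x in `[a, c]) (w x * g x) in E *.
set B := 2^-1 * (l * (c - a) + _); clearbody Ia Ib Iw B.
rewrite !ler_norml => /andP[? ?] /andP[? ?] /andP[? ?].
by apply/andP; split; lra.
Qed.

End distributional_derivatives.

(** * The energy bound *)
Section domain.
Context {R : realType}.
Notation leb := (@lebesgue_measure R).
Implicit Types (v w g psi : R -> R) (nu : @fmeasure R) (a b c p q x z e l k : R).

Lemma within_RplusP v : {within Rplus, continuous v} <->
  forall x, 0 <= x -> forall e, 0 < e -> exists2 r : R, 0 < r &
    forall z, 0 <= z -> `|z - x| < r -> `|v z - v x| < e.
Proof.
rewrite within_epsP; split=> H x x0 e e0.
  have [|r r0 Hr] := H x _ e e0; first by rewrite /Rplus/= in_itv/= x0.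
  by exists r => // z z0; apply: Hr; rewrite /Rplus/= in_itv/= z0.
move: x0; rewrite /Rplus/= in_itv/= andbT => x0; have [r r0 Hr] := H x x0 e e0.
by exists r => // z; rewrite in_itv/= andbT; exact: Hr.
Qed.

Lemma mass_oc nu x z : z <= x -> 0 <= z -> nu `]z, x] = (mass nu x - mass nu z)%:E.
Proof.
move=> zx z0.
have E : `[0, x]%classic = `[0, z] `|` `]z, x] :> set R.
  apply/seteqP; split => y; rewrite /= !in_itv/=.
    by move=> /andP[y0 yx]; case: (leP y z) => yz; [left; rewrite y0|right].
  move=> [/andP[-> /le_trans->]//|/andP[zy ->]].
  by rewrite (le_trans z0)// ltW.
have : nu `[0%R, x] = (nu `[0%R, z] + nu `]z, x])%E.
  rewrite {1}E measureU//; apply/seteqP; split => // y.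
  by rewrite /= !in_itv/= => -[/andP[_ yz] /andP[]]; rewrite ltNge yz.
rewrite !massE.
have : nu `]z, x] \is a fin_num by rewrite fin_num_measure.
move=> /fineK <-; rewrite -EFinD => -[->]; congr EFin; lra.
Qed.

(** The energy of an element of the domain is at most its mass; with Young's
    inequality in place of Cauchy-Schwarz this bounds increments. The hypothesis is
    about closed intervals inside ]p, q[, so that atoms at [p] and [q] do not count. *)
Lemma domain_increment v nu p q k l : in_domain (v, nu) -> 0 <= p -> p < q -> 0 < l ->
  (forall z c, p < z -> z <= c -> c < q -> mass nu c - mass nu z <= k) ->
  `|v q - v p| <= 2^-1 * (l * (q - p) + k / l).
Proof.
move=> [/= cv v0 nu0 [w [nua [nus [vw sw [nuE _ _] nuaE]]]]] p0 pq l0 Hk.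
apply/ler_addgt0Pr => e e0; have e20 : 0 < e / 2 by lra.
move/within_RplusP: (cv) => cvP.
have q0 : 0 <= q by lra.
have [r r0 Hr] := cvP p p0 _ e20; have [s s0 Hs] := cvP q q0 _ e20.
pose d := Num.min (r / 2) (Num.min (s / 2) ((q - p) / 4)).
have d0 : 0 < d by rewrite !lt_min; apply/and3P; split; lra.
have [dr ds dq] : [/\ d <= r / 2, d <= s / 2 & d <= (q - p) / 4].
  by rewrite !ge_min !lexx !orbT.
clearbody d.
pose a := p + d; pose b := q - d; pose c := q - d / 2; pose z := p + d / 2.
have Ha : `|v a - v p| < e / 2.
  by apply: Hr; rewrite /a; [lra|rewrite addrAC subrr add0r gtr0_norm//; lra].
have Hb : `|v b - v q| < e / 2.
  by apply: Hs; rewrite /b; [lra|rewrite addrAC subrr add0r normrN gtr0_norm//; lra].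
have a0 : 0 < a by rewrite /a; lra.
have ab : a < b by rewrite /a /b; lra.
have bc : b < c by rewrite /b /c; lra.
have cp : c - a <= q - p by rewrite /c /a; lra.
have za : z < a by rewrite /a /z; lra.
have pz : p < z by rewrite /z; lra.
have cq : c < q by rewrite /c; lra.
clearbody a b c z.
have zc : z <= c by lra.
have := distr_derivative_increment a0 ab bc cv vw sw l0.
have : \int[leb]_(x in `[a, c]) (w x ^+ 2) <= k.
  apply: le_trans (Hk z c pz zc cq).
  have acR : `[a, c] `&` Rplus = `[a, c] :> set R.
    apply: setIidl => x; rewrite /Rplus/= !in_itv/= andbT => /andP[ax _].
    by rewrite (le_trans (ltW a0)).
  have -> : \int[leb]_(x in `[a, c]) (w x ^+ 2) = fine (nua `[a, c]).
    by rewrite nuaE ?acR//; exact: measurable_itv.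
  have z0 : 0 <= z by lra.
  have le1 : (nua `[a, c] <= nu `[a, c])%E.
    by rewrite nuE ?leeDl//; exact: measurable_itv.
  have le2 : (nu `[a, c] <= nu `]z, c])%E.
    rewrite le_measure ?inE//; move=> x /=; rewrite !in_itv/= => /andP[ax ->].
    by rewrite (lt_le_trans za).
  have := le_trans le1 le2; rewrite mass_oc//.
  have : (0 <= nua `[a, c])%E by exact: measure_ge0.
  by case: (nua `[a, c]).
set I := \int[leb]_(x in _) _; clearbody I => IK HI.
have : l * (c - a) <= l * (q - p) by rewrite ler_wpM2l// ltW.
have : I / l <= k / l by rewrite ler_wpM2r// invr_ge0 ltW.
have -> : v q - v p = (v b - v a) - (v b - v q) + (v a - v p) by ring.
move=> h1 h2; apply: le_trans (ler_normD _ _) _.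
have := ler_normB (v b - v a) (v b - v q).
move: HI Ha Hb h1 h2; clear; lra.
Qed.

(** Without mass there is no energy. *)
Lemma domain_gap v nu p q : in_domain (v, nu) -> 0 <= p -> p <= q ->
  mass nu q <= mass nu p -> v q = v p.
Proof.
move=> D p0; rewrite le_eqVlt => /predU1P[->//|pq] m.
apply/eqP; rewrite -subr_eq0 -normr_le0; apply/ler_addgt0Pr => e e0.
have l0 : 0 < e / (q - p) by rewrite divr_gt0//; lra.
have H := @domain_increment v nu p q 0 (e / (q - p)) D p0 pq l0.
apply: le_trans (H _) _.
  move=> z c pz _ cq; have := le_mass nu (ltW cq); have := le_mass nu (ltW pz).
  by move: m; lra.
by rewrite divfK ?mul0r; [lra|rewrite gt_eqF//; lra].
Qed.

Lemma domain_bound v nu x k l : in_domain (v, nu) -> 0 <= x -> 0 <= k -> 0 < l ->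
  (forall z, z < x -> mass nu z <= k) -> `|v x| <= 2^-1 * (l * x + k / l).
Proof.
move=> D; rewrite le_eqVlt => /predU1P[<-|x0] k0 l0 H.
  by have [_ /= -> _ _] := D; rewrite normr0 mulr0 add0r mulr_ge0// divr_ge0// ltW.
have := @domain_increment v nu 0 x k l D (lexx 0) x0 l0.
have [_ /= -> _ _] := D; rewrite !subr0; apply.
move=> z c _ zc cx; apply: le_trans (H c cx); rewrite gerBl.
exact: mass_ge0.
Qed.

Lemma domain_mass_inverse_bound v nu xi l : in_domain (v, nu) -> 0 < xi ->
  reached nu xi -> 0 < l ->
  `|v (mass_inverse nu xi)| <= 2^-1 * (l * mass_inverse nu xi + xi / l).
Proof.
move=> D xi0 rxi l0; apply: domain_bound D _ _ _ _ => //.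
- exact: mass_inverse_ge0.
- exact: ltW.
- by move=> z; rewrite mass_inverse_gt// => /ltW.
Qed.

(** There is no mass between [mass_inverse nu (mass nu x)] and [x], so the values at
    the points of the generalized inverse determine [v]. *)
Lemma domain_lagrangian v nu x : in_domain (v, nu) -> 0 <= x ->
  v x = v (mass_inverse nu (mass nu x)).
Proof.
move=> D x0; have := mass_ge0 nu x; rewrite le_eqVlt => /predU1P[m0|m0].
  by rewrite -m0 mass_inverse0; apply: domain_gap D _ _ _ => //; rewrite -m0 mass_ge0.
have rx : reached nu (mass nu x) by exists x.
apply: domain_gap D _ _ _.
- exact: mass_inverse_ge0.
- by rewrite mass_inverse_le.
- by rewrite mass_mass_inverse.
Qed.

End domain.

(** * Transport of mass across moving lines *)
Section cutoffs.
Context {R : realType}.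
Notation leb := (@lebesgue_measure R).
Implicit Types (A B C : R -> R) (nu : @fmeasure R).

Lemma integrable_bounded (d : measure_display) (T : measurableType d)
    (mu : {measure set T -> \bar R}) (D : set T) (F : T -> R) (K : R) :
  measurable D -> (mu D < +oo)%E -> measurable_fun D F ->
  (forall t, D t -> `|F t| <= K) -> mu.-integrable D (EFin \o F).
Proof.
move=> mD muD mF FK; apply: measurable_bounded_integrable => //.
exists K; split; first exact: num_real.
by move=> M KM t Dt /=; apply: le_trans (FK _ Dt) (ltW KM).
Qed.

Lemma Rintegral_le0 (d : measure_display) (T : measurableType d)
    (mu : {measure set T -> \bar R}) (D : set T) (F : T -> R) :
  (forall t, D t -> F t <= 0) -> \int[mu]_(t in D) F t <= 0.
Proof.
move=> F0; have E : (\int[mu]_(t in D) (F t)%:E = - \int[mu]_(t in D) (- F t)%:E)%E.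
  rewrite -integral_ge0N.
    by apply: eq_integral => t _; rewrite -EFinN opprK.
  by move=> t Dt; rewrite lee_fin oppr_ge0 F0.
rewrite /Rintegral E fine_le0// oppe_le0 integral_ge0// => t Dt.
by rewrite lee_fin oppr_ge0 F0.
Qed.

Lemma mass_Rintegral nu x : \int[nu]_(t in `[0, x]) (1 : R) = mass nu x.
Proof. by rewrite Rintegral_cst ?mul1r. Qed.

(** [A] lies between the indicator functions of ]-oo, p] and of ]-oo, q]. *)
Lemma cutoff_integral_bounds nu A p q : continuous A ->
  (forall x, 0 <= A x <= 1) -> (forall x, x <= p -> A x = 1) ->
  (forall x, q <= x -> A x = 0) ->
  mass nu p <= \int[nu]_(x in Rplus) A x <= mass nu q.
Proof.
move=> cA A01 Ap Aq.
have mA D : measurable_fun D A.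
  by apply: measurable_funTS; exact: continuous_measurable_fun.
have sub z : `[0, z] `<=` (Rplus : set R) by apply: subset_itvl.
have fin D : measurable D -> (nu D < +oo)%E.
  by move=> mD; rewrite ltey_eq fin_num_measure.
have iA D : measurable D -> nu.-integrable D (EFin \o A).
  move=> mD; apply: (@integrable_bounded _ _ nu _ _ 1 mD (fin _ mD) (mA _)).
  by move=> x _; have /andP[? ?] := A01 x; rewrite ger0_norm.
apply/andP; split.
  pose F := (fun=> 1 : R) \_ (`[0, p]%classic : set R).
  have -> : mass nu p = \int[nu]_(x in Rplus) F x.
    rewrite (Rintegral_support nu (sub p)); last first.
      by move=> x _ xp; rewrite /F patchE memNset.
    rewrite -mass_Rintegral; apply: eq_Rintegral => x xp.
    by rewrite /F patchE xp.
  apply: le_Rintegral.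
  - exact: measurable_Rplus.
  - apply: (@integrable_bounded _ _ nu _ _ 1); first exact: measurable_Rplus.
    + exact: fin measurable_Rplus.
    + apply: measurable_funTS; apply/(measurable_restrictT _ _).1 => //.
    + by move=> x _; rewrite /F patchE; case: ifP => _; rewrite ?normr1 ?normr0.
  - exact: iA measurable_Rplus.
  - move=> x _; rewrite /F patchE; case: ifPn.
      by rewrite inE/= in_itv/= => /andP[_ /Ap ->].
    by have /andP[] := A01 x.
rewrite (Rintegral_support nu (sub q)); last first.
  move=> x; rewrite /Rplus/= !in_itv/= andbT => -> /= /negP.
  by rewrite -ltNge => /ltW/Aq.
rewrite -mass_Rintegral; apply: le_Rintegral.
- exact: measurable_itv.
- exact: iA (measurable_itv _).
- by apply: (@integrable_bounded _ _ nu _ _ 1) => //;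
    [exact: fin (measurable_itv _)|move=> x _; rewrite normr1].
- by move=> x _; have /andP[] := A01 x.
Qed.

(** Test functions that depend on time and space through a profile [A] constant on
    parallel lines; the factors [B] and [C] make the support compact. *)
Section product_test.
Variables (A B C : R -> R) (al be ga K : R).
Hypotheses (sA : smooth A) (sB : smooth B) (sC : smooth C).
Let phi t x := A (al * t + (be * x + ga)) * B x * C t.
Hypothesis phi0 : forall t x : R, K < `|t| \/ K < `|x| -> phi t x = 0.

Let dt (t x : R) : is_derive t 1 (phi^~ x)
  (al * A^`() (al * t + (be * x + ga)) * B x * C t +
   A (al * t + (be * x + ga)) * B x * C^`() t).
Proof.
have d1 : is_derive t 1 (fun t => A (al * t + (be * x + ga))) (A^`() (al * t + (be * x + ga)) * al).
  exact: (is_derive1_comp (smooth_is_derive _ sA) (is_derive_affine _ _ _)).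
have d2 := is_deriveM d1 (is_derive_cst (B x) t 1).
have := is_deriveM d2 (smooth_is_derive t sC).
apply: is_derive_ext => //; rewrite /GRing.scale/=.
rewrite (_ : ((fun t => A (al * t + (be * x + ga))) * cst (B x)) t = A (al * t + (be * x + ga)) * B x)//.
by rewrite /cst; ring.
Qed.

Let dx (t x : R) : is_derive x 1 (phi t)
  (be * A^`() (al * t + (be * x + ga)) * B x * C t +
   A (al * t + (be * x + ga)) * B^`() x * C t).
Proof.
have d1 : is_derive x 1 (fun x => A (al * t + (be * x + ga))) (A^`() (al * t + (be * x + ga)) * be).
  have -> : (fun x => A (al * t + (be * x + ga))) = A \o (fun x => be * x + (al * t + ga)).
    by apply/funext => z /=; congr A; ring.
  have -> : al * t + (be * x + ga) = be * x + (al * t + ga) by ring.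
  exact: (is_derive1_comp (smooth_is_derive _ sA) (is_derive_affine _ _ _)).
have d2 := is_deriveM d1 (smooth_is_derive x sB).
have := is_deriveM d2 (is_derive_cst (C t) x 1).
apply: is_derive_ext => //; rewrite /GRing.scale/=.
rewrite (_ : ((fun x => A (al * t + (be * x + ga))) * B) x = A (al * t + (be * x + ga)) * B x)//.
by rewrite /cst; ring.
Qed.

Lemma product_test_t (t x : R) : (phi^~ x)^`() t =
  al * A^`() (al * t + (be * x + ga)) * B x * C t +
   A (al * t + (be * x + ga)) * B x * C^`() t.
Proof. by rewrite derive1E; have [_ ->] := dt t x. Qed.

Lemma product_test_x (t x : R) : (phi t)^`() x =
  be * A^`() (al * t + (be * x + ga)) * B x * C t +
   A (al * t + (be * x + ga)) * B^`() x * C t.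
Proof. by rewrite derive1E; have [_ ->] := dx t x. Qed.

Lemma product_test : C1_test phi.
Proof.
have cfst g : smooth g -> continuous (fun z : R * R => g z.1).
  move=> sg z; apply: (@continuous_comp _ _ _ fst g); first exact: cvg_fst.
  exact: smooth_continuous.
have csnd g : smooth g -> continuous (fun z : R * R => g z.2).
  move=> sg z; apply: (@continuous_comp _ _ _ snd g); first exact: cvg_snd.
  exact: smooth_continuous.
have clin g : smooth g -> continuous (fun z : R * R => g (al * z.1 + (be * z.2 + ga))).
  move=> sg z; apply: (@continuous_comp _ _ _ (fun z : R * R => al * z.1 + (be * z.2 + ga)) g).
    apply: cvgD; first by apply: cvgM; [exact: cvg_cst|exact: cvg_fst].
    apply: cvgD; last exact: cvg_cst.
    by apply: cvgM; [exact: cvg_cst|exact: cvg_snd].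
  exact: smooth_continuous.
have sA' := smooth_derive1 sA; have sB' := smooth_derive1 sB; have sC' := smooth_derive1 sC.
split.
- by move=> t x; split; [have [] := dt t x|have [] := dx t x].
- under eq_fun do rewrite product_test_t.
  move=> z; apply: cvgD.
    apply: cvgM; last exact: cfst.
    apply: cvgM; last exact: csnd.
    by apply: cvgM; [exact: cvg_cst|exact: clin].
  by apply: cvgM; [apply: cvgM; [exact: clin|exact: csnd]|exact: cfst].
- under eq_fun do rewrite product_test_x.
  move=> z; apply: cvgD.
    apply: cvgM; last exact: cfst.
    apply: cvgM; last exact: csnd.
    by apply: cvgM; [exact: cvg_cst|exact: clin].
  by apply: cvgM; [apply: cvgM; [exact: clin|exact: csnd]|exact: cfst].
- by exists K.
Qed.

End product_test.

End cutoffs.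

Section transport.
Context {R : realType}.
Notation leb := (@lebesgue_measure R).
Variables (f : R -> R) (u : R -> R -> R) (nu : @fmeasure R) (mu : R -> @fmeasure R).
Hypothesis transport : measure_valued_solution f u nu mu.

(* integrated against a measure, x |-> cut r (x - s) gives the mass on the left of s,
   up to a layer of width r *)
Let cut (r : R) x : R := 1 + -1 * ramp 0 r x.

Let smooth_cut r : smooth (cut r).
Proof.
by apply: smoothD; [exact: smooth_cst|apply: smoothM; [exact: smooth_cst|exact: smooth_ramp]].
Qed.

Let cut' r x : (cut r)^`() x = - ramp' 0 r x.
Proof.
have : is_derive x 1 (cut r) (- ramp' 0 r x).
  apply: is_derive_ext (is_deriveB (is_derive_cst (1 : R) x 1) (is_derive_ramp 0 r x)).
    by apply/funext => y; rewrite /cut mulN1r.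
  by rewrite sub0r.
by rewrite derive1E => -[_ ->].
Qed.

(* The cut-off moves with speed c and the particles with speed f'(u), so the mass on
   the left changes at the rate c - f'(u), integrated over the layer. In the test
   function, B cuts off negative x, over which nothing is integrated, and C cuts off
   times outside [t1, t2]; the profile itself vanishes for large x. *)
Let line_identity (t1 t2 x1 c r : R) : 0 <= t1 -> t1 < t2 -> 0 < r ->
  exists G : R -> R, [/\ leb.-integrable `[t1, t2] (EFin \o G),
    \int[mu t2]_(x in Rplus) cut r (x - (x1 + c * (t2 - t1))) -
    \int[mu t1]_(x in Rplus) cut r (x - x1) = \int[leb]_(t in `[t1, t2]) G t
  & forall t, t1 <= t <= t2 -> G t = \int[mu t]_(x in Rplus)
      (ramp' 0 r (x - (x1 + c * (t - t1))) * (c - f^`() (u t x)))].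
Proof.
move=> t10 t12 r0.
pose B x : R := ramp (-2) 1 x.
pose C t : R := ramp (t1 - 2) 1 t * (1 + -1 * ramp (t2 + 1) 1 t).
pose phi t x := cut r (- c * t + (1 * x + (c * t1 - x1))) * B x * C t.
have sB : smooth B by exact: smooth_ramp.
have sC : smooth C.
  apply: smoothM; first exact: smooth_ramp.
  by apply: smoothD; [exact: smooth_cst|apply: smoothM; [exact: smooth_cst|exact: smooth_ramp]].
have B1 (x : R) : -1 <= x -> B x = 1 by move=> x1'; rewrite /B ramp_right//; lra.
have B'0 (x : R) : 0 <= x -> B^`() x = 0.
  move=> x0; apply: (@is_derive_cst_side _ _ x _ 1 true (smooth_is_derive x sB)).
  by move=> y xy; rewrite B1//; lra.
have C1 (t : R) : t1 - 1 <= t -> t <= t2 + 1 -> C t = 1.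
  by move=> ? ?; rewrite /C ramp_right ?ramp_left//; lra.
have C'0 t : t1 <= t -> t <= t2 -> C^`() t = 0.
  move=> t1t tt2; rewrite derive1E; suff [_ ->] : is_derive t 1 C 0 by [].
  apply: (@is_derive_local _ (cst 1) _ _ _ _ ltr01 _ (is_derive_cst (1 : R) t 1)).
  by move=> y; rewrite ltr_norml => /andP[? ?]; rewrite C1//; lra.
(* outside the square of size K, one of the three factors vanishes *)
pose K := 2 + `|t1| + `|t2| + `|x1| + `|c| * (2 + `|t1| + `|t2| + `|t1|) + r.
have KB : [/\ 2 + `|t1| + `|t2| <= K & 2 <= K].
  have := normr_ge0 t1; have := normr_ge0 t2; have := normr_ge0 x1.
  have : 0 <= `|c| * (2 + `|t1| + `|t2| + `|t1|) by rewrite mulr_ge0 ?addr_ge0.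
  by rewrite /K => ? ? ? ?; split; lra.
have phi0 (t x : R) : K < `|t| \/ K < `|x| -> phi t x = 0.
  have C0 : 2 + `|t1| + `|t2| < `|t| -> C t = 0.
    have := ler_norm t1; have := ler_norm (- t1); have := ler_norm t2; have := ler_norm (- t2).
    rewrite !normrN => ? ? ? ?.
    have [t0|t0] := leP 0 t; rewrite ?(ger0_norm t0) ?(ltr0_norm t0) => tK.
      by rewrite /C [X in 1 + -1 * X]ramp_right// ?mulr1 ?subrr ?mulr0//; lra.
    by rewrite /C ramp_left// ?mul0r//; lra.
  rewrite /phi; have [tK|tK] := ltP (2 + `|t1| + `|t2|) `|t|; first by rewrite C0// mulr0.
  move=> [|xK]; first by case: KB; lra.
  have [x0|x0] := ltP x 0.
    rewrite ltr0_norm// in xK; rewrite /B ramp_left// ?mulr0 ?mul0r//.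
    by case: KB; lra.
  rewrite ger0_norm// in xK.
  rewrite /cut ramp_right// ?mulr1 ?subrr ?mul0r//.
  have ct : c * (t - t1) <= `|c| * (2 + `|t1| + `|t2| + `|t1|).
    apply: le_trans (ler_norm _) _; rewrite normrM ler_wpM2l//.
    by apply: le_trans (ler_normB _ _) _; lra.
  have := ler_norm x1; have := normr_ge0 t1; have := normr_ge0 t2.
  by move: xK; rewrite /K; lra.
have := transport.2 phi (product_test (@smooth_cut r) sB sC phi0) t1 t2 t10 t12.
set G := fun t => _ => -[iG EG].
exists G; split => //.
  rewrite -EG; congr (_ - _); apply: eq_Rintegral => x; rewrite inE /Rplus/= in_itv/= andbT => x0.
    by rewrite /phi B1 ?C1 ?mulr1; [congr cut; ring|lra..].
  by rewrite /phi B1 ?C1 ?mulr1; [congr cut; ring|lra..].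
move=> t /andP[t1t tt2]; rewrite /G; apply: eq_Rintegral => x.
rewrite inE /Rplus/= in_itv/= andbT => x0.
rewrite product_test_t// product_test_x// B1 ?C1 ?C'0 ?B'0//; [|lra..].
rewrite cut' (_ : - c * t + (1 * x + (c * t1 - x1)) = x - (x1 + c * (t - t1))); last ring.
by ring.
Qed.

Let cut_bounds r s (m : @fmeasure R) : 0 < r ->
  mass m s <= \int[m]_(x in Rplus) cut r (x - s) <= mass m (s + r).
Proof.
move=> r0; apply: cutoff_integral_bounds.
- move=> x; apply: (@continuous_comp _ _ _ (fun x => x - s) (cut r)).
    by apply: cvgB; [exact: cvg_id|exact: cvg_cst].
  exact: smooth_continuous.
- move=> x; have := ramp_ge0 0 r (x - s); have := ramp_le1 0 r (x - s).
  by rewrite /cut => ? ?; apply/andP; split; lra.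
- by move=> x xs; rewrite /cut ramp_left ?mulr0 ?addr0//; lra.
- by move=> x xs; rewrite /cut ramp_right ?mulr1 ?subrr//; lra.
Qed.

(** A line that is faster than the particles in a layer on its right overtakes them,
    and mass only passes to its left. The width [r] of the layer is arbitrary, because
    the cut-off may be taken as steep as desired. *)
Lemma mass_fast_line (t1 t2 x1 c r : R) : 0 <= t1 -> t1 < t2 -> 0 < r ->
  (forall t x, t1 <= t <= t2 -> 0 <= x ->
     x1 + c * (t - t1) <= x <= x1 + c * (t - t1) + r -> f^`() (u t x) <= c) ->
  mass (mu t1) x1 <= mass (mu t2) (x1 + c * (t2 - t1)).
Proof.
move=> t10 t12 r0 fast; apply/ler_addgt0Pr => e e0.
have [s s0 Hs] := mass_right_continuous (mu t2) (x1 + c * (t2 - t1)) e0.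
pose d := Num.min r s.
have d0 : 0 < d by rewrite lt_min r0.
have [dr ds] : d <= r /\ d <= s by rewrite !ge_min !lexx orbT.
clearbody d.
have [G [_ E GE]] := line_identity x1 c t10 t12 d0.
have /andP[H1 _] := cut_bounds x1 (mu t1) d0.
have /andP[_ H2] := cut_bounds (x1 + c * (t2 - t1)) (mu t2) d0.
have G0 : 0 <= \int[leb]_(t in `[t1, t2]) G t.
  apply: Rintegral_ge0 => t; rewrite /= in_itv/= => t12'; rewrite GE//.
  apply: Rintegral_ge0 => x; rewrite /Rplus/= in_itv/= andbT => x0.
  have [xl|lx] := leP (x - (x1 + c * (t - t1))) 0; first by rewrite ramp'_left// mul0r.
  have [dx|xd] := leP (0 + d) (x - (x1 + c * (t - t1))); first by rewrite ramp'_right// mul0r.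
  rewrite mulr_ge0 ?ramp'_ge0// subr_ge0; apply: fast => //.
  by apply/andP; split; lra.
have : mass (mu t2) (x1 + c * (t2 - t1) + d) <= mass (mu t2) (x1 + c * (t2 - t1) + s).
  by apply: le_mass; rewrite lerD2l.
rewrite -E in G0; move: H1 H2 G0.
set I1 := \int[mu t1]_(x in Rplus) _; set I2 := \int[mu t2]_(x in Rplus) _.
clearbody I1 I2; move: Hs; clear; lra.
Qed.

(** Symmetrically, mass only passes to the right of a slower line. *)
Lemma mass_slow_line (t1 t2 x1 c r : R) : 0 <= t1 -> t1 < t2 -> 0 < r ->
  (forall t x, t1 <= t <= t2 -> 0 <= x ->
     x1 + c * (t - t1) <= x <= x1 + c * (t - t1) + r -> c <= f^`() (u t x)) ->
  mass (mu t2) (x1 + c * (t2 - t1)) <= mass (mu t1) x1.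
Proof.
move=> t10 t12 r0 slow; apply/ler_addgt0Pr => e e0.
have [s s0 Hs] := mass_right_continuous (mu t1) x1 e0.
pose d := Num.min r s.
have d0 : 0 < d by rewrite lt_min r0.
have [dr ds] : d <= r /\ d <= s by rewrite !ge_min !lexx orbT.
clearbody d.
have [G [_ E GE]] := line_identity x1 c t10 t12 d0.
have /andP[_ H1] := cut_bounds x1 (mu t1) d0.
have /andP[H2 _] := cut_bounds (x1 + c * (t2 - t1)) (mu t2) d0.
have G0 : \int[leb]_(t in `[t1, t2]) G t <= 0.
  apply: Rintegral_le0 => t; rewrite /= in_itv/= => t12'; rewrite GE//.
  apply: Rintegral_le0 => x; rewrite /Rplus/= in_itv/= andbT => x0.
  have [xl|lx] := leP (x - (x1 + c * (t - t1))) 0; first by rewrite ramp'_left// mul0r.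
  have [dx|xd] := leP (0 + d) (x - (x1 + c * (t - t1))); first by rewrite ramp'_right// mul0r.
  rewrite mulr_ge0_le0 ?ramp'_ge0// subr_le0; apply: slow => //.
  by apply/andP; split; lra.
have : mass (mu t1) (x1 + d) <= mass (mu t1) (x1 + s).
  by apply: le_mass; rewrite lerD2l.
rewrite -E in G0; move: H1 H2 G0.
set I1 := \int[mu t1]_(x in Rplus) _; set I2 := \int[mu t2]_(x in Rplus) _.
clearbody I1 I2; move: Hs; clear; lra.
Qed.

End transport.

(** * Motion of the generalized inverse *)
Section flux.
Context {R : realType}.
Variables (f : R -> R) (L : R).
Hypothesis f'_derivable : forall x : R, derivable (f^`()) x 1.
Hypothesis f''_lipschitz : forall a b : R, `|f^`(2) a - f^`(2) b| <= L * `|a - b|.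

Lemma f''_bound (v K : R) : `|v| <= K -> `|f^`(2) v| <= `|f^`(2) 0| + `|L| * K.
Proof.
move=> vK; have := f''_lipschitz v 0; rewrite subr0 => H.
rewrite -{1}(subrK (f^`(2) 0) (f^`(2) v)) addrC.
apply: le_trans (ler_normD _ _) _; rewrite lerD2l; apply: le_trans H _.
apply: le_trans (ler_wpM2r _ (ler_norm L)) _ => //.
by rewrite ler_wpM2l.
Qed.

Lemma f'_is_derive (v : R) : is_derive v 1 (f^`()) (f^`(2) v).
Proof.
by have := derivable_is_derive (@f'_derivable v); rewrite derive1nS derive1n1.
Qed.

Lemma continuous_f' : continuous (f^`()).
Proof. by move=> v; exact: is_derive_continuous (f'_is_derive v). Qed.

Lemma f'_lipschitz (v w K : R) : `|v| <= K -> `|w| <= K ->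
  `|f^`() v - f^`() w| <= (`|f^`(2) 0| + `|L| * K) * `|v - w|.
Proof.
wlog vw : v w / v <= w.
  move=> H vK wK; have [vw|/ltW wv] := leP v w; first exact: H.
  by rewrite distrC [`|v - w|]distrC; exact: H.
move=> vK wK; have [c] : exists2 c : R, c \in `[v, w]%R &
    f^`() w - f^`() v = f^`(2) c * (w - v).
  apply: (@MVT_segment R (f^`()) (f^`(2)) v w vw) => [x _|]; first exact: f'_is_derive.
  exact/continuous_subspaceT/continuous_f'.
rewrite in_itv/= => /andP[vc cw] E; rewrite distrC E normrM [`|v - w|]distrC.
rewrite ler_wpM2r// f''_bound//; move: vK wK; rewrite !ler_norml => /andP[? ?] /andP[? ?].
by apply/andP; split; lra.
Qed.

Lemma f'_quadratic : exists2 K : R, 0 <= K & forall v, `|f^`() v| <= K * (1 + v ^+ 2).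
Proof.
exists (`|f^`() 0| + `|f^`(2) 0| + `|L|); first by rewrite !addr_ge0.
move=> v; have := f'_lipschitz (lexx `|v|) (_ : `|0| <= `|v|).
rewrite normr0 subr0 => /(_ (normr_ge0 _)) H.
have H2 : `|f^`() v| <= `|f^`() 0| + `|f^`() v - f^`() 0|.
  by rewrite -{1}(subrK (f^`() 0) (f^`() v)) addrC ler_normD.
have v2 : `|v| ^+ 2 = v ^+ 2 by rewrite real_normK ?num_real.
move: H H2; rewrite -v2; set m := `|v|.
have : 0 <= m by exact: normr_ge0.
have := normr_ge0 (f^`() 0); have := normr_ge0 (f^`(2) 0); have := normr_ge0 L.
move: `|f^`() v| `|f^`() v - f^`() 0| `|f^`() 0| `|f^`(2) 0| `|L| m; clear => A B C D E m.
have : 0 <= (m - 1) ^+ 2 by exact: sqr_ge0.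
move=> ? ? ? ? ? ? ?.
have : D * m <= D * (1 + m ^+ 2) by rewrite ler_wpM2l//; nra.
have : 0 <= C * m ^+ 2 by rewrite mulr_ge0// sqr_ge0.
nra.
Qed.

End flux.

Section flow.
Context {R : realType}.
Variables (f : R -> R) (L : R).
Hypothesis f'_derivable : forall x : R, derivable (f^`()) x 1.
Hypothesis f''_lipschitz : forall a b : R, `|f^`(2) a - f^`(2) b| <= L * `|a - b|.
Variables (u : R -> R -> R) (nu : @fmeasure R) (mu : R -> @fmeasure R).
Hypothesis u_hoelder : locally_hoelder Rplus u.
Hypothesis transport : measure_valued_solution f u nu mu.
Hypothesis u_domain : forall t : R, 0 <= t -> in_domain (u t, mu t).

Lemma u_bounded T M : exists2 K : R, 0 <= K &
  forall t x : R, 0 <= t <= T -> 0 <= x <= M -> `|u t x| <= K.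
Proof.
have [C [a [a01 H]]] := u_hoelder T M.
have [a0 a1] := andP a01.
exists (`|u 0 0| + `|C| * (T `^ a + M `^ a)).
  by rewrite addr_ge0// mulr_ge0// addr_ge0// powR_ge0.
move=> t x /andP[t0 tT] /andP[x0 xM].
have T0 : 0 <= T by exact: le_trans tT.
have M0 : 0 <= M by exact: le_trans xM.
rewrite -{1}(subrK (u 0 0) (u t x)) addrC.
apply: le_trans (ler_normD _ _) _; rewrite lerD2l.
have := H t 0 x 0; rewrite !subr0 ?x0 ?lexx ?M0 /Rplus/= !in_itv/= !andbT.
move=> /(_ t0 (lexx 0) tT T0 xM isT) {}H; apply: le_trans H _.
apply: (@le_trans _ _ (`|C| * (`|t| `^ a + `|x| `^ a))).
  by rewrite ler_wpM2r ?ler_norm// addr_ge0// powR_ge0.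
rewrite ler_wpM2l// lerD// ge0_ler_powR ?nnegrE// ?ger0_norm// ltW//.
Qed.

Lemma u_uniform T M e : 0 < e -> exists2 d : R, 0 < d & forall s t x z : R,
  0 <= s <= T -> 0 <= t <= T -> 0 <= x <= M -> 0 <= z <= M ->
  `|s - t| <= d -> `|x - z| <= d -> `|u s x - u t z| < e.
Proof.
move=> e0; have [C [a [a01 H]]] := u_hoelder T M.
have [a0 a1] := andP a01.
pose q := e / (2 * (`|C| + 1)).
have C0 : 0 < 2 * (`|C| + 1) by rewrite mulr_gt0// ltr_wpDl.
have q0 : 0 < q by rewrite divr_gt0.
exists (q `^ a^-1); first exact: powR_gt0.
have pq m : 0 <= m -> m <= q `^ a^-1 -> m `^ a <= q.
  move=> m0 mq; have -> : q = (q `^ a^-1) `^ a.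
    by rewrite -powRrM mulVf ?gt_eqF// powRr1// ltW.
  by rewrite ge0_ler_powR ?nnegrE ?powR_ge0// ltW.
move=> s t x z /andP[s0 sT] /andP[t0 tT] xM zM st xz.
have := H s t x z; rewrite /Rplus/= !in_itv/= !andbT.
move=> /(_ s0 t0 sT tT xM zM) {}H; apply: le_lt_trans H _.
apply: (@le_lt_trans _ _ (`|C| * (q + q))).
  apply: (@le_trans _ _ (`|C| * (`|s - t| `^ a + `|x - z| `^ a))).
    by rewrite ler_wpM2r ?ler_norm// addr_ge0// powR_ge0.
  by rewrite ler_wpM2l// lerD// pq.
have -> : `|C| * (q + q) = (2 * `|C|) * q by ring.
have eq : e = (2 * (`|C| + 1)) * q by rewrite /q mulrC divfK// gt_eqF.
rewrite [X in _ < X]eq.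
by rewrite ltr_pM2r//; lra.
Qed.

Lemma speed_uniform T M e : 0 < e -> exists2 d : R, 0 < d & forall s t x z : R,
  0 <= s <= T -> 0 <= t <= T -> 0 <= x <= M -> 0 <= z <= M ->
  `|s - t| <= d -> `|x - z| <= d -> `|f^`() (u s x) - f^`() (u t z)| < e.
Proof.
move=> e0; have [K K0 HK] := u_bounded T M.
pose Q := `|f^`(2) 0| + `|L| * K + 1.
have Q0 : 0 < Q by rewrite ltr_wpDl// addr_ge0// mulr_ge0.
have [|d d0 H] := @u_uniform T M (e / Q); first by rewrite divr_gt0.
exists d => // s t x z sT tT xM zM st xz.
apply: le_lt_trans (f'_lipschitz f'_derivable f''_lipschitz (HK _ _ sT xM) (HK _ _ tT zM)) _.
have := H s t x z sT tT xM zM st xz; rewrite ltr_pdivlMr// => {}H.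
apply: le_lt_trans H; rewrite mulrC ler_wpM2l// /Q; lra.
Qed.

Lemma speed_bounded T M : exists2 K : R, 0 <= K &
  forall t x : R, 0 <= t <= T -> 0 <= x <= M -> `|f^`() (u t x)| <= K.
Proof.
have [K K0 HK] := u_bounded T M.
have [C C0 HC] := f'_quadratic f'_derivable f''_lipschitz.
exists (C * (1 + K ^+ 2)); first by rewrite mulr_ge0// addr_ge0// sqr_ge0.
move=> t x tT xM; apply: le_trans (HC _) _; rewrite ler_wpM2l// lerD2l.
rewrite -[X in X <= _]real_normK ?num_real// ler_sqr ?nnegrE//; exact: HK.
Qed.

(** In a small box around [(t, mass_inverse (mu t) xi)] all speeds are within [e] of
    the speed [a1] at the center. Lines of slope [a1 + e] and [a1 - e] are then faster
    and slower than the particles, and squeeze the position of the label. The box,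
    hence [r], depends only on a bound for the position. *)
Lemma flow_local T Y e : 0 < e -> exists2 r : R, 0 < r & forall t s xi : R,
  0 <= t <= T -> 0 <= s <= T -> 0 < xi -> reached (mu t) xi ->
  mass_inverse (mu t) xi <= Y -> `|s - t| <= r ->
  reached (mu s) xi /\
  `|mass_inverse (mu s) xi - mass_inverse (mu t) xi -
    f^`() (u t (mass_inverse (mu t) xi)) * (s - t)| <= e * `|s - t|.
Proof.
move=> e0.
have [d' d'0 Hd'] := @speed_uniform T (Y + 1) e e0.
have [K K0 HK] := speed_bounded T (Y + 1).
pose d := Num.min d' 1.
have d0 : 0 < d by rewrite lt_min d'0 ltr01.
have [dd' d1] : d <= d' /\ d <= 1 by rewrite !ge_min !lexx orbT.
clearbody d.
have Ke0 : 0 < 2 * (K + e) by lra.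
pose r := Num.min d (d / (2 * (K + e))).
have r0 : 0 < r by rewrite lt_min d0 divr_gt0.
have [rd rK] : r <= d /\ r * (2 * (K + e)) <= d.
  rewrite ge_min lexx; split => //.
  by rewrite -ler_pdivlMr// ge_min lexx orbT.
clearbody r.
exists r => // t s xi tT sT xi0 rxi yY st.
have y0 := mass_inverse_ge0 xi0 rxi.
have my := mass_inverse_gt xi0 rxi.
have mxi := mass_mass_inverse xi0 rxi.
set x1 := mass_inverse (mu t) xi in yY y0 my mxi *.
set a1 := f^`() (u t x1).
have a1K : `|a1| <= K by apply: HK => //; rewrite y0; lra.
have near_line tau x : 0 <= tau <= T -> `|tau - t| <= d -> 0 <= x -> `|x - x1| <= d ->
    `|f^`() (u tau x) - a1| < e.
  move=> tauT taut x0 xx1; apply: Hd' => //.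
  - by rewrite x0; move: xx1; rewrite ler_norml => /andP[_]; lra.
  - by rewrite y0; lra.
  - exact: le_trans dd'.
  - exact: le_trans dd'.
(* lines of slope c near (t, x1) stay in the box of size d *)
have line_box c x tau : `|c| <= K + e -> x1 - d / 4 <= x <= x1 -> `|tau - t| <= r ->
    forall x', x + c * (tau - t) <= x' <= x + c * (tau - t) + d / 4 -> `|x' - x1| <= d.
  move=> cK /andP[x1' x2'] taut x' /andP[xl xr].
  have : `|c * (tau - t)| <= d / 2.
    rewrite normrM; apply: (@le_trans _ _ ((K + e) * r)); first exact: ler_pM.
    lra.
  by rewrite !ler_norml => /andP[? ?]; apply/andP; split; lra.
have cpK : `|a1 + e| <= K + e.
  by apply: le_trans (ler_normD _ _) _; rewrite (gtr0_norm e0) lerD2r.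
have cmK : `|a1 - e| <= K + e.
  by apply: le_trans (ler_normB _ _) _; rewrite (gtr0_norm e0) lerD2r.
have d40 : 0 < d / 4 by lra.
have fast x t1 t2 : x1 - d / 4 <= x <= x1 -> 0 <= t1 -> t1 < t2 -> t2 <= T ->
    (forall tau, t1 <= tau <= t2 -> `|tau - t| <= r) ->
    mass (mu t1) (x + (a1 + e) * (t1 - t)) <= mass (mu t2) (x + (a1 + e) * (t2 - t)).
  move=> xx1 t10 t12 t2T tr.
  have -> : x + (a1 + e) * (t2 - t) = x + (a1 + e) * (t1 - t) + (a1 + e) * (t2 - t1) by ring.
  apply: (mass_fast_line transport t10 t12 d40) => tau x' tau12 x'0.
  have -> : x + (a1 + e) * (t1 - t) + (a1 + e) * (tau - t1) = x + (a1 + e) * (tau - t) by ring.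
  move=> /(line_box _ _ _ cpK xx1 (tr _ tau12)) x'x1.
  have := near_line tau x' _ _ x'0 x'x1.
  case/andP: tau12 (tr _ tau12) => tau1 tau2 taur.
  rewrite (le_trans t10 tau1) (le_trans tau2 t2T) (le_trans taur rd) => /(_ isT isT).
  by rewrite ltr_norml => /andP[_]; lra.
have slow x t1 t2 : x1 - d / 4 <= x <= x1 -> 0 <= t1 -> t1 < t2 -> t2 <= T ->
    (forall tau, t1 <= tau <= t2 -> `|tau - t| <= r) ->
    mass (mu t2) (x + (a1 - e) * (t2 - t)) <= mass (mu t1) (x + (a1 - e) * (t1 - t)).
  move=> xx1 t10 t12 t2T tr.
  have -> : x + (a1 - e) * (t2 - t) = x + (a1 - e) * (t1 - t) + (a1 - e) * (t2 - t1) by ring.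
  apply: (mass_slow_line transport t10 t12 d40) => tau x' tau12 x'0.
  have -> : x + (a1 - e) * (t1 - t) + (a1 - e) * (tau - t1) = x + (a1 - e) * (tau - t) by ring.
  move=> /(line_box _ _ _ cmK xx1 (tr _ tau12)) x'x1.
  have := near_line tau x' _ _ x'0 x'x1.
  case/andP: tau12 (tr _ tau12) => tau1 tau2 taur.
  rewrite (le_trans t10 tau1) (le_trans tau2 t2T) (le_trans taur rd) => /(_ isT isT).
  by rewrite ltr_norml => /andP[+ _]; lra.
have xx : x1 - d / 4 <= x1 <= x1 by lra.
(* the mass at x1 is transported along an upper line; the lower lines start from
   points x < x1, where the mass is less than xi *)
have conclude cu cl : cu * (s - t) = a1 * (s - t) + e * `|s - t| ->
    cl * (s - t) = a1 * (s - t) - e * `|s - t| ->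
    mass (mu t) x1 <= mass (mu s) (x1 + cu * (s - t)) ->
    (forall x, x1 - d / 4 <= x <= x1 -> mass (mu s) (x + cl * (s - t)) <= mass (mu t) x) ->
    reached (mu s) xi /\
    `|mass_inverse (mu s) xi - x1 - a1 * (s - t)| <= e * `|s - t|.
  move=> cuE clE up low.
  have rs : reached (mu s) xi by exists (x1 + cu * (s - t)); exact: le_trans up.
  split => //.
  have ub : mass_inverse (mu s) xi <= x1 + cu * (s - t).
    by rewrite mass_inverse_le//; exact: le_trans up.
  have lb : x1 + cl * (s - t) <= mass_inverse (mu s) xi.
    rewrite leNgt; apply/negP => H.
    pose x := Num.max (mass_inverse (mu s) xi - cl * (s - t)) (x1 - d / 4).
    have xx1 : x < x1 by rewrite gt_max; apply/andP; split; lra.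
    have : mass (mu t) x < xi by rewrite -my.
    rewrite ltNge => /negP; apply; apply: le_trans (low x _).
      rewrite -mass_inverse_le// -lerBlDr.
      by rewrite le_max lexx.
    by rewrite (ltW xx1) andbT le_max lexx orbT.
  by rewrite ler_norml; apply/andP; split; lra.
have [t0 tT'] := andP tT; have [s0 sT'] := andP sT.
have [ts|sLt|ts] := ltgtP t s.
- have tr tau : t <= tau <= s -> `|tau - t| <= r.
    move=> /andP[? ?]; apply: le_trans st; rewrite !ger0_norm; lra.
  have ast : `|s - t| = s - t by rewrite gtr0_norm ?subr_gt0.
  apply: (conclude (a1 + e) (a1 - e)); rewrite ?ast.
  + by ring.
  + by ring.
  + by have := fast x1 t s xx t0 ts sT' tr; rewrite subrr mulr0 addr0.
  + by move=> x xx1; have := slow x t s xx1 t0 ts sT' tr; rewrite subrr mulr0 addr0.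
- have tr tau : s <= tau <= t -> `|tau - t| <= r.
    move=> /andP[? ?]; apply: le_trans st; rewrite !ler0_norm; lra.
  have ast : `|s - t| = - (s - t) by rewrite ltr0_norm ?subr_lt0.
  apply: (conclude (a1 - e) (a1 + e)); rewrite ?ast.
  + by ring.
  + by ring.
  + by have := slow x1 s t xx s0 sLt tT' tr; rewrite subrr mulr0 addr0.
  + by move=> x xx1; have := fast x s t xx1 s0 sLt tT' tr; rewrite subrr mulr0 addr0.
- by rewrite -ts -/x1; split => //; rewrite !subrr !mulr0 subrr normr0 mulr0.
Qed.

Lemma flow_rel_derive T t xi : 0 <= t <= T -> 0 < xi -> reached (mu t) xi ->
  rel_derive `[0, T] (fun s => mass_inverse (mu s) xi) t (f^`() (lagrangian u mu t xi)).
Proof.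
move=> tT xi0 rxi e e0.
have [r r0 H] := @flow_local T (mass_inverse (mu t) xi) e e0.
exists r => // s; rewrite /= in_itv/= => sT /ltW st.
by have [_] := H t s xi tT sT xi0 rxi (lexx _) st.
Qed.

(** Young's inequality with the weight [(1 + y)^(-1/2)] turns the energy bound into
    linear growth of [u ^+ 2] along a trajectory, hence of the speed, which is at
    most quadratic in [u]. *)
Lemma flow_speed_bound xi : 0 < xi -> exists2 B : R, 0 <= B & forall t : R, 0 <= t ->
  reached (mu t) xi -> `|f^`() (lagrangian u mu t xi)| <= B * (1 + mass_inverse (mu t) xi).
Proof.
move=> xi0; have [C C0 HC] := f'_quadratic f'_derivable f''_lipschitz.
exists (C * (1 + (1 + xi) ^+ 2)); first by rewrite mulr_ge0// addr_ge0// sqr_ge0.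
move=> t t0 rxi; apply: le_trans (HC _) _; rewrite -mulrA ler_wpM2l//.
have y0 := mass_inverse_ge0 xi0 rxi.
rewrite /lagrangian; set y := mass_inverse (mu t) xi in y0 *.
pose s := Num.sqrt (1 + y).
have s2 : s ^+ 2 = 1 + y by rewrite sqr_sqrtr// addr_ge0.
have s0 : 0 < s by rewrite sqrtr_gt0; lra.
have := @domain_mass_inverse_bound _ _ _ xi s^-1 (u_domain t0) xi0 rxi.
rewrite invr_gt0 -/y invrK => /(_ s0) H.
have {}H : `|u t y| <= (1 + xi) * s.
  apply: le_trans H _; rewrite mulrDl mul1r.
  have : s^-1 * y <= s.
    by rewrite mulrC ler_pdivrMr// -expr2 s2; lra.
  have : 0 <= xi * s by rewrite mulr_ge0// ltW.
  lra.
have : u t y ^+ 2 <= ((1 + xi) * s) ^+ 2.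
  rewrite -[X in X <= _]real_normK ?num_real// ler_sqr ?nnegrE//.
  by rewrite mulr_ge0// ltW//; lra.
rewrite exprMn s2 mulrDl mul1r => {}H.
by apply: lerD => //; lra.
Qed.

(** No mass escapes to infinity or enters from there in finite time, because the speed
    of a trajectory grows at most linearly with its position. *)
Lemma flow_reached t s xi : 0 <= t -> 0 <= s -> 0 < xi ->
  reached (mu t) xi -> reached (mu s) xi.
Proof.
move=> t0 s0 xi0; have [B B0 HB] := flow_speed_bound xi0.
pose T := Num.max t s.
apply: (@continuation _ (fun t => reached (mu t) xi) (fun t => mass_inverse (mu t) xi) T B B0).
- move=> Y; have [r r0 H] := @flow_local T Y 1 ltr01.
  by exists r => // a b aT bT ra yY ab; have [] := H a b xi aT bT xi0 ra yY ab.
- move=> a aT ra; split; first exact: mass_inverse_ge0.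
  exists (f^`() (lagrangian u mu a xi)); split; last exact: flow_rel_derive.
  by apply: HB => //; case/andP: aT.
- by rewrite t0 /T le_max lexx.
- by rewrite s0 /T le_max lexx orbT.
Qed.

Lemma flow_bounded T xi : 0 < xi -> reached (mu 0) xi ->
  exists2 Y : R, 0 <= Y & forall t, 0 <= t <= T -> mass_inverse (mu t) xi <= Y.
Proof.
move=> xi0 r0; have [B B0 HB] := flow_speed_bound xi0.
have rt t : 0 <= t -> reached (mu t) xi by move=> t0; exact: flow_reached r0.
have y0 := mass_inverse_ge0 xi0 r0.
exists ((1 + mass_inverse (mu 0) xi) * expR (B * T)).
  by rewrite mulr_ge0 ?expR_ge0// addr_ge0.
move=> t /andP[t0 tT].
have := @exponential_growth _ 0 t (fun t => mass_inverse (mu t) xi)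
  (fun t => f^`() (lagrangian u mu t xi)) B t0.
move=> H; apply: (@le_trans _ _ (1 + mass_inverse (mu t) xi)); first lra.
apply: le_trans (H _ _) _.
- move=> s st; apply: flow_rel_derive => //; apply: rt.
  by case/andP: st.
- move=> s /andP[s0 _]; apply: le_trans (ler_norm _) (HB _ s0 (rt _ s0)).
- by rewrite ler_wpM2l ?addr_ge0// ler_expR ler_wpM2l//; lra.
Qed.

End flow.

(** * Uniqueness for the equations of the characteristics *)
Section absolutely_continuous_functions.
Context {R : realType}.
Notation leb := (@lebesgue_measure R).
Implicit Types (v w : R -> R) (a b c K : R).

Lemma abs_continuous_le a b c v : c <= b ->
  abs_continuous_fun a b v -> abs_continuous_fun a c v.
Proof.
move=> cb H e e0; have [d d0 {}H] := H e e0; exists d => // n s t st dst sd.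
apply: H => // i; have [? [? tc]] := st i; split => //; split => //.
exact: le_trans cb.
Qed.

Lemma abs_continuousB a b v w : abs_continuous_fun a b v -> abs_continuous_fun a b w ->
  abs_continuous_fun a b (fun t => v t - w t).
Proof.
move=> Hv Hw e e0; have e20 : 0 < e / 2 by rewrite divr_gt0.
have [d1 d10 {}Hv] := Hv _ e20; have [d2 d20 {}Hw] := Hw _ e20.
exists (Num.min d1 d2); first by rewrite lt_min d10.
move=> n s t st dst; rewrite lt_min => /andP[sd1 sd2].
have := Hv n s t st dst sd1; have := Hw n s t st dst sd2.
rewrite !sumEFin !lte_fin => sw sv.
have : \sum_(i < n) `|v (t i) - w (t i) - (v (s i) - w (s i))| <=
    \sum_(i < n) `|v (t i) - v (s i)| + \sum_(i < n) `|w (t i) - w (s i)|.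
  rewrite -big_split; apply: ler_sum => i _ /=.
  have -> : v (t i) - w (t i) - (v (s i) - w (s i)) =
    (v (t i) - v (s i)) - (w (t i) - w (s i)) by ring.
  exact: ler_normB.
move: sw sv; set I := \sum_(i < n) `|w _ - _|; set J := \sum_(i < n) `|v _ - v _|.
by set K := \sum_(i < n) _; clearbody I J K; lra.
Qed.

Lemma lipschitz_abs_continuous a b v K :
  (forall s t, a <= s -> s <= t -> t <= b -> `|v t - v s| <= K * (t - s)) ->
  abs_continuous_fun a b v.
Proof.
move=> H e e0; have K0 : 0 < `|K| + 1 by rewrite ltr_wpDl.
exists (e / (`|K| + 1)); first by rewrite divr_gt0.
move=> n s t st _; rewrite ltr_pdivlMr// => sd.
rewrite sumEFin lte_fin; apply: le_lt_trans sd.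
rewrite mulr_suml; apply: ler_sum => i _; have [? [? ?]] := st i.
apply: le_trans (H _ _ _ _ _) _ => //.
rewrite mulrC ler_wpM2l ?subr_ge0//.
by apply: le_trans (ler_norm _) _; rewrite lerDl.
Qed.

Lemma negligible_itv_meet (N : set R) a b : a < b -> leb.-negligible N ->
  exists2 z, a < z <= b & ~ N z.
Proof.
move=> ab nN; apply: contrapT => H.
have sub : `]a, b] `<=` N.
  move=> z; rewrite /= in_itv/= => abz; apply: contrapT => Nz; apply: H.
  by exists z.
have n0 : leb.-negligible `]a, b] by exact: negligibleS nN.
have : leb `]a, b] = 0%E by apply: (@measure_negligible _ _ _ leb) => //; exact: measurable_itv.
rewrite [X in X = _ -> _](lebesgue_measure_bnd false false (ltW ab)).
by move=> -[]; lra.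
Qed.

Lemma ae_conj (P Q : R -> Prop) : {ae leb, forall x, P x} -> {ae leb, forall x, Q x} ->
  {ae leb, forall x, P x /\ Q x}.
Proof.
move=> aP aQ; apply: negligibleS (negligibleU aP aQ) => x /= nPQ.
by apply/not_andP => -[Px Qx]; apply: nPQ.
Qed.

Lemma ae_and (P Q S : R -> Prop) : {ae leb, forall x, P x} -> {ae leb, forall x, Q x} ->
  (forall x, P x -> Q x -> S x) -> {ae leb, forall x, S x}.
Proof.
move=> aP aQ PQS; apply: negligibleS (ae_conj aP aQ) => x /= nS -[Px Qx].
exact: nS (PQS x Px Qx).
Qed.

Lemma le_Rintegral_diff_ae v w a K : 0 <= a -> 0 <= K ->
  leb.-integrable `[0, a] (EFin \o v) -> leb.-integrable `[0, a] (EFin \o w) ->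
  {ae leb, forall x, 0 <= x <= a -> `|v x - w x| <= K} ->
  `|\int[leb]_(x in `[0, a]) v x - \int[leb]_(x in `[0, a]) w x| <= K * a.
Proof.
move=> a0 K0 iv iw vwK.
have m0a : measurable (`[0, a]%classic : set (measurableTypeR R)) by exact: measurable_itv.
have iB : leb.-integrable `[0, a] (EFin \o (fun x => v x - w x)).
  exact: (@integrableB _ _ _ leb _ m0a _ _ iv iw).
rewrite -(@RintegralB _ _ _ leb _ _ _ m0a iv iw).
apply: le_trans (@le_normr_Rintegral _ _ _ leb _ _ m0a iB) _.
have iN := @integrable_norm _ _ _ leb _ _ iB.
have fN : (\int[leb]_(x in `[0%R, a]) (`|v x - w x|%R)%:E)%E \is a fin_num.
  exact: (integrable_fin_num m0a iN).
rewrite -lee_fin /Rintegral fineK//.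
apply: (@le_trans _ _ (\int[leb]_(x in `[0%R, a]) K%:E)%E).
  apply: (@ae_ge0_le_integral _ _ _ leb _ m0a).
  - by move=> x _; rewrite lee_fin.
  - exact: measurable_int iN.
  - by move=> x _; rewrite lee_fin.
  - exact: measurable_cst.
  - by apply: (ae_and vwK vwK) => x H _; rewrite /= in_itv/= lee_fin.
rewrite integral_cst// [Y in (_ * Y)%E](lebesgue_measure_bnd true false a0) subr0.
by rewrite -EFinM lee_fin.
Qed.

Definition left_continuous_at v x := forall e, 0 < e ->
  exists2 y : R, 0 < y < x & forall z, y < z -> z <= x -> `|v z - v x| <= e.

Lemma ae_eq_left_continuous X v w x : {ae leb, forall z, 0 <= z <= X -> v z = w z} ->
  0 < x <= X -> left_continuous_at v x -> left_continuous_at w x -> v x = w x.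
Proof.
move=> vw /andP[x0 xX] cv cw; apply/eqP; rewrite -subr_eq0 -normr_le0.
apply/ler_addgt0Pr => e e0; rewrite add0r.
have e20 : 0 < e / 2 by rewrite divr_gt0.
have [y1 /andP[y10 y1x] H1] := cv _ e20; have [y2 /andP[y20 y2x] H2] := cw _ e20.
have [|z /andP[yz zx] Nz] := @negligible_itv_meet _ (Num.max y1 y2) x _ vw.
  by rewrite gt_max y1x.
move: yz; rewrite gt_max => /andP[y1z y2z].
have vwz : v z = w z.
  apply: contrapT => nvw; apply: Nz => /= E; apply: nvw; apply: E.
  by rewrite (le_trans zx xX) andbT ltW// (lt_trans y10).
have := H1 z y1z zx; have := H2 z y2z zx; rewrite -vwz.
have -> : v x - w x = (v z - w x) - (v z - v x) by ring.
move=> ? ?; apply: le_trans (ler_normB _ _) _; lra.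
Qed.

End absolutely_continuous_functions.

Section system.
Context {R : realType}.
Notation leb := (@lebesgue_measure R).
Variables (f : R -> R) (L : R).
Hypothesis f''_continuous : continuous (f^`(2)).
Hypothesis f''_lipschitz : forall a b : R, `|f^`(2) a - f^`(2) b| <= L * `|a - b|.

(** What the functions [lagrangian u mu] and the functions [U] of the explicit formula
    have in common. Exceptional labels form a negligible set, which the integral on
    the right-hand side does not see. *)
Definition system_solution (X T : R) (V : R -> R -> R) : Prop :=
  [/\ exists K : R, forall t xi : R, 0 <= t <= T -> 0 <= xi <= X -> `|V t xi| <= K,
      forall t : R, 0 <= t <= T -> measurable_fun `[0, X] (V t)
    & {ae leb, forall xi : R, 0 <= xi <= X ->
        abs_continuous_fun 0 T (V^~ xi) /\
        {ae leb, forall t : R, 0 < t < T -> is_derive t 1 (V^~ xi)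
          (2^-1 * \int[leb]_(eta in `[0, xi]) f^`(2) (V t eta))}}].

Section uniqueness.
Variables (X T : R) (V W : R -> R -> R).
Hypotheses (sV : system_solution X T V) (sW : system_solution X T W).
Hypothesis VW0 : forall xi : R, 0 < xi <= X -> V 0 xi = W 0 xi.

Let good xi := 0 < xi <= X /\ forall Z, Z = V \/ Z = W ->
  abs_continuous_fun 0 T (Z^~ xi) /\
  {ae leb, forall t : R, 0 < t < T -> is_derive t 1 (Z^~ xi)
          (2^-1 * \int[leb]_(eta in `[0, xi]) f^`(2) (Z t eta))}.

Let ae_good : {ae leb, forall xi : R, 0 <= xi <= X -> good xi}.
Proof.
have [_ _ aV] := sV; have [_ _ aW] := sW.
have a0 : {ae leb, forall xi : R, xi <> 0}.
  apply: negligibleS (negligible_set1 0) => x /= H.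
  by apply: contrapT => H'; apply: H => x0; apply: H'; rewrite x0.
apply: (ae_and a0 (ae_conj aV aW)) => xi xi0 [HV HW] xiX; split.
  by case/andP: xiX => + ->; rewrite andbT le_eqVlt => /predU1P[E|//]; case: xi0.
by move=> Z [->|->]; [exact: HV|exact: HW].
Qed.

Let lam := `|L| * X + 1.

Let integrable_f'' Z t xi : system_solution X T Z -> 0 <= t <= T -> 0 <= xi <= X ->
  leb.-integrable `[0, xi] (EFin \o (fun eta => f^`(2) (Z t eta))).
Proof.
move=> [[K HK] mZ _] tT /andP[xi0 xiX].
have sub : `[0, xi] `<=` `[0, X] by apply: subset_itvl; rewrite bnd_simp.
apply: (@integrable_bounded _ _ _ leb _ _ (`|f^`(2) 0| + `|L| * K)).
- exact: measurable_itv.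
- by rewrite [Y in (Y < _)%E](lebesgue_measure_bnd true false xi0) ltry.
- apply: (measurableT_comp (continuous_measurable_fun f''_continuous)).
  exact: measurable_funS (measurable_itv _) sub (mZ t tT).
- move=> eta /=; rewrite in_itv/= => /andP[eta0 etaxi].
  by apply: f''_bound => //; apply: HK => //; rewrite eta0 (le_trans etaxi).
Qed.

Let rhs_bound M t xi : 0 <= M -> 0 <= t <= T -> 0 <= xi <= X ->
  (forall eta, good eta -> `|V t eta - W t eta| <= M) ->
  `|2^-1 * \int[leb]_(eta in `[0, xi]) f^`(2) (V t eta) -
    2^-1 * \int[leb]_(eta in `[0, xi]) f^`(2) (W t eta)| <= 2^-1 * (`|L| * M * xi).
Proof.
move=> M0 tT /andP[xi0 xiX] HM.
have iV := @integrable_f'' V t xi sV tT; have iW := @integrable_f'' W t xi sW tT.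
rewrite xi0 xiX in iV iW; have {}iV := iV isT; have {}iW := iW isT.
rewrite -mulrBr normrM ger0_norm ?invr_ge0// ler_wpM2l ?invr_ge0//.
apply: (le_Rintegral_diff_ae xi0 _ iV iW); first by rewrite mulr_ge0.
apply: (ae_and ae_good ae_good) => x gx _ /andP[x0 xxi].
have {}gx : good x by apply: gx; rewrite x0 (le_trans xxi).
apply: le_trans (f''_lipschitz _ _) _.
apply: le_trans (ler_wpM2r _ (ler_norm L)) _ => //.
by rewrite ler_wpM2l// HM.
Qed.

(** The supremum [M] of [expR (- lam * t) * `|V t xi - W t xi|] over the labels for
    which both equations hold satisfies [M <= M / 2]. *)
Lemma system_unique : 0 <= X -> 0 <= T ->
  {ae leb, forall xi : R, 0 <= xi <= X -> forall t, 0 <= t <= T -> V t xi = W t xi}.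
Proof.
move=> X0 T0; apply: (ae_and ae_good ae_good) => xi0 gxi0 _ xi0X t0 t0T.
have {}gxi0 := gxi0 xi0X.
pose D t xi := V t xi - W t xi.
pose S := [set r : R | exists t xi : R, [/\ 0 <= t <= T, good xi &
  r = expR (- lam * t) * `|D t xi|]].
have lam0 : 0 < lam by rewrite ltr_wpDl// mulr_ge0.
have Sr0 : S (expR (- lam * t0) * `|D t0 xi0|) by exists t0, xi0.
have [[K HK] _ _] := sV; have [[K' HK'] _ _] := sW.
have supS : has_sup S.
  split; first by exists (expR (- lam * t0) * `|D t0 xi0|).
  exists (K + K') => r [t [xi [tT [/andP[xi0' xiX] _] ->]]].
  have xi0X' : 0 <= xi <= X by rewrite (ltW xi0').
  apply: (@le_trans _ _ `|D t xi|).
    rewrite ler_piMl// -expR0 ler_expR mulNr oppr_le0 mulr_ge0// ?(ltW lam0)//.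
    by case/andP: tT.
  by apply: le_trans (ler_normB _ _) _; rewrite lerD ?HK ?HK'.
pose M := sup S.
have MS r : S r -> r <= M by move=> Sr; exact: ub_le_sup supS.2 _ Sr.
have M0 : 0 <= M.
  by apply: le_trans (MS _ Sr0); rewrite mulr_ge0 ?expR_ge0.
have DM t xi : 0 <= t <= T -> good xi -> `|D t xi| <= M * expR (lam * t).
  move=> tT gxi; have := MS (expR (- lam * t) * `|D t xi|) (ex_intro _ t (ex_intro _ xi (And3 tT gxi erefl))).
  by rewrite mulNr expRN ler_pdivrMl ?expR_gt0// mulrC.
(* the weight exp (lam t) makes the right-hand side a contraction of ratio 1/2 *)
pose g t : R := M / 2 * expR (lam * t).
have dg (t : R) : is_derive t 1 g (M / 2 * (expR (lam * t) * lam)).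
  have := is_deriveM (is_derive_cst (M / 2) t 1)
    (@is_derive1_comp R expR (fun s => lam * s + 0) t _ _ (is_derive_expR _) (is_derive_affine t lam 0)).
  apply: is_derive_ext; first by apply/funext => s; rewrite /g -[lam * s]addr0.
  by rewrite /GRing.scale/= addr0 /cst; ring.
have ndg s t : s <= t -> g s <= g t.
  by move=> st; rewrite ler_wpM2l ?divr_ge0// ler_expR ler_wpM2l// ltW.
have half t xi Z Z' : 0 <= t <= T -> good xi ->
    (Z = V /\ Z' = W \/ Z = W /\ Z' = V) -> Z t xi - Z' t xi <= M / 2 * expR (lam * t).
  move=> /andP[t0' tT] gxi ZZ.
  have [/andP[xipos xiX] gZ] := gxi.
  have xi0X' : 0 <= xi <= X by rewrite (ltW xipos).
  have [acZ odeZ] : _ := gZ Z (match ZZ with or_introl H => or_introl H.1 | or_intror H => or_intror H.1 end).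
  have [acZ' odeZ'] : _ := gZ Z' (match ZZ with or_introl H => or_intror H.2 | or_intror H => or_introl H.2 end).
  have start : Z 0 xi - Z' 0 xi = 0.
    by apply/eqP; rewrite subr_eq0; apply/eqP; case: ZZ => -[-> ->]; rewrite VW0// xipos.
  apply: (@le_trans _ _ (g t - g 0)); last by rewrite gerBl mulr_ge0 ?divr_ge0 ?expR_ge0.
  have -> : Z t xi - Z' t xi = Z t xi - Z' t xi - (Z 0 xi - Z' 0 xi).
    by rewrite start subr0.
  apply: (@ae_le_increment _ 0 t (fun t => Z t xi - Z' t xi) g) => //.
    by apply: (abs_continuous_le tT); exact: abs_continuousB.
  apply: (ae_and odeZ odeZ') => s dZ dZ' /andP[s0 st].
  have sT : 0 < s < T by rewrite s0 (lt_le_trans st).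
  have sT' : 0 <= s <= T by case/andP: sT => /ltW -> /ltW.
  exists (2^-1 * \int[leb]_(eta in `[0, xi]) f^`(2) (Z s eta) -
    2^-1 * \int[leb]_(eta in `[0, xi]) f^`(2) (Z' s eta)), (M / 2 * (expR (lam * s) * lam)).
  split.
  - exact: (is_deriveB (dZ sT) (dZ' sT)).
  - exact: dg.
  - have := rhs_bound (mulr_ge0 M0 (expR_ge0 (lam * s))) sT' xi0X' (fun eta geta => DM s eta sT' geta) => H.
    have {}H : 2^-1 * \int[leb]_(eta in `[0, xi]) f^`(2) (Z s eta) -
        2^-1 * \int[leb]_(eta in `[0, xi]) f^`(2) (Z' s eta) <=
        2^-1 * (`|L| * (M * expR (lam * s)) * xi).
      apply: le_trans (ler_norm _) _.
      by case: ZZ => -[-> ->]; [exact: H|rewrite distrC; exact: H].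
    apply: le_trans H _.
    have -> : M / 2 * (expR (lam * s) * lam) = 2^-1 * ((M * expR (lam * s)) * lam) by ring.
    rewrite ler_wpM2l ?invr_ge0// mulrAC [X in _ <= X]mulrC ler_wpM2r//.
      by rewrite mulr_ge0 ?expR_ge0.
    apply: (@le_trans _ _ (`|L| * X)); first by rewrite ler_wpM2l.
    by rewrite lerDl.
have M2 : M <= M / 2.
  apply: ge_sup; first by exists (expR (- lam * t0) * `|D t0 xi0|).
  move=> r [t [xi [tT gxi ->]]].
  rewrite mulNr expRN ler_pdivrMl ?expR_gt0// mulrC ler_norml; apply/andP; split.
    have := half t xi W V tT gxi (or_intror (conj erefl erefl)).
    by rewrite /D; lra.
  exact: half t xi V W tT gxi (or_introl (conj erefl erefl)).
have : `|D t0 xi0| <= 0.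
  apply: le_trans (DM _ _ t0T gxi0) _.
  by rewrite mulr_le0_ge0 ?expR_ge0//; lra.
by rewrite normr_le0 subr_eq0 => /eqP.
Qed.

End uniqueness.

End system.

(** * Uniqueness of conservative solutions *)
Section conservative_solutions.
Context {R : realType}.
Notation leb := (@lebesgue_measure R).
Variables (f : R -> R) (L : R).
Hypothesis f'_derivable : forall x : R, derivable (f^`()) x 1.
Hypothesis f''_continuous : continuous (f^`(2)).
Hypothesis f''_lipschitz : forall a b : R, `|f^`(2) a - f^`(2) b| <= L * `|a - b|.

Lemma eq_mass_inverse (nu1 nu2 : @fmeasure R) :
  (forall x, mass nu1 x = mass nu2 x) -> mass_inverse nu1 = mass_inverse nu2.
Proof.
move=> E; apply/funext => xi; rewrite /mass_inverse; congr inf.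
by apply/seteqP; split => x /=; rewrite !massE E.
Qed.

Section one_solution.
Variables (p : @data R) (u : R -> R -> R) (mu : R -> @fmeasure R).
Hypothesis sol : conservative_solution f p u mu.

Let u_domain : forall t : R, 0 <= t -> in_domain (u t, mu t).
Proof. by have [] := sol. Qed.

Let u_hoelder : locally_hoelder Rplus u.
Proof. by have [_ []] := sol. Qed.

Let transport : measure_valued_solution f u p.2 mu.
Proof. by have [] := sol. Qed.

Lemma solution_domain t : 0 <= t -> in_domain (u t, mu t).
Proof. exact: u_domain. Qed.

Lemma solution_initial x : 0 <= x -> u 0 x = p.1 x.
Proof.
by move=> x0; have [_ [_ /(_ 1 ltr01)[_ H _ _ _]] _ _ _] := sol; exact: H.
Qed.

Lemma solution_initial_mass x : mass (mu 0) x = mass p.2 x.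
Proof. by rewrite /mass; have [-> //] := transport; exact: measurable_itv. Qed.

Lemma solution_initial_mass_inverse : mass_inverse (mu 0) = mass_inverse p.2.
Proof. exact: eq_mass_inverse solution_initial_mass. Qed.

Lemma solution_reached t xi : 0 <= t -> 0 < xi -> reached (mu t) xi <-> reached p.2 xi.
Proof.
move=> t0 xi0; have E : reached (mu 0) xi <-> reached p.2 xi.
  by split=> -[x Hx]; exists x; move: Hx; rewrite solution_initial_mass.
have F := flow_reached f'_derivable f''_lipschitz u_hoelder transport u_domain.
by split=> [H|/E H]; [apply/E|]; apply: F H => //.
Qed.

Lemma solution_position_derive T t xi : 0 <= t <= T -> 0 < xi -> reached p.2 xi ->
  rel_derive `[0, T] (fun s => mass_inverse (mu s) xi) t (f^`() (lagrangian u mu t xi)).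
Proof.
move=> tT xi0 rxi.
apply: (flow_rel_derive f'_derivable f''_lipschitz u_hoelder transport) => //.
by apply/solution_reached => //; case/andP: tT.
Qed.

Lemma solution_position_bounded T xi : 0 < xi -> reached p.2 xi ->
  exists2 Y : R, 0 <= Y & forall t, 0 <= t <= T -> mass_inverse (mu t) xi <= Y.
Proof.
move=> xi0 rxi; apply: (flow_bounded f'_derivable f''_lipschitz u_hoelder transport) => //.
by apply/solution_reached.
Qed.

Lemma lagrangian_left_continuous t xi : 0 <= t -> 0 < xi -> reached p.2 xi ->
  left_continuous_at (lagrangian u mu t) xi.
Proof.
move=> t0 xi0 /(solution_reached t0 xi0) rxi e e0.
have [/= cu _ _ _] := u_domain t0.
have y0 := mass_inverse_ge0 xi0 rxi.
have [r r0 Hr] := (within_RplusP _).1 cu _ y0 e e0.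
have [eta eta0xi H] := mass_inverse_left_continuous xi0 rxi r0.
exists eta => // z etaz zxi; have /andP[yl yr] := H z etaz zxi.
have z0 : 0 < z by case/andP: eta0xi => eta0 _; exact: lt_trans etaz.
apply/ltW/Hr; first by apply: mass_inverse_ge0 => //; exact: reached_le rxi.
by rewrite distrC ger0_norm ?subr_ge0//; lra.
Qed.

Lemma lagrangian_measurable X t : 0 <= t -> 0 < X -> reached p.2 X ->
  measurable_fun `[0, X] (lagrangian u mu t).
Proof.
move=> t0 X0 /(solution_reached t0 X0) rX.
(* clamping to [0, X] turns the inverse into a monotone function on R *)
pose cl (z : R) := Num.max 0 (Num.min X z).
have cl0 z : 0 <= cl z by rewrite /cl le_max lexx.
have clX z : cl z <= X by rewrite /cl ge_max (ltW X0) ge_min lexx.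
have clM y z : y <= z -> cl y <= cl z.
  move=> yz; have mm : Num.min X y <= Num.min X z by rewrite le_min !ge_min lexx yz orbT.
  by rewrite /cl ge_max !le_max lexx mm orbT.
have clE z : 0 <= z <= X -> cl z = z.
  by move=> /andP[z0 zX]; rewrite /cl (min_idPr zX) (max_idPr z0).
have mcl : measurable_fun `[0, X] (fun z => mass_inverse (mu t) (cl z)).
  apply: nondecreasing_measurable => // y z /clM.
  have [->|y0] := eqVneq (cl y) 0.
    have [->//|z0 _] := eqVneq (cl z) 0; rewrite mass_inverse0.
    by apply: mass_inverse_ge0; [rewrite lt_neqAle eq_sym z0 cl0|exact: reached_le rX].
  move=> yz; apply: le_mass_inverse => //; first by rewrite lt_neqAle eq_sym y0 cl0.
  exact: reached_le rX.
have cu : continuous (fun x : R => u t (Num.max 0 x)).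
  have [/= c _ _ _] := u_domain t0.
  move=> x; apply/ball_continuousP => e e0.
  have mx0 : 0 <= Num.max 0 x by rewrite le_max lexx.
  have [r r0 Hr] := (within_RplusP _).1 c _ mx0 e e0.
  exists r => // y yx; apply: Hr; first by rewrite le_max lexx.
  apply: le_lt_trans yx; rewrite ler_norml !maxEle.
  have := ler_norm (y - x); have := ler_norm (- (y - x)); rewrite normrN.
  by case: (leP 0 x) => ?; case: (leP 0 y) => ? ? ?; apply/andP; split; lra.
apply: (eq_measurable_fun (fun z => u t (Num.max 0 (mass_inverse (mu t) (cl z))))).
  move=> z; rewrite inE/= in_itv/= => zX; rewrite clE// /lagrangian (max_idPr _)//.
  have [->|z0] := eqVneq z 0; first by rewrite mass_inverse0.
  case/andP: zX => z0' zX; apply: mass_inverse_ge0; last exact: reached_le rX.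
  by rewrite lt_neqAle eq_sym z0 z0'.
exact: (measurableT_comp (continuous_measurable_fun cu) mcl).
Qed.

Lemma lagrangian_system X T : 0 < X -> 0 <= T -> reached p.2 X ->
  system_solution f X T (lagrangian u mu).
Proof.
move=> X0 T0 rX; split.
- have [Y Y0 HY] := solution_position_bounded T X0 rX.
  have [K K0 HK] := u_bounded u_hoelder T Y.
  exists K => t xi tT /andP[xi0 xiX]; apply: HK => //.
  have [t0 _] := andP tT.
  move: xi0; rewrite le_eqVlt => /predU1P[<-|xi0].
    by rewrite mass_inverse0 lexx.
  have rt : reached (mu t) X by apply/solution_reached.
  rewrite mass_inverse_ge0//; last exact: reached_le rt.
  by apply: le_trans (le_mass_inverse _ xiX rt) (HY _ tT).
- by move=> t /andP[t0 _]; exact: lagrangian_measurable.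
- have [_ _ _ _ ode] := sol.
  apply: (ae_and ode ode) => xi {}ode _ /andP[xi0 xiX].
  have [|ac dode] := ode.
    rewrite xi0 (le_trans xiX)//; have [x Hx] := rX.
    exact: le_trans Hx (mass_le_total _ _).
  split; first by apply: (@abs_continuous_le _ 0 (T + 1)); [rewrite lerDl|apply: ac; lra].
  by apply: (ae_and dode dode) => t d _ /andP[t0 _]; apply: d; exact: ltW.
Qed.

(** The differential equation determines the values for almost every label, and left
    continuity in the label extends this to all labels. *)
Lemma lagrangian_unique X T V : 0 < X -> 0 <= T -> reached p.2 X ->
  system_solution f X T V ->
  (forall xi, 0 < xi <= X -> V 0 xi = p.1 (mass_inverse p.2 xi)) ->
  (forall t xi, 0 <= t <= T -> 0 < xi <= X -> left_continuous_at (V t) xi) ->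
  forall t xi, 0 <= t <= T -> 0 < xi <= X -> lagrangian u mu t xi = V t xi.
Proof.
move=> X0 T0 rX sV V0 lV t xi tT xiX.
have [xi0 xiX'] := andP xiX.
have init z : 0 < z <= X -> lagrangian u mu 0 z = V 0 z.
  move=> zX; rewrite V0// /lagrangian solution_initial_mass_inverse solution_initial//.
  by case/andP: zX => z0 zX; apply: mass_inverse_ge0 => //; exact: reached_le rX.
have := system_unique f''_continuous f''_lipschitz (lagrangian_system X0 T0 rX) sV init (ltW X0) T0.
move=> ae; have {}ae : {ae leb, forall z, 0 <= z <= X -> lagrangian u mu t z = V t z}.
  by apply: (ae_and ae ae) => z H _ zX; exact: H.
apply: (ae_eq_left_continuous ae xiX); last exact: lV.
by apply: lagrangian_left_continuous => //; [case/andP: tT|exact: reached_le rX].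
Qed.

Lemma solution_lagrangian t x : 0 <= t -> 0 <= x ->
  u t x = lagrangian u mu t (mass (mu t) x).
Proof. by move=> t0 x0; exact: domain_lagrangian (u_domain t0) x0. Qed.

Lemma lagrangian0 t : 0 <= t -> lagrangian u mu t 0 = 0.
Proof. by move=> t0; rewrite /lagrangian mass_inverse0; have [] := u_domain t0. Qed.

End one_solution.

Section two_solutions.
Variables (p : @data R) (u1 u2 : R -> R -> R) (mu1 mu2 : R -> @fmeasure R).
Hypotheses (sol1 : conservative_solution f p u1 mu1)
           (sol2 : conservative_solution f p u2 mu2).

Lemma lagrangian_eq t xi : 0 <= t -> 0 < xi -> reached p.2 xi ->
  lagrangian u1 mu1 t xi = lagrangian u2 mu2 t xi.
Proof.
move=> t0 xi0 rxi.
apply: (lagrangian_unique sol1 xi0 t0 rxi (lagrangian_system sol2 xi0 t0 rxi)).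
- move=> z /andP[z0 zxi].
  rewrite /lagrangian (solution_initial_mass_inverse sol2) (solution_initial sol2)//.
  by apply: mass_inverse_ge0 => //; exact: reached_le rxi.
- move=> s z /andP[s0 _] /andP[z0 zxi].
  by apply: (lagrangian_left_continuous sol2) => //; exact: reached_le rxi.
- by rewrite t0 lexx.
- by rewrite xi0 lexx.
Qed.

(** Both trajectories start from the same point and have the same speed. *)
Lemma position_eq t xi : 0 <= t -> 0 < xi -> reached p.2 xi ->
  mass_inverse (mu1 t) xi = mass_inverse (mu2 t) xi.
Proof.
move=> t0 xi0 rxi.
apply: (@rel_derive0_eq _ (fun s => mass_inverse (mu1 s) xi)
  (fun s => mass_inverse (mu2 s) xi) (fun s => f^`() (lagrangian u1 mu1 s xi))) => //.
- by rewrite (solution_initial_mass_inverse sol1) (solution_initial_mass_inverse sol2).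
- by move=> s st; exact: (solution_position_derive sol1).
- move=> s st; rewrite lagrangian_eq//; last by case/andP: st.
  exact: (solution_position_derive sol2).
Qed.

End two_solutions.

Lemma le_solution_mass (p : data) (u1 u2 : R -> R -> R) (mu1 mu2 : R -> @fmeasure R) t x :
  conservative_solution f p u1 mu1 -> conservative_solution f p u2 mu2 -> 0 <= t ->
  mass (mu1 t) x <= mass (mu2 t) x.
Proof.
move=> sol1 sol2 t0; have := mass_ge0 (mu1 t) x.
rewrite le_eqVlt => /predU1P[<-|m0]; first exact: mass_ge0.
have r1 : reached (mu1 t) (mass (mu1 t) x) by exists x.
have rp : reached p.2 (mass (mu1 t) x) by apply/(solution_reached sol1 t0 m0).
have r2 : reached (mu2 t) (mass (mu1 t) x) by apply/(solution_reached sol2 t0 m0).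
by rewrite -mass_inverse_le// -(position_eq sol1 sol2)// mass_inverse_le.
Qed.

Theorem conservative_solution_unique (p : data) (u1 u2 : R -> R -> R)
    (mu1 mu2 : R -> @fmeasure R) :
  conservative_solution f p u1 mu1 -> conservative_solution f p u2 mu2 ->
  forall t, 0 <= t -> data_eq (u1 t, mu1 t) (u2 t, mu2 t).
Proof.
move=> sol1 sol2 t t0.
have mE x : mass (mu1 t) x = mass (mu2 t) x.
  by apply/eqP; rewrite eq_le (le_solution_mass x sol1 sol2)// (le_solution_mass x sol2 sol1).
split => [x x0|] /=.
  rewrite (solution_lagrangian sol1)// (solution_lagrangian sol2)// -mE.
  have := mass_ge0 (mu1 t) x; rewrite le_eqVlt => /predU1P[<-|m0].
    by rewrite (lagrangian0 sol1)// (lagrangian0 sol2).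
  apply: (lagrangian_eq sol1 sol2) => //; apply/(solution_reached sol1 t0 m0).
  by exists x.
have [_ _ /= n1 _] := solution_domain sol1 t0.
have [_ _ /= n2 _] := solution_domain sol2 t0.
by apply: eq_measure_mass => // x _.
Qed.

End conservative_solutions.

(** * Truncation of the data *)
Section truncation.
Context {R : realType}.
Notation leb := (@lebesgue_measure R).
Implicit Types (v w g h : R -> R) (nu : @fmeasure R) (n x z e : R).

Definition truncated_measure nu n : @fmeasure R :=
  mrestr nu (measurable_itv `]-oo, n]%R : measurable (_ : set (measurableTypeR R))).

Lemma truncated_measureE nu n (A : set R) :
  truncated_measure nu n A = nu (A `&` `]-oo, n]).
Proof. by []. Qed.

(** Making the function constant on [n, +oo[ erases its energy there, as the absolutely
    continuous part of the restricted measure requires. *)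
Definition truncation (p : data) n : @data R :=
  (fun x => p.1 (Num.min x n), truncated_measure p.2 n).

Lemma mass_truncated nu n x : mass (truncated_measure nu n) x = mass nu (Num.min x n).
Proof.
rewrite /mass truncated_measureE; congr (fine (nu _)).
apply/seteqP; split => y /=; rewrite !in_itv/= le_min.
  by move=> [/andP[-> ->] ->].
by move=> /and3P[-> -> ->].
Qed.

Lemma total_mass_truncated nu n : total_mass (truncated_measure nu n) = mass nu n.
Proof.
rewrite /total_mass /mass truncated_measureE; congr (fine (nu _)).
apply/seteqP; split => y /=; rewrite /Rplus/= !in_itv/= ?andbT.
  by move=> [-> ->].
by move=> /andP.
Qed.

Lemma compactly_supported_truncated nu n : compactly_supported (truncated_measure nu n).
Proof.
exists n; rewrite truncated_measureE [X in nu X](_ : _ = set0) ?measure0//.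
apply/seteqP; split => // y [/=]; rewrite !in_itv/= andbT => ny yn.
by move: ny; rewrite ltNge yn.
Qed.

Lemma mass_inverse_truncated nu n xi : 0 < xi -> xi <= mass nu n ->
  mass_inverse (truncated_measure nu n) xi = mass_inverse nu xi.
Proof.
move=> xi0 xin.
have r1 : reached nu xi by exists n.
have r2 : reached (truncated_measure nu n) xi.
  by exists n; rewrite mass_truncated minxx.
have E x : (mass_inverse (truncated_measure nu n) xi <= x) = (mass_inverse nu xi <= x).
  rewrite !mass_inverse_le// mass_truncated; case: (leP x n) => // nx.
  by rewrite xin; apply/esym/(le_trans xin)/le_mass/ltW.
by apply/eqP; rewrite eq_le E lexx -E lexx.
Qed.

Let shrink (k : nat) : R := k.+1%:R^-1.

Let shrink_gt0 k : 0 < shrink k.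
Proof. by rewrite invr_gt0 ltr0n. Qed.

Let shrink_le1 k : shrink k <= 1.
Proof. by rewrite invf_le1 ?ltr0n// ler1n. Qed.

Let shrink_lt e : 0 < e -> \forall k \near \oo, shrink k < e.
Proof.
move=> e0; have /cvgrPdist_lt/(_ e e0) := @cvg_harmonic R.
apply: filterS => k; rewrite sub0r normrN ger0_norm//.
by rewrite invr_ge0.
Qed.

Lemma integrable_cut h a c n : leb.-integrable `[a, c] (EFin \o h) ->
  leb.-integrable `[a, c] (EFin \o (h \_ `]-oo, n])).
Proof.
have mac : measurable (`[a, c]%classic : set (measurableTypeR R)) by exact: measurable_itv.
have man : measurable (`[a, c] `&` `]-oo, n] : set (measurableTypeR R)).
  by apply: measurableI => //; exact: measurable_itv.
move=> ih; rewrite -restrict_EFin; apply/integrable_restrict => //.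
exact: (@integrableS _ _ _ leb _ _ _ mac man (@subIsetl _ _ _) ih).
Qed.

Lemma square_integrable_itv a c w : 0 <= a -> square_integrable Rplus w ->
  leb.-integrable `[a, c] (EFin \o w).
Proof.
move=> a0 [mw w2].
have acR : `[a, c] `<=` (Rplus : set R).
  by move=> x; rewrite /Rplus/= !in_itv/= andbT => /andP[ax _]; rewrite (le_trans a0).
have mac : measurable (`[a, c]%classic : set (measurableTypeR R)) by exact: measurable_itv.
have mwac : measurable_fun `[a, c] w by exact: measurable_funS measurable_Rplus acR mw.
have iw2 : leb.-integrable `[a, c] (EFin \o (fun x => w x ^+ 2)).
  apply: (@integrableS _ _ _ leb Rplus `[a, c] (EFin \o (fun x => w x ^+ 2)) measurable_Rplus mac acR).
  apply/integrableP; split; first by apply/measurable_EFinP; exact: measurable_funX.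
  by under eq_integral => x _ do rewrite /= ger0_norm ?sqr_ge0//.
have i1 : leb.-integrable `[a, c] (EFin \o (fun=> 2^-1 : R)).
  by apply: integrable_itv_continuous; apply: continuous_subspaceT => x; exact: cvg_cst.
have := integrable_linear (mu := leb) 2^-1 mac iw2 i1.
apply: le_integrable => //; first exact/measurable_EFinP.
move=> x _ /=; rewrite lee_fin; apply: le_trans (ler_norm _).
by apply: le_trans (@le_half_sqr _ 1 (w x) ltr01) _; rewrite divr1; lra.
Qed.

Lemma ramp_cut_cvg h a c n : leb.-integrable `[a, c] (EFin \o h) ->
  \int[leb]_(x in `[a, c]) (h x * (1 - ramp n (shrink k) x)) @[k --> \oo] -->
  \int[leb]_(x in `[a, c]) (h \_ `]-oo, n]) x.
Proof.
move=> ih.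
have hE x : (h \_ `]-oo, n]) x = if x <= n then h x else 0.
  by rewrite patchE mem_setE in_itv.
have mac : measurable (`[a, c]%classic : set (measurableTypeR R)) by exact: measurable_itv.
have mh : measurable_fun `[a, c] h by apply/measurable_EFinP; exact: measurable_int ih.
have H := @dominated_cvg _ _ _ leb _ mac
  (fun k x => (h x * (1 - ramp n (shrink k) x))%:E)
  (EFin \o (h \_ `]-oo, n])) (fun x => `|h x|%:E).
apply: fine_cvg; rewrite fineK; first apply: H.
- move=> k; apply/measurable_EFinP; apply: measurable_funM => //.
  apply: measurable_funB => //; apply: measurable_funTS.
  by apply: continuous_measurable_fun; apply: smooth_continuous; exact: smooth_ramp.
- move=> x _ /=; rewrite hE; apply: cvg_EFin; first by apply: nearW.
  case: (leP x n) => xn.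
    rewrite [X in X @ _ --> _](_ : _ = cst (h x)); first exact: cvg_cst.
    by apply/funext => k /=; rewrite ramp_left// subr0 mulr1.
  apply/cvgrPdist_lt => e e0.
  have xn0 : 0 < x - n by rewrite subr_gt0.
  apply: filterS (shrink_lt xn0) => k kn.
  by rewrite /= ramp_right ?subrr ?mulr0 ?subr0 ?normr0//; lra.
- by [].
- exact: integrable_norm.
- move=> k x _; rewrite lee_fin normrM ler_piMr//.
  have := ramp_ge0 n (shrink k) x; have := ramp_le1 n (shrink k) x => ? ?.
  by rewrite ger0_norm; lra.
- apply: (integrable_fin_num mac).
  exact: integrable_cut.
Qed.

(** Test [v] with [g * (1 - ramp n s)] and let the width [s] of the ramp tend to 0: the
    product rule leaves a term with the derivative of the ramp, which tends to the
    boundary value [v n * g n]. The constant [v n] on the right of [n] contributes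
    the opposite term. *)
Lemma distr_derivative_truncation v w n : 0 < n -> {within Rplus, continuous v} ->
  square_integrable Rplus w -> distr_derivative v w ->
  distr_derivative (fun x => v (Num.min x n)) (w \_ `]-oo, n]).
Proof.
move=> n0 cv [mw w2] vw g sg [a' [b' [a'0 g0']]].
pose a := Num.min a' n / 2; pose c := Num.max b' n + 1.
have m0 : 0 < Num.min a' n by rewrite lt_min a'0.
have a0 : 0 < a by rewrite divr_gt0.
have [aa' an] : a < a' /\ a < n.
  have ma : Num.min a' n <= a' by rewrite ge_min lexx.
  have mn : Num.min a' n <= n by rewrite ge_min lexx orbT.
  by rewrite /a; split; lra.
have nc : n + 1 <= c by rewrite lerD2r le_max lexx orbT.
have bc : b' < c by rewrite /c; apply: ltr_pwDr => //; rewrite le_max lexx.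
have glow x : x <= a -> g x = 0.
  by move=> xa; apply: g0' => /andP[a'x _]; move: xa aa' a'x; clear; lra.
have ghigh x : c <= x -> g x = 0.
  by move=> xa; apply: g0' => /andP[_ a'x]; move: xa bc a'x; clear; lra.
clearbody a c; clear a' b' a'0 g0' m0 aa' bc.
have ac : a <= c by lra.
have acR : `[a, c] `<=` (Rplus : set R).
  by move=> x; rewrite /Rplus/= !in_itv/= andbT => /andP[ax _]; rewrite (le_trans (ltW a0)).
have g0 x : ~ (a <= x <= c) -> g x = 0.
  by move=> /negP; rewrite negb_and -!ltNge => /orP[/ltW/glow//|/ltW/ghigh].
have g'0 x : ~ (a <= x <= c) -> g^`() x = 0.
  move=> /negP; rewrite negb_and -!ltNge => /orP[xa|cx].
    apply: (@is_derive_cst_side _ g x _ 0 false (smooth_is_derive x sg)) => y yx.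
    by apply: glow; rewrite (le_trans yx)// ltW.
  apply: (@is_derive_cst_side _ g x _ 0 true (smooth_is_derive x sg)) => y yx.
  by apply: ghigh; rewrite (le_trans _ yx)// ltW.
have sg' := smooth_derive1 sg.
have cg : {within `[a, c], continuous g} by exact/continuous_subspaceT/smooth_continuous.
have cg' : {within `[a, c], continuous (g^`())} by exact/continuous_subspaceT/smooth_continuous.
have cvac : {within `[a, c], continuous v} by exact: continuous_subspaceW cv.
have mac : measurable (`[a, c]%classic : set (measurableTypeR R)) by exact: measurable_itv.
have ivg' : leb.-integrable `[a, c] (EFin \o (fun x => v x * g^`() x)).
  by apply: integrable_itv_continuous; exact: within_continuousM.
have ig' : leb.-integrable `[a, c] (EFin \o g^`()) by exact: integrable_itv_continuous.
have iw := square_integrable_itv c (ltW a0) (conj mw w2).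
have iwg : leb.-integrable `[a, c] (EFin \o (fun x => w x * g x)).
  have [|z _ Hz] := @EVT_max _ (fun x => `|g x|) a c ac.
    by move=> x; apply: continuous_comp; [exact: cg|exact: norm_continuous].
  have := @integrableZl _ _ _ leb _ mac `|g z| _ iw; apply: le_integrable => //.
    apply/measurable_EFinP; apply: measurable_funM.
      by apply/measurable_EFinP; exact: measurable_int iw.
    by apply: measurable_funTS; apply: continuous_measurable_fun; exact: smooth_continuous.
  move=> x xac /=; rewrite lee_fin !normrM normr_id mulrC ler_wpM2r//.
  exact: Hz.
have test k : \int[leb]_(x in `[a, c]) (v x * g^`() x * (1 - ramp n (shrink k) x)) -
    \int[leb]_(x in `[a, c]) (v x * g x * ramp' n (shrink k) x) =
    - \int[leb]_(x in `[a, c]) (w x * g x * (1 - ramp n (shrink k) x)).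
  pose gk x := g x * (1 + -1 * ramp n (shrink k) x).
  have sgk : smooth gk.
    apply: smoothM => //; apply: smoothD; first exact: smooth_cst.
    by apply: smoothM; [exact: smooth_cst|exact: smooth_ramp].
  have gk' x : gk^`() x = g^`() x * (1 - ramp n (shrink k) x) - g x * ramp' n (shrink k) x.
    have d1 := is_deriveB (is_derive_cst (1 : R) x 1) (is_derive_ramp n (shrink k) x).
    have := is_deriveM (smooth_is_derive x sg) d1.
    rewrite [gk^`() x]derive1E; set D := (X in is_derive _ _ _ X) => d2.
    have -> : 'D_1 gk x = D.
      have [_ <-] := d2; congr ('D_1 _ x); apply/funext => y.
      by rewrite /gk mulN1r.
    by rewrite /D /GRing.scale/= (_ : (cst 1 - ramp n (shrink k)) x = 1 - ramp n (shrink k) x)//; ring.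
  have gk0 x : ~ (a <= x <= c) -> gk x = 0 by move=> /g0; rewrite /gk => ->; rewrite mul0r.
  have := vw gk sgk (ex_intro _ a (ex_intro _ c (conj a0 gk0))).
  rewrite (Rintegral_support leb acR); last first.
    by move=> x _; rewrite /= in_itv/= gk' => xac; rewrite g'0// g0// !mul0r subrr mulr0.
  rewrite (Rintegral_support leb acR); last first.
    by move=> x _; rewrite /= in_itv/= => xac; rewrite gk0// mulr0.
  have cr : {within `[a, c], continuous (fun x => 1 - ramp n (shrink k) x)}.
    apply: within_continuousB; first by apply: continuous_subspaceT => x; exact: cvg_cst.
    by apply: continuous_subspaceT; apply: smooth_continuous; exact: smooth_ramp.
  have i1 : leb.-integrable `[a, c] (EFin \o (fun x => v x * g^`() x * (1 - ramp n (shrink k) x))).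
    apply: integrable_itv_continuous; apply: within_continuousM => //.
    exact: within_continuousM.
  have i2 : leb.-integrable `[a, c] (EFin \o (fun x => v x * g x * ramp' n (shrink k) x)).
    apply: integrable_itv_continuous; apply: within_continuousM.
      exact: within_continuousM.
    by apply: continuous_subspaceT; exact: continuous_ramp'.
  rewrite -(@RintegralB _ _ _ leb _ _ _ mac i1 i2) => E.
  transitivity (\int[leb]_(x in `[a, c]) (v x * gk^`() x)).
    by apply: eq_Rintegral => x _; rewrite gk'; ring.
  rewrite E; congr (- _); apply: eq_Rintegral => x _.
  by rewrite /gk mulN1r mulrA.
have lim1 := @ramp_cut_cvg _ _ _ n ivg'.
have lim2 := @ramp_cut_cvg _ _ _ n iwg.
have lim3 : \int[leb]_(x in `[a, c]) (v x * g x * ramp' n (shrink k) x) @[k --> \oo] --> v n * g n.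
  have cvg' : {within `[a, c], continuous (fun x => v x * g x)} by exact: within_continuousM.
  apply/cvgrPdist_le => e e0.
  have nac : (`[a, c] : set R) n by rewrite /= in_itv/=; apply/andP; split; lra.
  have [r r0 Hr] := (within_epsP _ _).1 cvg' n nac e e0.
  apply: filterS (shrink_lt r0) => k kr; rewrite distrC.
  have := shrink_gt0 k; have := shrink_le1 k => s1 s0.
  apply: (@ramp'_approx _ (fun x => v x * g x)) => //; [lra|lra|].
  move=> x /andP[nx xn]; apply/ltW/Hr; first by rewrite /= in_itv/=; apply/andP; split; lra.
  by rewrite ger0_norm; lra.
have E1 : \int[leb]_(x in `[a, c]) ((fun x => v x * g^`() x) \_ `]-oo, n]) x - v n * g n =
    - \int[leb]_(x in `[a, c]) ((fun x => w x * g x) \_ `]-oo, n]) x.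
  have L : \int[leb]_(x in `[a, c]) (v x * g^`() x * (1 - ramp n (shrink k) x)) -
      \int[leb]_(x in `[a, c]) (v x * g x * ramp' n (shrink k) x) @[k --> \oo] -->
      \int[leb]_(x in `[a, c]) ((fun x => v x * g^`() x) \_ `]-oo, n]) x - v n * g n.
    exact: cvgB.
  have := @cvgN _ _ _ _ _ _ _ lim2.
  rewrite (_ : - _ = (fun k => \int[leb]_(x in `[a, c]) (v x * g^`() x * (1 - ramp n (shrink k) x)) -
      \int[leb]_(x in `[a, c]) (v x * g x * ramp' n (shrink k) x))); last first.
    by apply/funext => k; rewrite test.
  by move=> R2; apply: (cvg_unique _ L (R2 _)); exact: norm_hausdorff.
rewrite (Rintegral_support leb acR); last first.
  by move=> x _; rewrite /= in_itv/= => xac; rewrite g'0// mulr0.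
rewrite (Rintegral_support leb acR); last first.
  by move=> x _; rewrite /= in_itv/= => xac; rewrite g0// mulr0.
have -> : \int[leb]_(x in `[a, c]) ((w \_ `]-oo, n]) x * g x) =
    \int[leb]_(x in `[a, c]) ((fun x => w x * g x) \_ `]-oo, n]) x.
  by apply: eq_Rintegral => x _; rewrite !patchE; case: ifP => // _; rewrite mul0r.
rewrite -E1.
have i1 := @integrable_cut _ _ _ n ivg'; have i2 := @integrable_cut _ _ _ n ig'.
have -> : \int[leb]_(x in `[a, c]) (v (Num.min x n) * g^`() x) =
    \int[leb]_(x in `[a, c]) (((fun x => v x * g^`() x) \_ `]-oo, n]) x +
      v n * (g^`() x - (g^`() \_ `]-oo, n]) x)).
  apply: eq_Rintegral => x _; rewrite !patchE mem_setE in_itv/=.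
  have [xn|nx] := boolP (x <= n).
    by rewrite (min_idPl xn) subrr mulr0 addr0.
  move: nx; rewrite -ltNge => /ltW nx.
  by rewrite (min_idPr nx) [point](_ : _ = 0)// add0r subr0.
have i3 : leb.-integrable `[a, c] (EFin \o (fun x => g^`() x - (g^`() \_ `]-oo, n]) x)).
  exact: (@integrableB _ _ _ leb _ mac _ _ ig' i2).
have i4 : leb.-integrable `[a, c] (EFin \o (fun x => v n * (g^`() x - (g^`() \_ `]-oo, n]) x))).
  exact: (@integrableZl _ _ _ leb _ mac (v n) _ i3).
rewrite (@RintegralD _ _ _ leb _ _ _ mac i1 i4) (@RintegralZl _ _ _ leb _ _ _ mac i3).
rewrite (@RintegralB _ _ _ leb _ _ _ mac ig' i2).
rewrite (Rintegral_derive ac (fun x => smooth_is_derive x sg) (smooth_continuous sg')).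
have -> : \int[leb]_(x in `[a, c]) (g^`() \_ `]-oo, n]) x = g n.
  rewrite -(@Rintegral_mkcondr _ _ _ leb `[a, c] `]-oo, n]).
  have -> : (`[a, c] `&` `]-oo, n])%classic = `[a, n]%classic :> set R.
    apply/seteqP; split => x /=; rewrite !in_itv/=; first by move=> [/andP[-> _]].
    by move=> /andP[-> xn]; rewrite xn; split => //=; lra.
  rewrite (Rintegral_derive (ltW an) (fun x => smooth_is_derive x sg) (smooth_continuous sg')).
  by rewrite (glow a)// subr0.
by rewrite (ghigh c)// (glow a)// subrr sub0r mulrN.
Qed.

Lemma in_domain_truncation (p : data) n : 0 < n -> in_domain p -> in_domain (truncation p n).
Proof.
move=> n0 [cv v0 nu0 [w [nua [nus [vw sw [nuE nuac [N [mN N0 nusN]]] nuaE]]]]].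
have mD : measurable (`]-oo, n]%classic : set (measurableTypeR R)) by exact: measurable_itv.
split => /=.
- apply/within_RplusP => x x0 e e0.
  have m0 : 0 <= Num.min x n by rewrite le_min x0 ltW.
  have [r r0 Hr] := (within_RplusP _).1 cv _ m0 e e0.
  exists r => // z z0 zx; apply: Hr; first by rewrite le_min z0 ltW.
  apply: le_lt_trans zx; rewrite ler_norml.
  have := ler_norm (z - x); have := ler_norm (- (z - x)); rewrite normrN.
  by case: (leP z n) => ?; case: (leP x n) => ? ? ?; apply/andP; split; lra.
- by rewrite (min_idPl _) ?ltW.
- apply/eqP; rewrite eq_le measure_ge0 andbT -nu0 truncated_measureE le_measure ?inE//.
    by apply: measurableI => //; apply: measurableC; exact: measurable_Rplus.
  by apply: measurableC; exact: measurable_Rplus.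
exists (w \_ `]-oo, n]), (mrestr nua mD), (mrestr nus mD); split.
- exact: distr_derivative_truncation.
- have [mw w2] := sw.
  have mwn : measurable_fun Rplus (w \_ `]-oo, n]).
    apply/measurable_restrict => //; first exact: measurable_Rplus.
    by apply: measurable_funS mw; [exact: measurable_Rplus|exact: subIsetl].
  split => //; apply: le_lt_trans w2; apply: ge0_le_integral.
  + exact: measurable_Rplus.
  + by move=> x _; rewrite lee_fin sqr_ge0.
  + by apply/measurable_EFinP; exact: measurable_funX.
  + by apply/measurable_EFinP; exact: measurable_funX.
  + move=> x _; rewrite lee_fin patchE; case: ifP => // _.
    by rewrite [point](_ : _ = 0)// expr0n sqr_ge0.
- split.
  + move=> A mA; rewrite truncated_measureE nuE//.
    exact: measurableI.
  + move=> A A0 B mB BA; rewrite /= /mrestr.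
    by apply: (nuac _ A0); [exact: measurableI|exact: subset_trans (@subIsetl _ _ _) BA].
  + exists N; split => //; apply/eqP; rewrite eq_le measure_ge0 andbT -nusN.
    rewrite /= /mrestr le_measure ?inE//; last exact: measurableC.
    by apply: measurableI => //; exact: measurableC.
- move=> A mA; rewrite /= /mrestr nuaE; last exact: measurableI.
  rewrite setIAC integral_mkcondr; apply: eq_integral => x _.
  by rewrite !patchE; case: ifP => //= _; rewrite [point](_ : _ = 0)// expr0n.
Qed.

End truncation.

(** * The explicit formula for truncated data *)
Section explicit.
Context {R : realType}.
Notation leb := (@lebesgue_measure R).
Variables (f : R -> R) (L : R).
Hypothesis f'_derivable : forall x : R, derivable (f^`()) x 1.
Hypothesis f''_continuous : continuous (f^`(2)).
Hypothesis f''_lipschitz : forall a b : R, `|f^`(2) a - f^`(2) b| <= L * `|a - b|.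

Lemma ge0_cases (x : R) : 0 <= x -> 0 = x \/ 0 < x.
Proof. by rewrite le_eqVlt => /predU1P[->|]; [left|right]. Qed.

Lemma domain_zero (v : R -> R) (nu : @fmeasure R) x : in_domain (v, nu) -> 0 <= x ->
  (forall z, z < x -> mass nu z <= 0) -> v x = 0.
Proof.
move=> D x0 H; apply/eqP; rewrite -normr_le0; apply/ler_addgt0Pr => e e0.
have x10 : 0 < x + 1 by lra.
apply: le_trans (@domain_bound _ v nu x 0 (e / (x + 1)) D x0 (lexx 0) _ H) _.
  by rewrite divr_gt0.
rewrite mul0r addr0 add0r.
have : e / (x + 1) * x <= e.
  by rewrite mulrAC ler_pdivrMr// ler_wpM2l//; lra.
have : 0 <= e / (x + 1) * x by rewrite mulr_ge0// divr_ge0// ltW.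
lra.
Qed.

Section initial_zero.
Variable nu : @fmeasure R.

Let S := [set x : R | 0 <= x /\ nu `[0%R, x] = 0%E].

Let initial_positionE : initial_position nu 0 = sup S.
Proof. by rewrite /initial_position eqxx. Qed.

Lemma initial_position0_ge0 : 0 <= initial_position nu 0.
Proof.
rewrite initial_positionE; have [hS|nS] := pselect (has_sup S); last by rewrite sup_out.
by have [x [x0 Hx]] := hS.1; apply: (le_trans x0); apply: ub_le_sup; [exact: hS.2|split].
Qed.

Lemma mass_lt_initial_position0 z : z < initial_position nu 0 -> mass nu z = 0.
Proof.
rewrite initial_positionE; have [hS|nS] := pselect (has_sup S); last first.
  (* the supremum has the default value 0 *)
  by rewrite sup_out//; exact: mass_lt0.
move=> zS; have e0 : 0 < sup S - z by rewrite subr_gt0.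
have [x [x0 Hx]] := sup_adherent e0 hS; rewrite subKr => zx.
apply/eqP; rewrite eq_le mass_ge0 andbT; apply: le_trans (le_mass nu (ltW zx)) _.
by rewrite /mass Hx.
Qed.

Lemma initial_position0_le xi : 0 < xi -> reached nu xi ->
  initial_position nu 0 <= mass_inverse nu xi.
Proof.
move=> xi0 rxi; rewrite leNgt; apply/negP => /mass_lt_initial_position0 m0.
by have := mass_mass_inverse xi0 rxi; rewrite m0 leNgt xi0.
Qed.

End initial_zero.

Variables (p : @data R) (u : R -> R -> R) (mu : R -> @fmeasure R).
Hypothesis p_domain : in_domain p.
Hypothesis sol : conservative_solution f p u mu.
Variables (n : R) (U : R -> R -> R).
Hypothesis n0 : 0 < n.
Hypothesis solU : characteristic_solution f (truncation p n) U.

Let X := mass p.2 n.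

Let X0 : 0 <= X. Proof. exact: mass_ge0. Qed.

Let totalE : total_mass (truncation p n).2 = X.
Proof. exact: total_mass_truncated. Qed.

Let U_continuous t xi e : 0 <= t -> 0 <= xi <= X -> 0 < e -> exists2 r : R, 0 < r &
  forall s eta, 0 <= s -> 0 <= eta <= X -> `|s - t| < r -> `|eta - xi| < r ->
  `|U s eta - U t xi| < e.
Proof.
move=> t0 xiX e0; have [cU _ _] := solU; rewrite totalE in cU.
move/subspace_continuousP : cU => /(_ (t, xi)) cU.
have /cvgrPdist_lt/(_ e e0) := cU (conj t0 xiX).
rewrite near_withinE => /nbhs_ballP[r r0 Hr]; exists r => // s eta s0 etaX st etaxi.
rewrite distrC; apply: (Hr (s, eta)); last by split.
by split; rewrite /ball/= distrC.
Qed.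

Let U_bounded T : exists K : R, forall t xi : R, 0 <= t <= T -> 0 <= xi <= X -> `|U t xi| <= K.
Proof.
have [T0|T0] := ltP T 0.
  by exists 0 => t xi /andP[t0 tT]; move: T0; rewrite ltNge (le_trans t0 tT).
have cB : compact (`[0, T] `*` `[0, X] : set (R * R)).
  by apply: compact_setX; exact: segment_compact.
have [||z _ Hz] := @compact_EVT_max _ R (fun z : R * R => `|U z.1 z.2|) _ _ cB.
- by exists (0, 0); split; rewrite /= in_itv/= lexx.
- apply/subspace_continuousP => -[t xi] [/=]; rewrite !in_itv/= => /andP[t0 tT] xiX.
  apply/cvgrPdist_lt => e e0; have [r r0 Hr] := U_continuous t0 xiX e0.
  rewrite near_withinE; apply/nbhs_ballP; exists r => // -[s eta] [/=].
  rewrite /ball/= => st etaxi [/=]; rewrite !in_itv/= => /andP[s0 _] etaX.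
  apply: le_lt_trans (ler_dist_dist _ _) _; rewrite distrC.
  by apply: Hr => //; rewrite distrC.
exists `|U z.1 z.2| => t xi tT xiX; apply: (Hz (t, xi)).
by rewrite inE; split; rewrite /= in_itv.
Qed.

Let U_slice t : 0 <= t -> {within `[0, X], continuous (U t)}.
Proof.
move=> t0; apply/within_epsP => xi; rewrite /= in_itv/= => xiX e e0.
have [r r0 Hr] := U_continuous t0 xiX e0; exists r => // eta; rewrite in_itv/= => etaX etaxi.
by apply: Hr => //; rewrite subrr normr0.
Qed.

Let U_time T xi : 0 <= xi <= X -> {within `[0, T], continuous (U^~ xi)}.
Proof.
move=> xiX; apply/within_epsP => t; rewrite /= in_itv/= => /andP[t0 _] e e0.
have [r r0 Hr] := U_continuous t0 xiX e0; exists r => // s; rewrite in_itv/= => /andP[s0 _] st.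
by apply: Hr => //; rewrite subrr normr0.
Qed.

Let U_measurable t : 0 <= t -> measurable_fun `[0, X] (U t).
Proof.
by move=> t0; apply: subspace_continuous_measurable_fun => //; exact: U_slice.
Qed.

Let U_derive (t xi : R) : 0 < t -> 0 <= xi <= X ->
  is_derive t 1 (U^~ xi) (2^-1 * \int[leb]_(eta in `[0, xi]) f^`(2) (U t eta)).
Proof. by move=> t0 xiX; have [_ _] := solU; rewrite totalE; exact. Qed.

Let U_lipschitz T : exists K : R, forall xi s t : R, 0 <= xi <= X ->
  0 <= s -> s <= t -> t <= T -> `|U t xi - U s xi| <= K * (t - s).
Proof.
have [K HK] := U_bounded T.
pose B := `|f^`(2) 0| + `|L| * K.
exists (2^-1 * (B * X)) => xi s t xiX s0 st tT.
have [c] : exists2 c, c \in `[s, t]%R & U t xi - U s xi =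
    (2^-1 * \int[leb]_(eta in `[0, xi]) f^`(2) (U c eta)) * (t - s).
  move: (st); rewrite le_eqVlt => /predU1P[<-|slt].
    by exists s; rewrite ?in_itv/= ?lexx// !subrr mulr0.
  have [||c cst E] := @MVT R (U^~ xi) (fun c => 2^-1 * \int[leb]_(eta in `[0, xi]) f^`(2) (U c eta)) s t slt.
  - by move=> c; rewrite in_itv/= => /andP[sc _]; apply: U_derive => //; exact: le_lt_trans sc.
  - apply: continuous_subspaceW (@U_time T xi xiX) => c /=; rewrite !in_itv/= => /andP[sc ct].
    by rewrite (le_trans s0 sc) (le_trans ct).
  - by exists c => //; move: cst; rewrite !in_itv/= => /andP[/ltW -> /ltW ->].
rewrite in_itv/= => /andP[sc ct] ->; rewrite normrM [`|t - s|]ger0_norm ?subr_ge0//.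
rewrite ler_wpM2r ?subr_ge0// normrM ger0_norm ?invr_ge0// ler_wpM2l ?invr_ge0//.
have c0 : 0 <= c by exact: le_trans sc.
have [xi0 xiX'] := andP xiX.
have fB eta : 0 <= eta <= xi -> `|f^`(2) (U c eta)| <= B.
  move=> /andP[eta0 etaxi]; apply: f''_bound => //; apply: HK.
    by rewrite c0 (le_trans ct).
  by rewrite eta0 (le_trans etaxi).
have B0 : 0 <= B by apply: le_trans (fB 0 _); rewrite ?lexx.
have m0 : measurable (`[0, xi]%classic : set (measurableTypeR R)) by exact: measurable_itv.
have i1 : leb.-integrable `[0, xi] (EFin \o (fun eta => f^`(2) (U c eta))).
  apply: (@integrable_bounded _ _ _ leb _ _ B) => //.
  - by rewrite [Y in (Y < _)%E](lebesgue_measure_bnd true false xi0) ltry.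
  - apply: (measurableT_comp (continuous_measurable_fun f''_continuous)).
    apply: measurable_funS (measurable_itv _) _ (U_measurable c0).
    by apply: subset_itvl; rewrite bnd_simp.
have i2 : leb.-integrable `[0, xi] (EFin \o (fun=> 0 : R)).
  by apply: integrable_itv_continuous; apply: continuous_subspaceT => x; exact: cvg_cst.
have := @le_Rintegral_diff_ae _ _ _ xi B xi0 B0 i1 i2.
rewrite Rintegral_cst// mul0r subr0 => H; apply: le_trans (H _) _.
  by apply: aeW => eta etaxi; rewrite subr0; exact: fB.
by rewrite ler_wpM2l.
Qed.

Lemma characteristic_system T : 0 <= T -> system_solution f X T U.
Proof.
move=> T0; split.
- exact: U_bounded.
- by move=> t /andP[t0 _]; exact: U_measurable.
- apply: aeW => xi xiX; split.
    have [K HK] := U_lipschitz T.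
    by apply: (@lipschitz_abs_continuous _ _ _ _ K) => s t; exact: HK.
  by apply: aeW => t /andP[t0 _]; exact: U_derive.
Qed.

Let reachedX xi : xi <= X -> reached p.2 xi.
Proof. by move=> xiX; exists n. Qed.

(** The equation for the label [xi] involves only labels in [[0, xi]], so the truncation
    does not change it for [xi <= X]. *)
Lemma characteristic_lagrangian t xi : 0 <= t -> 0 < xi <= X ->
  lagrangian u mu t xi = U t xi.
Proof.
move=> t0 xiX; have [xi0 xiX'] := andP xiX.
have Xpos : 0 < X by exact: lt_le_trans xiX'.
apply: (lagrangian_unique f'_derivable f''_continuous f''_lipschitz sol Xpos t0
  (reachedX (lexx _)) (characteristic_system t0)) => //; last by rewrite t0 lexx.
- move=> z /andP[z0 zX]; have [_ HU _] := solU.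
  rewrite HU ?totalE ?(ltW z0)// /initial_position gt_eqF//=.
  rewrite mass_inverse_truncated// (min_idPl _)// mass_inverse_le//.
  exact: reachedX.
- move=> s z /andP[s0 st] /andP[z0 zX] e e0.
  have zX' : 0 <= z <= X by rewrite (ltW z0).
  have [r r0 Hr] := U_continuous s0 zX' e0.
  exists (Num.max (z / 2) (z - r / 2)).
    by rewrite lt_max gt_max; apply/andP; split; [apply/orP; left; lra|apply/andP; split; lra].
  move=> y; rewrite gt_max => /andP[y1 y2] yz; apply/ltW/Hr => //.
  + by apply/andP; split; lra.
  + by rewrite subrr normr0.
  + by rewrite ler0_norm; lra.
Qed.

(** The right-hand side of the equation for the label 0 is an integral over a point.
    The initial value is 0, because [p.1] vanishes as long as there is no mass. *)
Lemma characteristic_zero t : 0 <= t -> U t 0 = 0.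
Proof.
move=> t0.
have X00 : 0 <= (0 : R) <= X by rewrite lexx.
have -> : U t 0 = U 0 0.
  apply: (@rel_derive0_eq _ (U^~ 0) (fun=> U 0 0) (fun=> 0) t) => //.
  - move=> s /andP[s0 st]; move: s0; rewrite le_eqVlt => /predU1P[<-|s0]; last first.
      have := U_derive s0 X00; rewrite set_itv1 Rintegral_set1 mulr0.
      exact: is_derive_rel.
    move=> e e0; exists 1 => // r; rewrite /= in_itv/= => /andP[r0 rt] _.
    have [c] : exists2 c, c \in `[0, r]%R & U r 0 - U 0 0 = (fun=> 0) c * (r - 0).
      apply: (@MVT_segment R (U^~ 0)) => //.
        move=> c; rewrite in_itv/= => /andP[c0 _].
        by have := U_derive c0 X00; rewrite set_itv1 Rintegral_set1 mulr0.
      exact: U_time.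
    by move=> _ ->; rewrite subrr normr0 mulr_ge0// ltW.
  - by move=> s _; apply: is_derive_rel; exact: is_derive_cst.
have [_ HU _] := solU; rewrite HU; last by rewrite totalE.
have D := in_domain_truncation n0 p_domain.
apply: (@domain_zero _ (truncation p n).2).
- exact: D.
- exact: initial_position0_ge0.
- by move=> z /mass_lt_initial_position0 ->.
Qed.

Lemma characteristic_position t xi : 0 <= t -> 0 < xi <= X ->
  characteristic f (truncation p n).2 U t xi = mass_inverse (mu t) xi.
Proof.
move=> t0 xiX; have [xi0 xiX'] := andP xiX.
have rxi := reachedX xiX'.
have E0 : initial_position (truncation p n).2 xi = mass_inverse (mu 0) xi.
  rewrite /initial_position gt_eqF//= mass_inverse_truncated//.
  by rewrite (solution_initial_mass_inverse sol).
rewrite /characteristic E0.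
move: t0; rewrite le_eqVlt => /predU1P[<-|t0].
  by rewrite set_itv1 Rintegral_set1 addr0.
have dy s : 0 <= s <= t -> rel_derive `[0, t] (fun s => mass_inverse (mu s) xi) s (f^`() (U s xi)).
  move=> st; rewrite -characteristic_lagrangian//; last by case/andP: st.
  exact: (solution_position_derive f'_derivable f''_lipschitz sol).
have cy : {within `[0, t], continuous (fun s => mass_inverse (mu s) xi)}.
  by apply: (@rel_derive_continuous _ _ _ (fun s => f^`() (U s xi))) => s /=; rewrite in_itv/=; exact: dy.
have cf : {within `[0, t], continuous (fun s => f^`() (U s xi))}.
  have xiX2 : 0 <= xi <= X by rewrite (ltW xi0).
  move=> s; apply: (@continuous_comp _ _ _ (U^~ xi : subspace `[0, t] -> R) (f^`())).
    exact: (@U_time t xi xiX2 s).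
  exact: (continuous_f' f'_derivable).
have din s : 0 < s < t -> is_derive s 1 (fun s => mass_inverse (mu s) xi) (f^`() (U s xi)).
  move=> st; apply: rel_derive_interior (st) (dy _ _).
  by case/andP: st => /ltW -> /ltW ->.
rewrite [X in _ + X](_ : _ = mass_inverse (mu t) xi - mass_inverse (mu 0) xi).
  by rewrite addrC subrK.
rewrite /Rintegral (@continuous_FTC2 _ (fun s => f^`() (U s xi)) (fun s => mass_inverse (mu s) xi))//.
- have [c1 c2 c3] := (continuous_within_itvP _ t0).1 cy.
  by split => // s; rewrite in_itv/= => /din[].
- move=> s; rewrite in_itv/= => /din[_ E].
  have := derive1E (fun s => mass_inverse (mu s) xi) s.
  by move=> ->; exact: E.
Qed.

(** The label 0 moves with the constant speed [f' 0]. A small positive label starts on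
    its right, and moves with nearly the same speed: by the energy bound [u] is small
    along its trajectory. So it ends on the right of the label 0, up to a small
    error. *)
Lemma characteristic_position0_le t xi : 0 <= t -> 0 < xi <= X ->
  characteristic f (truncation p n).2 U t 0 <= mass_inverse (mu t) xi.
Proof.
move=> t0 xiX; have [xi0 xiX'] := andP xiX.
have rxi := reachedX xiX'.
have -> : characteristic f (truncation p n).2 U t 0 =
    initial_position (truncation p n).2 0 + f^`() 0 * t.
  rewrite /characteristic; congr (_ + _).
  transitivity (\int[leb]_(s in `[0, t]) f^`() 0).
    by apply: eq_Rintegral => s; rewrite inE/= in_itv/= => /andP[s0 _]; rewrite characteristic_zero.
  by rewrite Rintegral_cst// [Y in fine Y](lebesgue_measure_bnd true false t0) subr0.
apply/ler_addgt0Pr => e e0.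
have t10 : 0 < t + 1 by lra.
have e'0 : 0 < e / (t + 1) by rewrite divr_gt0.
have [d d0 Hd] := (ball_continuousP _ _).1 (continuous_f' f'_derivable (x := (0 : R))) _ e'0.
have [Y Y0 HY] := solution_position_bounded f'_derivable f''_lipschitz sol t xi0 rxi.
(* along the trajectory of a label z, 2 |u| <= l Y + z / l, with l Y < d and z / l <= d *)
pose l := d / (Y + 1).
have Y10 : 0 < Y + 1 by lra.
have l0 : 0 < l by rewrite divr_gt0.
have lY : l * Y < d by rewrite mulrAC ltr_pdivrMr// ltr_pM2l//; lra.
pose z := Num.min xi (l * d).
have z0 : 0 < z by rewrite lt_min xi0 mulr_gt0.
have zxi : z <= xi by rewrite ge_min lexx.
have zl : z / l <= d by rewrite ler_pdivrMr// mulrC ge_min lexx orbT.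
clearbody l z.
have zX : 0 < z <= X by rewrite z0 (le_trans zxi).
have rt s : 0 <= s -> reached (mu s) xi.
  by move=> s0; apply/(solution_reached f'_derivable f''_lipschitz sol s0 xi0).
apply: (@le_trans _ _ (mass_inverse (mu t) z + e)); last first.
  by rewrite lerD2r; apply: le_mass_inverse => //; exact: rt.
rewrite -(characteristic_position t0 zX) /characteristic.
have H1 : initial_position (truncation p n).2 0 <= initial_position (truncation p n).2 z.
  have -> : initial_position (truncation p n).2 z = mass_inverse (truncation p n).2 z.
    by rewrite /initial_position gt_eqF.
  apply: initial_position0_le => //; exists n; rewrite mass_truncated minxx.
  by case/andP: zX.
have H2 : (f^`() 0 - e / (t + 1)) * t <= \int[leb]_(s in `[0, t]) f^`() (U s z).
  have -> : (f^`() 0 - e / (t + 1)) * t = \int[leb]_(s in `[0, t]) (f^`() 0 - e / (t + 1)).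
    by rewrite Rintegral_cst// [W in fine W](lebesgue_measure_bnd true false t0) subr0.
  have zX2 : 0 <= z <= X by case/andP: zX => /ltW -> ->.
  apply: le_Rintegral => //.
  - by apply: integrable_itv_continuous; apply: continuous_subspaceT => x; exact: cvg_cst.
  - apply: integrable_itv_continuous => s.
    apply: (@continuous_comp _ _ _ (U^~ z : subspace `[0, t] -> R) (f^`())).
      exact: (@U_time t z zX2 s).
    exact: (continuous_f' f'_derivable).
  - move=> s; rewrite /= in_itv/= => /andP[s0 st].
    have rs : reached (mu s) z by apply: reached_le (rt _ s0).
    have := Hd (U s z); rewrite subr0 => Hs.
    suff : `|f^`() (U s z) - f^`() 0| < e / (t + 1).
      by rewrite ltr_norml => /andP[+ _]; lra.
    apply: Hs; rewrite -characteristic_lagrangian//.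
    apply: le_lt_trans (domain_mass_inverse_bound (solution_domain sol s0) z0 rs l0) _.
    have : l * mass_inverse (mu s) z <= l * Y.
      rewrite ler_wpM2l ?(ltW l0)//; apply: (le_trans (le_mass_inverse z0 zxi (rt _ s0))).
      by apply: HY; rewrite s0.
    lra.
have H3 : e / (t + 1) * t <= e.
  by rewrite mulrAC ler_pdivrMr// ler_wpM2l//; lra.
move: H1 H2 H3; set I1 := \int[leb]_(s in _) _; clearbody I1.
rewrite mulrBl; lra.
Qed.

(** A label is carried into [[0, x]] when its trajectory ends there, which by the
    Galois connection means that it is at most [mass (mu t) x]. The label 0 may be an
    exception, whence the two cases of the proof. *)
Lemma explicit_mass t (q : @data R) x : 0 <= t ->
  (forall J, measurable J -> J `<=` Rplus ->
       q.2 J = leb [set xi : R | 0 <= xi <= X /\ J (characteristic f (truncation p n).2 U t xi)]) ->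
  mass q.2 x = Num.min X (mass (mu t) x).
Proof.
move=> t0 Hq; set c := Num.min X (mass (mu t) x).
have c0 : 0 <= c by rewrite le_min X0 mass_ge0.
rewrite /mass Hq; last 2 first.
- exact: measurable_itv.
- by apply: subset_itvl.
set E := [set xi : R | _].
have EP xi : 0 < xi -> E xi <-> xi <= c.
  move=> xi0; rewrite /E/= /c le_min; split.
    move=> [/andP[_ xiX]]; rewrite in_itv/= characteristic_position ?xi0// xiX => /andP[_].
    rewrite mass_inverse_le//; apply/(solution_reached f'_derivable f''_lipschitz sol t0 xi0).
    exact: reachedX.
  move=> /andP[xiX xim]; rewrite (ltW xi0) xiX; split => //.
  have rt : reached (mu t) xi.
    by apply/(solution_reached f'_derivable f''_lipschitz sol t0 xi0); exact: reachedX.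
  by rewrite in_itv/= characteristic_position ?xi0// mass_inverse_le// xim mass_inverse_ge0.
have E0 xi : E xi -> 0 <= xi by move=> [/andP[]].
have [E00|E00] := pselect (E 0).
  have -> : E = `[0, c]%classic.
    apply/seteqP; split => xi; rewrite /= in_itv/=.
      move=> Exi; have xi0 := E0 _ Exi; rewrite xi0/=.
      by have [<-//|xip] := ge0_cases xi0; apply/EP.
    by move=> /andP[/ge0_cases[<-//|xi0]] /(EP _ xi0).
  by rewrite [Y in fine Y](lebesgue_measure_bnd true false c0) subr0.
have -> : E = `]0, c]%classic.
  apply/seteqP; split => xi; rewrite /= in_itv/=.
    move=> Exi; have /ge0_cases[x00|xi0] := E0 _ Exi.
      by exfalso; apply: E00; rewrite x00.
    by rewrite xi0; apply/EP.
  by move=> /andP[xi0 xic]; exact: (EP _ xi0).2 xic.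
by rewrite [Y in fine Y](lebesgue_measure_bnd false false c0) subr0.
Qed.

(** If [x] is on the left of the label 0, then no mass lies on the left of [x], and
    [u t x = 0] by the energy bound, unless [X = 0], when both sides belong to the
    label 0. Otherwise the supremum is the last label whose position is at most
    [x]. *)
Lemma explicit_function t (q : @data R) x : 0 <= t -> 0 <= x ->
  q.1 x = (if x <= characteristic f (truncation p n).2 U t 0 then 0
    else U t (sup [set xi : R | 0 <= xi <= X /\
      characteristic f (truncation p n).2 U t xi <= x])) ->
  q.1 x = lagrangian u mu t (Num.min X (mass (mu t) x)).
Proof.
move=> t0 x0 ->; set c := Num.min X (mass (mu t) x).
have c0 : 0 <= c by rewrite le_min X0 mass_ge0.
have cX : c <= X by rewrite ge_min lexx.
have cm : c <= mass (mu t) x by rewrite ge_min lexx orbT.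
have rt xi : 0 < xi -> xi <= X -> reached (mu t) xi.
  move=> xi0 xiX; apply/(solution_reached f'_derivable f''_lipschitz sol t0 xi0).
  exact: reachedX.
case: ifPn => [xy|].
  have [<-|cp] := ge0_cases c0; [by rewrite (lagrangian0 sol)|clear c0; rename cp into c0].
  have yx : mass_inverse (mu t) c <= x by rewrite mass_inverse_le//; exact: rt.
  have xE : mass_inverse (mu t) c = x.
    apply/eqP; rewrite eq_le yx (le_trans xy)//; apply: characteristic_position0_le => //.
    by rewrite c0.
  rewrite /lagrangian xE; apply/esym/(domain_zero (solution_domain sol t0) x0) => z zx.
  rewrite leNgt; apply/negP => mz.
  pose xi := Num.min X (mass (mu t) z).
  have xi0 : 0 < xi by rewrite lt_min mz andbT (lt_le_trans c0).
  have xiX : xi <= X by rewrite ge_min lexx.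
  have yz : mass_inverse (mu t) xi <= z.
    by rewrite mass_inverse_le ?ge_min ?lexx ?orbT//; exact: rt.
  have := @characteristic_position0_le t xi t0; rewrite xi0 xiX => /(_ isT) H.
  by move: (lt_le_trans zx (le_trans xy (le_trans H yz))); rewrite ltxx.
rewrite -ltNge => yx.
have -> : [set xi : R | 0 <= xi <= X /\ characteristic f (truncation p n).2 U t xi <= x] =
    `[0, c]%classic.
  apply/seteqP; split => xi; rewrite /= in_itv/=.
    move=> [/andP[xi0 xiX]]; rewrite xi0 /c le_min xiX/=.
    have [<- _|xip] := ge0_cases xi0; [exact: mass_ge0|clear xi0; rename xip into xi0].
    by rewrite characteristic_position ?xi0// mass_inverse_le//; exact: rt.
  move=> /andP[xi0 xic]; rewrite xi0 (le_trans xic cX); split; first by [].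
  have [<-|xip] := ge0_cases xi0; [exact: ltW|clear xi0; rename xip into xi0].
  rewrite characteristic_position ?xi0 ?(le_trans xic cX)// mass_inverse_le//.
    exact: le_trans cm.
  by apply: rt => //; exact: le_trans cX.
have -> : sup `[0, c]%classic = c.
  apply/eqP; rewrite eq_le; apply/andP; split.
    apply: ge_sup; first by exists 0; rewrite /= in_itv/= lexx.
    by move=> y; rewrite /= in_itv/= => /andP[].
  apply: ub_le_sup; last by rewrite /= in_itv/= lexx andbT.
  by exists c => y; rewrite /= in_itv/= => /andP[].
have [<-|c0'] := ge0_cases c0.
  by rewrite characteristic_zero// (lagrangian0 sol).
by rewrite characteristic_lagrangian// c0'.
Qed.

End explicit.

(** * Limits of truncated solutions *)
Section measure_distance.
Context {R : realType}.
Notation leb := (@lebesgue_measure R).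
Implicit Types (nu q m : @fmeasure R) (g : R -> R).

Lemma Rintegral_bound1 nu (D : set R) g :
  measurable (D : set (measurableTypeR R)) -> continuous g ->
  (forall x, D x -> `|g x| <= 1) -> `|\int[nu]_(x in D) g x| <= fine (nu D).
Proof.
move=> mD cg g1.
have nuD : (nu D < +oo)%E by rewrite ltey_eq fin_num_measure.
have mg : measurable_fun D g by apply: measurable_funTS; exact: continuous_measurable_fun.
have ig := @integrable_bounded _ _ _ nu D g 1 mD nuD mg g1.
have i1 : nu.-integrable D (EFin \o (fun=> 1 : R)).
  by apply: (@integrable_bounded _ _ _ nu D _ 1 mD nuD) => // x _; rewrite normr1.
apply: le_trans (@le_normr_Rintegral _ _ _ nu D _ mD ig) _.
have -> : fine (nu D) = \int[nu]_(x in D) (1 : R) by rewrite Rintegral_cst// mul1r.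
exact: (@le_Rintegral _ _ _ nu D _ _ mD (@integrable_norm _ _ _ nu _ _ ig) i1 g1).
Qed.

Lemma measure_dist_ge0 q m : (0 <= measure_dist q m)%E.
Proof.
apply: (@le_trans _ _ (`|\int[q]_(x in Rplus) (0 : R) - \int[m]_(x in Rplus) (0 : R)|)%:E).
  by rewrite lee_fin.
apply: ereal_sup_ubound; exists (fun=> 0) => //; split; first exact: smooth_cst.
move=> x _; rewrite derive1_cst normr0; lra.
Qed.

Lemma measure_dist_truncated nu n : 0 <= n ->
  (measure_dist (truncated_measure nu n) nu <= (total_mass nu - mass nu n)%:E)%E.
Proof.
move=> n0; apply: ge_ereal_sup => _ [g [sg Hg] <-]; rewrite lee_fin.
have cg := smooth_continuous sg.
have m1 : measurable (`[0, n]%classic : set (measurableTypeR R)) by exact: measurable_itv.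
have m2 : measurable (`]n, +oo[%classic : set (measurableTypeR R)) by exact: measurable_itv.
have E : Rplus = `[0, n] `|` `]n, +oo[ :> set R.
  apply/seteqP; split => y; rewrite /Rplus/= !in_itv/= !andbT.
    by move=> y0; case: (leP y n) => yn; [left; rewrite y0|right].
  by move=> [/andP[]//|/ltW]; exact: le_trans.
have g1 x : Rplus x -> `|g x| <= 1.
  by rewrite /Rplus/= in_itv/= andbT => /Hg[].
have split_integral q : \int[q]_(x in Rplus) g x =
    \int[q]_(x in `[0, n]) g x + \int[q]_(x in `]n, +oo[) g x.
  have ig : q.-integrable (`[0, n] `|` `]n, +oo[) (EFin \o g).
    rewrite -E; apply: (@integrable_bounded _ _ _ q _ _ 1 measurable_Rplus) => //.
      by rewrite ltey_eq fin_num_measure//; exact: measurable_Rplus.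
    by apply: measurable_funTS; exact: continuous_measurable_fun.
  rewrite {1}E (@Rintegral_setU _ _ _ q _ _ _ m1 m2 ig)//.
  rewrite disj_set2E; apply/eqP/seteqP; split => // y [/=]; rewrite !in_itv/= andbT.
  by move=> /andP[_ yn]; rewrite ltNge yn.
rewrite !split_integral.
have -> : \int[truncated_measure nu n]_(x in `[0, n]) g x = \int[nu]_(x in `[0, n]) g x.
  rewrite /Rintegral; congr fine; apply: eq_measure_integral => A mA An.
  transitivity (nu (A `&` `]-oo, n])); first by [].
  congr (nu _); apply: setIidl => x /An; rewrite /= !in_itv/=; by case/andP.
rewrite opprD addrACA subrr add0r.
have g2 x : `]n, +oo[%classic x -> `|g x| <= 1.
  by rewrite /= in_itv/= andbT => nx; have [] := Hg x _; rewrite // (le_trans n0)// ltW.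
have := Rintegral_bound1 (truncated_measure nu n) m2 cg g2.
rewrite truncated_measureE [X in nu X](_ : _ = set0); last first.
  by apply/seteqP; split => // y [/=]; rewrite !in_itv/= andbT => ny yn; move: ny; rewrite ltNge yn.
rewrite measure0 normr_le0 => /eqP ->; rewrite sub0r normrN.
apply: le_trans (Rintegral_bound1 nu m2 cg g2) _.
have : (nu `]n, +oo[ + nu `[0%R, n] = nu Rplus)%E.
  rewrite E addeC measureU//; apply/seteqP; split => // y [/=]; rewrite !in_itv/= andbT.
  by move=> /andP[_ yn]; rewrite ltNge yn.
rewrite total_massE massE.
have : nu `]n, +oo[ \is a fin_num by rewrite fin_num_measure.
by move=> /fineK <-; rewrite -EFinD => -[<-]; rewrite addrK.
Qed.

Lemma cvge0P (d : nat -> \bar R) : (forall k, (0 <= d k)%E) ->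
  d k @[k --> \oo] --> 0%E <->
  forall e : R, 0 < e -> \forall k \near \oo, (d k < e%:E)%E.
Proof.
move=> d0; split.
  move=> /fine_cvgP[fd /cvgrPdist_lt H] e e0.
  apply: filterS2 fd (H e e0) => k fk; rewrite sub0r normrN => Hk.
  by rewrite -(fineK fk) lte_fin; apply: le_lt_trans (ler_norm _) Hk.
move=> H; apply/fine_cvgP; split.
  apply: filterS (H 1 ltr01) => k Hk.
  by rewrite ge0_fin_numE// (lt_trans Hk) ?ltry.
apply/cvgrPdist_lt => e e0; apply: filterS (H e e0) => k Hk.
have fk : d k \is a fin_num by rewrite ge0_fin_numE// (lt_trans Hk) ?ltry.
by rewrite sub0r normrN ger0_norm ?fine_ge0//= -lte_fin fineK.
Qed.

Lemma ramp'_bounded (z e : R) : 0 < e ->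
  exists2 K : R, 1 <= K & forall x, `|ramp' z e x| <= K.
Proof.
move=> e0; have ze : z <= z + e by rewrite lerDl ltW.
have [|c _ Hc] := @EVT_max _ (ramp' z e) z (z + e) ze.
  exact/continuous_subspaceT/continuous_ramp'.
exists (1 + `|ramp' z e c|); first by rewrite lerDl.
move=> x; rewrite ger0_norm ?ramp'_ge0//.
have [xz|zx] := leP x z; first by rewrite ramp'_left// addr_ge0.
have [zex|xze] := leP (z + e) x; first by rewrite ramp'_right// addr_ge0.
apply: (@le_trans _ _ (ramp' z e c)); last first.
  by apply: le_trans (ler_norm _) _; rewrite lerDr.
by apply: Hc; rewrite in_itv/= !ltW.
Qed.

(** Divided by a bound for its derivative, a decreasing ramp between [a] and [b] is
    admissible in the definition of the metric, and its integral lies between the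
    masses of [[0, a]] and [[0, b]]. So the metric controls distribution functions up
    to a displacement, which right continuity removes. *)
Lemma mass_limit (q : nat -> @fmeasure R) m m' :
  (forall x, \forall k \near \oo, mass (q k) x = mass m' x) ->
  measure_dist (q k) m @[k --> \oo] --> 0%E ->
  forall x, mass m x = mass m' x.
Proof.
move=> qm' /(cvge0P (fun k => measure_dist_ge0 _ _)) qm.
have key a b : a < b -> mass m a <= mass m' b /\ mass m' a <= mass m b.
  move=> ab; pose A x : R := 1 + -1 * ramp a (b - a) x.
  have ba : 0 < b - a by rewrite subr_gt0.
  have sA : smooth A.
    by apply: smoothD; [exact: smooth_cst|apply: smoothM; [exact: smooth_cst|exact: smooth_ramp]].
  have A01 x : 0 <= A x <= 1.
    have := ramp_ge0 a (b - a) x; have := ramp_le1 a (b - a) x.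
    by rewrite /A => ? ?; apply/andP; split; lra.
  have bounds nu : mass nu a <= \int[nu]_(x in Rplus) A x <= mass nu b.
    apply: cutoff_integral_bounds => //; first exact: smooth_continuous.
    - by move=> x xa; rewrite /A ramp_left// mulr0 addr0.
    - by move=> x bx; rewrite /A ramp_right ?mulr1 ?subrr//; lra.
  have [K K1 HK] := ramp'_bounded a ba.
  have K0 : 0 < K by exact: lt_le_trans K1.
  pose g x := K^-1 * A x.
  have sg : smooth g by apply: smoothM => //; exact: smooth_cst.
  have g'E x : g^`() x = K^-1 * - ramp' a (b - a) x.
    have dA : is_derive x 1 A (- ramp' a (b - a) x).
      apply: is_derive_ext (is_deriveB (is_derive_cst (1 : R) x 1) (is_derive_ramp a (b - a) x)).
        by apply/funext => y; rewrite /A mulN1r.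
      by rewrite sub0r.
    have := is_deriveM (is_derive_cst (K^-1) x 1) dA.
    rewrite derive1E => -[_ ->]; rewrite /GRing.scale/= /cst; ring.
  have Ki : K^-1 <= 1 by rewrite invf_le1.
  have gok : [set g : R -> R | smooth g /\
      forall x : R, 0 <= x -> `|g x| <= 1 /\ `|g^`() x| <= 1] g.
    split => // x _; have /andP[A0 A1] := A01 x; split.
      rewrite normrM ger0_norm ?invr_ge0 ?(ltW K0)// (ger0_norm A0).
      by rewrite mulr_ile1// invr_ge0 ltW.
    rewrite g'E normrM normrN ger0_norm ?invr_ge0 ?(ltW K0)//.
    by rewrite ler_pdivrMl// mulr1; exact: HK.
  have gA nu : \int[nu]_(x in Rplus) g x = K^-1 * \int[nu]_(x in Rplus) A x.
    rewrite (@RintegralZl _ _ _ nu _ _ _ measurable_Rplus)//.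
    apply: (@integrable_bounded _ _ _ nu _ _ 1 measurable_Rplus).
    - by rewrite ltey_eq fin_num_measure//; exact: measurable_Rplus.
    - by apply: measurable_funTS; apply: continuous_measurable_fun; exact: smooth_continuous.
    - by move=> x _; have /andP[A0 A1] := A01 x; rewrite ger0_norm.
  have close e : 0 < e -> mass m a <= mass m' b + e /\ mass m' a <= mass m b + e.
    move=> e0; have eK : 0 < e / K by rewrite divr_gt0.
    have [N _ HN] := filterI (qm _ eK) (filterI (qm' a) (qm' b)).
    have [/= d [ea eb]] := HN N (leqnn N).
    have : (`|\int[q N]_(x in Rplus) g x - \int[m]_(x in Rplus) g x|%:E < (e / K)%:E)%E.
      by apply: le_lt_trans d; apply: ereal_sup_ubound; exists g.
    rewrite lte_fin !gA -mulrBr normrM ger0_norm ?invr_ge0 ?(ltW K0)// [e / K]mulrC.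
    rewrite ltr_pM2l ?invr_gt0// ltr_norml => /andP[H1 H2].
    have := bounds (q N); have := bounds m; rewrite ea eb => /andP[h1 h2] /andP[h3 h4].
    move: H1 H2 h1 h2 h3 h4.
    set I1 := \int[q N]_(x in _) _; set I2 := \int[m]_(x in _) _.
    by clearbody I1 I2; clear; split; lra.
  by split; apply/ler_addgt0Pr => e e0; have [] := close e e0.
move=> x; apply/eqP; rewrite eq_le; apply/andP; split; apply/ler_addgt0Pr => e e0.
  have [r r0 Hr] := mass_right_continuous m' x e0.
  have [|H _] := key x (x + r); first by rewrite ltrDl.
  by apply: (le_trans H); exact: ltW.
have [r r0 Hr] := mass_right_continuous m x e0.
have [|_ H] := key x (x + r); first by rewrite ltrDl.
by apply: (le_trans H); exact: ltW.
Qed.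

End measure_distance.

Section semigroup.
Context {R : realType}.
Variables (f : R -> R) (L : R).
Hypothesis f'_derivable : forall x : R, derivable (f^`()) x 1.
Hypothesis f''_continuous : continuous (f^`(2)).
Hypothesis f''_lipschitz : forall a b : R, `|f^`(2) a - f^`(2) b| <= L * `|a - b|.

Lemma truncation_cvg (p : @data R) :
  locally_uniform_cvg (fun k => (truncation p k.+1%:R).1) p.1 /\
  measure_dist (truncation p k.+1%:R).2 p.2 @[k --> \oo] --> 0%E.
Proof.
split.
  move=> M e e0; exists (Num.bound M) => // k /= Mk x /andP[x0 xM].
  have M0 : 0 <= M by exact: le_trans xM.
  rewrite (min_idPl _) ?subrr ?normr0//.
  apply: (le_trans xM); apply/ltW/(lt_le_trans (archi_boundP M0)).
  by rewrite ler_nat ltnW.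
apply/cvge0P; first by move=> k; exact: measure_dist_ge0.
move=> e e0; have [x x0 Hx] := mass_tail p.2 e0.
exists (Num.bound x) => // k /= xk.
apply: le_lt_trans (measure_dist_truncated p.2 (ler0n _ _)) _.
rewrite lte_fin; have : mass p.2 x <= mass p.2 k.+1%:R; last by lra.
apply: le_mass; apply/ltW/(lt_le_trans (archi_boundP x0)).
by rewrite ler_nat ltnW.
Qed.

(** The explicit formula holds for the truncated data and becomes stationary, at each
    point, as the truncation is removed; its limit is the semigroup by continuity. *)
Theorem conservative_solution_semigroup (p : @data R) (S : R -> @data R -> @data R)
    (u : R -> R -> R) (mu : R -> @fmeasure R) :
  in_domain p -> conservative_semigroup f S -> conservative_solution f p u mu ->
  forall t, 0 <= t -> data_eq (u t, mu t) (S t p).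
Proof.
move=> Dp [SD Sexplicit Scontinuous] sol t t0.
pose pn k := truncation p k.+1%:R.
have Dpn k : in_domain (pn k) by apply: in_domain_truncation => //; rewrite ltr0n.
have [c1 c2] := truncation_cvg p.
have [/(_ t) Su /(_ t t0) Smu] := Scontinuous pn p Dpn Dp c1 c2.
have formula k x : mass (S t (pn k)).2 x = Num.min (mass p.2 k.+1%:R) (mass (mu t) x) /\
    (0 <= x -> (S t (pn k)).1 x = lagrangian u mu t (Num.min (mass p.2 k.+1%:R) (mass (mu t) x))).
  have [|U [solU]] := Sexplicit t (pn k) t0 (Dpn k); first exact: compactly_supported_truncated.
  rewrite /= total_mass_truncated => -[H1 H2].
  have k0 : 0 < k.+1%:R :> R by rewrite ltr0n.
  split.
    have E := @explicit_mass R f L f'_derivable f''_continuous f''_lipschitz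
      p u mu sol k.+1%:R U solU t (S t (pn k)) x t0.
    by apply: E; exact: H2.
  move=> x0; apply: (explicit_function f'_derivable f''_continuous f''_lipschitz Dp sol k0 solU t0 x0).
  exact: H1.
(* the labels on the left of x at time t start from a bounded set *)
have stable x : \forall k \near \oo,
    Num.min (mass p.2 k.+1%:R) (mass (mu t) x) = mass (mu t) x.
  have [m0|m0] := ge0_cases (mass_ge0 (mu t) x).
    by apply: nearW => k; rewrite -m0 (min_idPr _)// mass_ge0.
  have rt : reached (mu t) (mass (mu t) x) by exists x.
  have [z Hz] := (solution_reached f'_derivable f''_lipschitz sol t0 m0).1 rt.
  exists (Num.bound `|z|) => // k /= zk; apply/min_idPr.
  apply: (le_trans Hz); apply: le_mass; apply: (le_trans (ler_norm z)).
  apply/ltW/(lt_le_trans (archi_boundP (normr_ge0 z))).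
  by rewrite ler_nat ltnW.
split => [x x0|] /=.
  apply/eqP; rewrite -subr_eq0 -normr_le0; apply/ler_addgt0Pr => e e0; rewrite add0r.
  have [N _ HN] := filterI (Su x e e0) (stable x).
  have [/= Hu Hm] := HN N (leqnn N).
  have {Hu} := Hu t x; rewrite t0 x0 !lexx => /(_ isT isT).
  by rewrite (formula N x).2// Hm -(solution_lagrangian sol t0 x0) => /ltW.
have [_ _ nS _] := SD t p t0 Dp.
have [_ _ /= nmu _] := solution_domain sol t0.
apply: eq_measure_mass => // x _; apply/esym; move: x.
apply: mass_limit Smu => x.
by apply: filterS (stable x) => k Hk; rewrite (formula k x).1 Hk.
Qed.

End semigroup.

Theorem theorem4p1 (R : realType) (f : R -> R) (L : R)
    (f_derivable : forall x, derivable f x 1)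
    (f'_derivable : forall x, derivable (f^`()) x 1)
    (f''_continuous : continuous (f^`(2)))
    (f'0_ge0 : 0 <= f^`() 0)
    (f''_lipschitz : forall a b, `|f^`(2) a - f^`(2) b| <= L * `|a - b|)
    (p : data) (p_domain : in_domain p) :
  (forall S : R -> data -> data, conservative_semigroup f S ->
     forall (u : R -> R -> R) (mu : R -> fmeasure),
       conservative_solution f p u mu ->
       forall t, 0 <= t -> data_eq (u t, mu t) (S t p)) /\
  (forall (u1 u2 : R -> R -> R) (mu1 mu2 : R -> fmeasure),
     conservative_solution f p u1 mu1 ->
     conservative_solution f p u2 mu2 ->
     forall t, 0 <= t -> data_eq (u1 t, mu1 t) (u2 t, mu2 t)).
Proof.
split=> [S semigroup u mu sol|u1 u2 mu1 mu2 sol1 sol2].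
  exact: (conservative_solution_semigroup f'_derivable f''_continuous f''_lipschitz).
exact: (conservative_solution_unique f'_derivable f''_continuous f''_lipschitz sol1 sol2).
Qed.
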